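(* Let $\lambda_1<\lambda_2<\cdots<\lambda_N$ be $N$ distinct real numbers and let $a_1,\ldots,a_N$ be complex numbers. Then: (i) We have $$\lim_{T\to+\infty}\frac{1}{T}\int_{-T/2}^{T/2}\left|\sum_{k=1}^N a_k e^{2i\pi\lambda_k t}\right|\,\mathrm{d}t\;\geq\;\frac{1}{26}\sum_{k=1}^N\frac{|a_k|}{k+1}.$$ (ii) If further $|a_k|\geq 1$ for every $k=1,\ldots,N$, then $$\lim_{T\to+\infty}\frac{1}{T}\int_{-T/2}^{T/2}\left|\sum_{k=1}^N a_k e^{2i\pi\lambda_k t}\right|\,\mathrm{d}t\;\geq\;\frac{4}{\pi^3}\ln N.$$ (iii) If (for arbitrary complex $a_1,\ldots,a_N$) one assumes further that $|\lambda_k-\lambda_\ell|\geq|k-\ell|$ for all $k,\ell=1,\ldots,N$, then for every real $T\geq 72$, $$\frac{1}{T}\int_{-T/2}^{T/2}\left|\sum_{k=1}^N a_k e^{2i\pi\lambda_k t}\right|\,\mathrm{d}t\;\geq\;\frac{1}{122}\sum_{k=1}^N\frac{|a_k|}{k+1}.$$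
   Context: The limits in (i) and (ii) are well known to exist (they are the Besikovitch norms of the almost periodic functions $t\mapsto\sum_{k=1}^N a_k e^{2i\pi\lambda_k t}$). $\ln$ denotes the natural logarithm. *)

(* Defs.v *)
From Stdlib Require Import Reals.
From Coquelicot Require Import Coquelicot.

Open Scope R_scope.

(* Families indexed by 1, ..., N are total functions on nat; only their values
   at 1, ..., N are ever used. *)

Definition Cexp (z : C) : C :=
  (exp (Re z) * cos (Im z), exp (Re z) * sin (Im z)).

Definition trig_sum (N : nat) (a : nat -> C) (lambda : nat -> R) (t : R) : C :=
  sum_n_m (fun k => a k * Cexp (2 * Ci * PI * lambda k * t))%C 1 N.

Definition mean_abs (N : nat) (a : nat -> C) (lambda : nat -> R) (T : R) : R :=
  1 / T * RInt (fun t => Cmod (trig_sum N a lambda t)) (- T / 2) (T / 2).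

Definition weighted_sum (N : nat) (a : nat -> C) : R :=
  sum_n_m (fun k => Cmod (a k) / (INR k + 1)) 1 N.

(* Main.v *)
(* The lower bounds follow the McGehee-Pigno-Smith duality argument, run on the interval
   [-T/2, T/2]. Cut the frequencies into consecutive blocks of sizes rho^i (rho = r^2) and let f_i be
   the block polynomial with coefficients rho^(-i) a_k/|a_k|, so |f_i| <= 1 and its L^2 norm is about
   r^(-i). Since f_i is not T-periodic, |f_i| is first majorized on the interval by the Fejer mean of
   a T-periodic function of nearly the same L^2 norm; doubling its negative frequencies gives h_i
   with spectrum in the nonpositive multiples of 1/T, Re h_i >= |f_i| and L^2 norm at most sqrt 2
   times that of f_i. The multiplier F = sum_i f_i exp(-eps sum_(l>i) h_l) is bounded by
   1/(1 - exp(-eps)), and its coefficient at lambda_k, for k in block j, is close to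
   rho^(-j) a_k/|a_k|: the blocks i >= j are controlled by Cauchy-Schwarz, and the blocks i < j only
   leak through the Fourier transform of the weight at arguments bounded away from 0. Testing the sum
   against F gives the bounds. With weight 1 and T -> oo the leak vanishes; r = 2, eps = 1/4 gives
   1/26 and r = 10, eps = 1.7 gives 4/pi^3. For fixed T >= 72 the tent weight, whose transform decays
   quadratically, with r = 2, eps = 1/8, gives 1/122.
   The limits exist because |f| = sqrt(|f|^2) is a uniform limit of real trigonometric polynomials. *)
Require Import Defs.
From Stdlib Require Import Reals Arith Lra Lia.
From Coquelicot Require Import Coquelicot.
Open Scope R_scope.

(** * Finite sums, complex exponentials and means *)

(** The two properties of h_l serve different ends. Since Re h_l >= |f_l|, the factor exp(-eps h_l)
    is small where |f_l| is large, which keeps F bounded whatever the number of blocks. Since h_l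
    has one-sided spectrum, the damping only lowers frequencies, so a block below j cannot be moved
    up to lambda_k. If all lambda_k were multiples of 1/T its contribution would be exactly zero; in
    general only the sign of the shifted frequency survives, and the resulting leak must be paid
    for. The size of the leak dictates the weight. For weight 1, Cauchy-Schwarz bounds the leak from
    lambda_l by a multiple of ((k-l)T)^(-1/2) for unit gaps, which is not summable uniformly in N
    and is harmless only when T tends to infinity with N fixed. The tent improves this to
    ((k-l)T)^(-3/2), which is summable; the price is that its mean is 1/2 instead of 1. The choice
    of eps balances two losses: the error from the blocks i >= j is linear in eps, while the bound
    1/(1 - exp(-eps)) on F grows like 1/eps. *)

Fixpoint rsum (f : nat -> R) (n : nat) : R :=
  match n with O => 0 | S m => rsum f m + f m end.

Fixpoint csum (f : nat -> C) (n : nat) : C :=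
  match n with O => 0%C | S m => (csum f m + f m)%C end.

Lemma rsum_ext (f g : nat -> R) (n : nat) :
  (forall k, (k < n)%nat -> f k = g k) -> rsum f n = rsum g n.
Proof.
  induction n as [|n IH]; simpl; intros H; auto.
  rewrite IH, H; auto; intros; apply H; lia.
Qed.

Lemma rsum_le (f g : nat -> R) (n : nat) :
  (forall k, (k < n)%nat -> f k <= g k) -> rsum f n <= rsum g n.
Proof.
  induction n as [|n IH]; simpl; intros H; [lra|].
  apply Rplus_le_compat; [apply IH; intros; apply H; lia | apply H; lia].
Qed.

Lemma rsum_ge0 (f : nat -> R) (n : nat) :
  (forall k, (k < n)%nat -> 0 <= f k) -> 0 <= rsum f n.
Proof.
  induction n as [|n IH]; simpl; intros H; [lra|].
  apply Rplus_le_le_0_compat; [apply IH; intros; apply H; lia | apply H; lia].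
Qed.

Lemma rsum_plus (f g : nat -> R) (n : nat) :
  rsum (fun k => f k + g k) n = rsum f n + rsum g n.
Proof. induction n as [|n IH]; simpl; [lra|]. rewrite IH; ring. Qed.

Lemma rsum_scal (c : R) (f : nat -> R) (n : nat) :
  rsum (fun k => c * f k) n = c * rsum f n.
Proof. induction n as [|n IH]; simpl; [lra|]. rewrite IH; ring. Qed.

Lemma rsum_const (c : R) (n : nat) : rsum (fun _ => c) n = INR n * c.
Proof. induction n as [|n IH]; [simpl; lra|]. rewrite S_INR; simpl rsum; rewrite IH; ring. Qed.

Lemma rsum_0 (n : nat) : rsum (fun _ => 0) n = 0.
Proof. rewrite rsum_const; ring. Qed.

Lemma rsum_single (f : nat -> R) (n k : nat) : (k < n)%nat ->
  rsum (fun i => if Nat.eq_dec i k then f i else 0) n = f k.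
Proof.
  intros Hk; induction n as [|n IH]; [lia|]; simpl.
  destruct (Nat.eq_dec n k) as [->|Hn].
  - rewrite (rsum_ext _ (fun _ => 0)), rsum_0; [ring|].
    intros i Hi; destruct (Nat.eq_dec i k); [lia | reflexivity].
  - rewrite IH; [ring | lia].
Qed.

Lemma rsum_le_extend (f : nat -> R) (n m : nat) : (n <= m)%nat ->
  (forall k, 0 <= f k) -> rsum f n <= rsum f m.
Proof. intros H Hf; induction H as [|m H IH]; simpl; [lra|]. specialize (Hf m); lra. Qed.

(** Bounds [A], [B] on the norms replace the norms, so applications need no square roots. The
    induction hypothesis is used at the square roots of the partial sums, and the step is the
    two-dimensional inequality. *)
Lemma rsum_cauchy_schwarz (x y : nat -> R) (A B : R) (n : nat) :
  0 <= A -> 0 <= B ->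
  rsum (fun k => x k ^ 2) n <= A ^ 2 -> rsum (fun k => y k ^ 2) n <= B ^ 2 ->
  rsum (fun k => x k * y k) n <= A * B.
Proof.
  revert A B; induction n as [|n IH]; intros A B HA HB Hx Hy; cbn [rsum] in *; [nra|].
  set (X := rsum (fun k => x k ^ 2) n) in *.
  set (Y := rsum (fun k => y k ^ 2) n) in *.
  assert (HX : 0 <= X) by (apply rsum_ge0; intros; apply pow2_ge_0).
  assert (HY : 0 <= Y) by (apply rsum_ge0; intros; apply pow2_ge_0).
  assert (H1 := IH (sqrt X) (sqrt Y) (sqrt_pos _) (sqrt_pos _)).
  assert (sX := sqrt_sqrt X HX). assert (sY := sqrt_sqrt Y HY).
  assert (pX := sqrt_pos X). assert (pY := sqrt_pos Y).
  set (p := sqrt X) in *. set (q := sqrt Y) in *.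
  assert (H2 : rsum (fun k => x k * y k) n <= p * q) by (apply H1; rewrite <- Rsqr_pow2; unfold Rsqr; lra).
  apply Rle_trans with (p * q + x n * y n); [lra|].
  apply Rsqr_incr_0_var; [|nra].
  unfold Rsqr.
  assert (Hp : p * p + x n * x n <= A * A) by lra.
  assert (Hq : q * q + y n * y n <= B * B) by lra.
  apply Rle_trans with ((p * p + x n * x n) * (q * q + y n * y n)).
  - assert (H := Rle_0_sqr (p * y n - q * x n)); unfold Rsqr in H; nra.
  - replace (A * B * (A * B)) with ((A * A) * (B * B)) by ring.
    apply Rmult_le_compat; try lra; nra.
Qed.

Lemma csum_ext (f g : nat -> C) (n : nat) :
  (forall k, (k < n)%nat -> f k = g k) -> csum f n = csum g n.
Proof.
  induction n as [|n IH]; simpl; intros H; auto.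
  rewrite IH, H; auto; intros; apply H; lia.
Qed.

Lemma csum_plus (f g : nat -> C) (n : nat) :
  csum (fun k => f k + g k)%C n = (csum f n + csum g n)%C.
Proof. induction n as [|n IH]; simpl; [ring|]. rewrite IH; ring. Qed.

Lemma csum_scal (c : C) (f : nat -> C) (n : nat) :
  csum (fun k => c * f k)%C n = (c * csum f n)%C.
Proof. induction n as [|n IH]; simpl; [ring|]. rewrite IH; ring. Qed.

Lemma csum_0 (n : nat) : csum (fun _ => 0%C) n = 0%C.
Proof. induction n as [|n IH]; simpl; [reflexivity|]. rewrite IH; ring. Qed.

Lemma csum_swap (f : nat -> nat -> C) (n m : nat) :
  csum (fun k => csum (f k) m) n = csum (fun l => csum (fun k => f k l) n) m.
Proof.
  induction n as [|n IH]; simpl.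
  - now rewrite csum_0.
  - now rewrite IH, csum_plus.
Qed.

Lemma csum_single (f : nat -> C) (n k : nat) : (k < n)%nat ->
  csum (fun i => if Nat.eq_dec i k then f i else 0%C) n = f k.
Proof.
  intros Hk; induction n as [|n IH]; [lia|]; simpl.
  destruct (Nat.eq_dec n k) as [->|Hn].
  - rewrite (csum_ext _ (fun _ => 0%C)), csum_0; [ring|].
    intros i Hi; destruct (Nat.eq_dec i k); [lia | reflexivity].
  - rewrite IH; [ring | lia].
Qed.

Lemma csum_extend (f : nat -> C) (n m : nat) : (n <= m)%nat ->
  csum (fun k => if lt_dec k n then f k else 0%C) m = csum f n.
Proof.
  intros H; induction H as [|m H IH].
  - apply csum_ext; intros k Hk; destruct (lt_dec k n); [reflexivity | lia].
  - simpl; rewrite IH; destruct (lt_dec m n); [lia | ring].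
Qed.

Lemma Cmod_csum (f : nat -> C) (n : nat) :
  Cmod (csum f n) <= rsum (fun k => Cmod (f k)) n.
Proof.
  induction n as [|n IH]; simpl; [rewrite Cmod_0; lra|].
  eapply Rle_trans; [apply Cmod_triangle | lra].
Qed.

Lemma Re_csum (f : nat -> C) (n : nat) : Re (csum f n) = rsum (fun k => Re (f k)) n.
Proof. induction n as [|n IH]; simpl; [reflexivity|]. now rewrite <- IH. Qed.

Lemma Im_csum (f : nat -> C) (n : nat) : Im (csum f n) = rsum (fun k => Im (f k)) n.
Proof. induction n as [|n IH]; simpl; [reflexivity|]. now rewrite <- IH. Qed.

Lemma Cconj_csum (f : nat -> C) (n : nat) : Cconj (csum f n) = csum (fun k => Cconj (f k)) n.
Proof.
  induction n as [|n IH]; simpl.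
  - apply injective_projections; simpl; ring.
  - now rewrite Cplus_conj, IH.
Qed.

Lemma Re_le_Cmod (z : C) : Re z <= Cmod z.
Proof. generalize (re_le_Cmod z) (Rle_abs (Re z)); lra. Qed.

Lemma Cmod_RtoC (x : R) : 0 <= x -> Cmod x = x.
Proof. intros; rewrite Cmod_R; now apply Rabs_pos_eq. Qed.

Definition cis (x : R) : C := (cos x, sin x).

Lemma cis_0 : cis 0 = 1%C.
Proof. unfold cis; now rewrite cos_0, sin_0. Qed.

Lemma cis_plus (x y : R) : cis (x + y) = (cis x * cis y)%C.
Proof. unfold cis; apply injective_projections; simpl; [apply cos_plus | rewrite sin_plus; ring]. Qed.

Lemma cis_opp (x : R) : cis (- x) = Cconj (cis x).
Proof. unfold cis, Cconj; simpl; now rewrite cos_neg, sin_neg. Qed.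

Lemma Cmod_cis (x : R) : Cmod (cis x) = 1.
Proof.
  unfold Cmod, cis; simpl.
  replace (_ + _) with 1; [apply sqrt_1|].
  generalize (sin2_cos2 x); unfold Rsqr; lra.
Qed.

Lemma Cexp_cis (z : C) : Cexp z = (RtoC (exp (Re z)) * cis (Im z))%C.
Proof. unfold Cexp, cis; apply injective_projections; simpl; ring. Qed.

Lemma Cmod_Cexp (z : C) : Cmod (Cexp z) = exp (Re z).
Proof. rewrite Cexp_cis, Cmod_mult, Cmod_cis, Cmod_RtoC; [ring | left; apply exp_pos]. Qed.

Lemma Cexp_plus (z w : C) : Cexp (z + w)%C = (Cexp z * Cexp w)%C.
Proof.
  rewrite !Cexp_cis. unfold Re, Im; simpl. rewrite exp_plus, cis_plus, RtoC_mult; ring.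
Qed.

Lemma Cexp_0 : Cexp 0 = 1%C.
Proof. rewrite Cexp_cis; simpl; rewrite exp_0, cis_0; ring. Qed.

(** Continuity is asked on the whole line although means only see an interval: integrability then
    follows from the shape of the function alone, and the hint database [cts] discharges it. *)
Definition cts (f : R -> R) : Prop := forall t, continuous f t.
Definition ccts (f : R -> C) : Prop := cts (fun t => Re (f t)) /\ cts (fun t => Im (f t)).

Lemma cts_const (c : R) : cts (fun _ => c).
Proof. intros t; apply continuous_const. Qed.
Lemma cts_id : cts (fun t => t).
Proof. intros t; apply continuous_id. Qed.
Lemma cts_plus (f g : R -> R) : cts f -> cts g -> cts (fun t => f t + g t).
Proof. intros Hf Hg t; apply (continuous_plus f g); auto. Qed.
Lemma cts_minus (f g : R -> R) : cts f -> cts g -> cts (fun t => f t - g t).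
Proof. intros Hf Hg t; apply (continuous_minus f g); auto. Qed.
Lemma cts_opp (f : R -> R) : cts f -> cts (fun t => - f t).
Proof. intros Hf t; apply (continuous_opp f); auto. Qed.
Lemma cts_mult (f g : R -> R) : cts f -> cts g -> cts (fun t => f t * g t).
Proof. intros Hf Hg t; apply (continuous_mult f g); auto. Qed.
Lemma cts_div (f : R -> R) (c : R) : cts f -> cts (fun t => f t / c).
Proof. intros Hf; apply cts_mult; [assumption | apply cts_const]. Qed.
Lemma cts_pow (f : R -> R) (n : nat) : cts f -> cts (fun t => f t ^ n).
Proof. intros Hf; induction n as [|n IH]; simpl; [apply cts_const | now apply cts_mult]. Qed.
Lemma cts_cos (f : R -> R) : cts f -> cts (fun t => cos (f t)).
Proof. intros Hf t; apply continuous_cos_comp; auto. Qed.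
Lemma cts_sin (f : R -> R) : cts f -> cts (fun t => sin (f t)).
Proof. intros Hf t; apply continuous_sin_comp; auto. Qed.
Lemma cts_exp (f : R -> R) : cts f -> cts (fun t => exp (f t)).
Proof. intros Hf t; apply continuous_exp_comp; auto. Qed.
Lemma cts_Rabs (f : R -> R) : cts f -> cts (fun t => Rabs (f t)).
Proof. intros Hf t; apply continuous_Rabs_comp; auto. Qed.
Lemma cts_rsum (f : nat -> R -> R) (n : nat) :
  (forall k, cts (f k)) -> cts (fun t => rsum (fun k => f k t) n).
Proof. intros Hf; induction n as [|n IH]; simpl; [apply cts_const | now apply cts_plus]. Qed.

Lemma ccts_const (c : C) : ccts (fun _ => c).
Proof. split; apply cts_const. Qed.
Lemma ccts_RtoC (f : R -> R) : cts f -> ccts (fun t => RtoC (f t)).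
Proof. intros Hf; split; simpl; [exact Hf | apply cts_const]. Qed.
Lemma ccts_plus (f g : R -> C) : ccts f -> ccts g -> ccts (fun t => f t + g t)%C.
Proof. intros [? ?] [? ?]; split; simpl; now apply cts_plus. Qed.
Lemma ccts_opp (f : R -> C) : ccts f -> ccts (fun t => - f t)%C.
Proof. intros [? ?]; split; simpl; now apply cts_opp. Qed.
Lemma ccts_minus (f g : R -> C) : ccts f -> ccts g -> ccts (fun t => f t - g t)%C.
Proof. intros; apply ccts_plus; [assumption | now apply ccts_opp]. Qed.
Lemma ccts_mult (f g : R -> C) : ccts f -> ccts g -> ccts (fun t => f t * g t)%C.
Proof.
  intros [? ?] [? ?]; split; simpl.
  - apply cts_minus; now apply cts_mult.
  - apply cts_plus; now apply cts_mult.
Qed.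
Lemma ccts_conj (f : R -> C) : ccts f -> ccts (fun t => Cconj (f t)).
Proof. intros [? ?]; split; simpl; [assumption | now apply cts_opp]. Qed.
Lemma ccts_cis (f : R -> R) : cts f -> ccts (fun t => cis (f t)).
Proof. intros Hf; split; simpl; [now apply cts_cos | now apply cts_sin]. Qed.
Lemma ccts_Cexp (f : R -> C) : ccts f -> ccts (fun t => Cexp (f t)).
Proof.
  intros [H1 H2]; split; simpl; apply cts_mult.
  1, 3: now apply (cts_exp _ H1).
  - now apply (cts_cos _ H2).
  - now apply (cts_sin _ H2).
Qed.
Lemma ccts_csum (f : nat -> R -> C) (n : nat) :
  (forall k, ccts (f k)) -> ccts (fun t => csum (fun k => f k t) n).
Proof. intros Hf; induction n as [|n IH]; simpl; [apply ccts_const | now apply ccts_plus]. Qed.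
Lemma ccts_pow (f : R -> C) (n : nat) : ccts f -> ccts (fun t => Cpow (f t) n).
Proof. intros Hf; induction n as [|n IH]; simpl; [apply ccts_const | now apply ccts_mult]. Qed.
Lemma cts_Re (f : R -> C) : ccts f -> cts (fun t => Re (f t)).
Proof. now intros []. Qed.
Lemma cts_Cmod (f : R -> C) : ccts f -> cts (fun t => Cmod (f t)).
Proof.
  intros [? ?] t; unfold Cmod; apply continuous_sqrt_comp.
  apply (cts_plus (fun t => Re (f t) ^ 2) (fun t => Im (f t) ^ 2)); now apply cts_pow.
Qed.

Create HintDb cts.
#[local] Hint Resolve cts_const cts_id cts_plus cts_minus cts_opp cts_mult cts_div cts_pow cts_cos
  cts_sin cts_exp cts_Rabs cts_rsum ccts_const ccts_RtoC ccts_plus ccts_opp ccts_minus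
  ccts_mult ccts_conj ccts_cis ccts_Cexp ccts_csum ccts_pow cts_Re cts_Cmod : cts.

(** * Means over [-T/2, T/2] of real and complex functions *)

Definition mean (T : R) (f : R -> R) : R := 1 / T * RInt f (- T / 2) (T / 2).

Lemma cts_ex_RInt (f : R -> R) (a b : R) : cts f -> ex_RInt f a b.
Proof. intros Hf; apply (ex_RInt_continuous (V := R_CompleteNormedModule)); auto. Qed.

Lemma mean_ext (T : R) (f g : R -> R) : 0 < T ->
  (forall t, - T / 2 <= t <= T / 2 -> f t = g t) -> mean T f = mean T g.
Proof.
  intros HT H; unfold mean; f_equal; apply (RInt_ext (V := R_CompleteNormedModule)).
  rewrite Rmin_left, Rmax_right by lra; intros; apply H; lra.
Qed.

Lemma mean_plus (T : R) (f g : R -> R) : cts f -> cts g ->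
  mean T (fun t => f t + g t) = mean T f + mean T g.
Proof.
  intros Hf Hg; unfold mean.
  generalize (RInt_plus (V := R_CompleteNormedModule) f g (- T / 2) (T / 2)
    (cts_ex_RInt _ _ _ Hf) (cts_ex_RInt _ _ _ Hg)).
  intros E; change (RInt (fun t => f t + g t) (- T / 2) (T / 2) =
    RInt f (- T / 2) (T / 2) + RInt g (- T / 2) (T / 2)) in E.
  rewrite E; ring.
Qed.

Lemma mean_scal (T c : R) (f : R -> R) : cts f -> mean T (fun t => c * f t) = c * mean T f.
Proof.
  intros Hf; unfold mean.
  generalize (RInt_scal (V := R_CompleteNormedModule) f (- T / 2) (T / 2) c (cts_ex_RInt _ _ _ Hf)).
  intros E; change (RInt (fun t => c * f t) (- T / 2) (T / 2) =
    c * RInt f (- T / 2) (T / 2)) in E.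
  rewrite E; ring.
Qed.

Lemma mean_minus (T : R) (f g : R -> R) : cts f -> cts g ->
  mean T (fun t => f t - g t) = mean T f - mean T g.
Proof.
  intros Hf Hg.
  replace (mean T f - mean T g) with (mean T f + -1 * mean T g) by ring.
  rewrite <- mean_scal, <- mean_plus; auto with cts.
  unfold mean; f_equal; apply (RInt_ext (V := R_CompleteNormedModule)).
  intros x _; change (f x - g x = f x + -1 * g x); ring.
Qed.

Lemma mean_const (T c : R) : 0 < T -> mean T (fun _ => c) = c.
Proof.
  intros HT; unfold mean; rewrite (RInt_const (V := R_CompleteNormedModule)).
  unfold scal; simpl; unfold mult; simpl; field; lra.
Qed.

Lemma mean_le (T : R) (f g : R -> R) : 0 < T -> cts f -> cts g ->
  (forall t, - T / 2 <= t <= T / 2 -> f t <= g t) -> mean T f <= mean T g.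
Proof.
  intros HT Hf Hg H; unfold mean; apply Rmult_le_compat_l.
  - unfold Rdiv; rewrite Rmult_1_l; left; now apply Rinv_0_lt_compat.
  - apply RInt_le; try (now apply cts_ex_RInt); [lra|]; intros; apply H; lra.
Qed.

Lemma mean_ge0 (T : R) (f : R -> R) : 0 < T -> cts f ->
  (forall t, - T / 2 <= t <= T / 2 -> 0 <= f t) -> 0 <= mean T f.
Proof.
  intros HT Hf H; rewrite <- (mean_const T 0 HT).
  apply mean_le; auto with cts.
Qed.

Lemma mean_rsum (T : R) (f : nat -> R -> R) (n : nat) : 0 < T -> (forall k, cts (f k)) ->
  mean T (fun t => rsum (fun k => f k t) n) = rsum (fun k => mean T (f k)) n.
Proof.
  intros HT Hf; induction n as [|n IH]; simpl; [now apply mean_const|].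
  rewrite mean_plus, IH; auto with cts.
Qed.

(** Pointwise, f g <= (B/2A) f^2 + (A/2B) g^2. These weights make the two means add up to A B, and
    positivity of [A] and [B] avoids the case of a vanishing norm. *)
Lemma mean_cauchy_schwarz (T A B : R) (f g : R -> R) : 0 < T -> cts f -> cts g ->
  0 < A -> 0 < B ->
  mean T (fun t => f t ^ 2) <= A ^ 2 -> mean T (fun t => g t ^ 2) <= B ^ 2 ->
  mean T (fun t => f t * g t) <= A * B.
Proof.
  intros HT Hf Hg HA HB H1 H2.
  apply Rle_trans with (mean T (fun t => (B / (2 * A)) * f t ^ 2 + (A / (2 * B)) * g t ^ 2)).
  - apply mean_le; auto 6 with cts; intros t _.
    assert (H := pow2_ge_0 (B * f t - A * g t)).
    apply Rmult_le_reg_l with (2 * A * B); [nra|].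
    replace (2 * A * B * (B / (2 * A) * f t ^ 2 + A / (2 * B) * g t ^ 2))
      with (B ^ 2 * f t ^ 2 + A ^ 2 * g t ^ 2) by (field; lra).
    nra.
  - rewrite mean_plus, !mean_scal; auto with cts.
    apply Rle_trans with (B / (2 * A) * A ^ 2 + A / (2 * B) * B ^ 2).
    + apply Rplus_le_compat; apply Rmult_le_compat_l; auto; left; apply Rdiv_lt_0_compat; lra.
    + right; field; lra.
Qed.

Definition cmean (T : R) (f : R -> C) : C :=
  (mean T (fun t => Re (f t)), mean T (fun t => Im (f t))).

Lemma cmean_ext (T : R) (f g : R -> C) : 0 < T ->
  (forall t, - T / 2 <= t <= T / 2 -> f t = g t) -> cmean T f = cmean T g.
Proof.
  intros HT H; unfold cmean; f_equal; apply mean_ext; auto; intros; now rewrite H.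
Qed.

Lemma cmean_plus (T : R) (f g : R -> C) : ccts f -> ccts g ->
  cmean T (fun t => f t + g t)%C = (cmean T f + cmean T g)%C.
Proof.
  intros [? ?] [? ?]; unfold cmean; apply injective_projections; simpl;
    now apply mean_plus.
Qed.

Lemma cmean_scal (T : R) (c : C) (f : R -> C) : ccts f ->
  cmean T (fun t => c * f t)%C = (c * cmean T f)%C.
Proof.
  intros [? ?]; unfold cmean; apply injective_projections.
  - change (mean T (fun t => fst c * Re (f t) - snd c * Im (f t)) =
      fst c * mean T (fun t => Re (f t)) - snd c * mean T (fun t => Im (f t))).
    rewrite mean_minus, !mean_scal; auto with cts.
  - change (mean T (fun t => fst c * Im (f t) + snd c * Re (f t)) =
      fst c * mean T (fun t => Im (f t)) + snd c * mean T (fun t => Re (f t))).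
    rewrite mean_plus, !mean_scal; auto with cts.
Qed.

Lemma cmean_minus (T : R) (f g : R -> C) : ccts f -> ccts g ->
  cmean T (fun t => f t - g t)%C = (cmean T f - cmean T g)%C.
Proof.
  intros [? ?] [? ?]; unfold cmean; apply injective_projections; simpl.
  - now apply (mean_minus T (fun t => Re (f t)) (fun t => Re (g t))).
  - now apply (mean_minus T (fun t => Im (f t)) (fun t => Im (g t))).
Qed.

Lemma cmean_csum (T : R) (f : nat -> R -> C) (n : nat) : 0 < T -> (forall k, ccts (f k)) ->
  cmean T (fun t => csum (fun k => f k t) n) = csum (fun k => cmean T (f k)) n.
Proof.
  intros HT Hf; induction n as [|n IH]; simpl.
  - unfold cmean; simpl; now rewrite mean_const.
  - rewrite cmean_plus, IH; auto with cts.
Qed.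

(* Rotating the mean onto the positive axis reduces this to the real case. *)
Lemma Cmod_cmean (T : R) (f : R -> C) : 0 < T -> ccts f ->
  Cmod (cmean T f) <= mean T (fun t => Cmod (f t)).
Proof.
  intros HT Hf; set (w := cmean T f).
  destruct (Req_dec (Cmod w) 0) as [E|E].
  { rewrite E; apply mean_ge0; auto with cts; intros; apply Cmod_ge_0. }
  assert (0 < Cmod w) by (generalize (Cmod_ge_0 w); lra).
  apply Rmult_le_reg_l with (Cmod w); auto.
  replace (Cmod w * Cmod w) with (Re (Cconj w * w)%C).
  2:{ replace (Cmod w * Cmod w) with (Cmod w ^ 2) by ring.
      rewrite Cmod2_alt; unfold Re, Im; simpl; ring. }
  unfold w at 2; rewrite <- cmean_scal by assumption.
  rewrite <- mean_scal by auto with cts.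
  change (mean T (fun t => Re (Cconj w * f t)%C) <= mean T (fun t => Cmod w * Cmod (f t))).
  apply mean_le; auto with cts.
  intros t _; rewrite <- (Cmod_conj w), <- Cmod_mult; apply Re_le_Cmod.
Qed.

Lemma exp_le (x y : R) : x <= y -> exp x <= exp y.
Proof. intros [H | ->]; [left; now apply exp_increasing | right; reflexivity]. Qed.

Lemma exp_pow (x : R) (n : nat) : exp x ^ n = exp (INR n * x).
Proof.
  induction n as [|n IH]; [simpl; now rewrite Rmult_0_l, exp_0|].
  rewrite S_INR; simpl; rewrite IH, <- exp_plus; f_equal; ring.
Qed.

(** * Antianalytic trigonometric polynomials *)

(** The factor [w] stays on the left so that w = 0 needs no separate case. The formula has two uses:
    w = i s gives Fourier integrals, and T = 1, v = w/2 gives exp w - 1 as w times the integral of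
    exp(u w) over u in [0, 1]. *)
Lemma cmean_Cexp (T : R) (w v : C) : 0 < T ->
  (w * cmean T (fun t => Cexp (w * t + v)) =
   RtoC (/ T) * (Cexp (w * (T / 2)%R + v) - Cexp (w * (- T / 2)%R + v)))%C.
Proof.
  intros HT. rewrite <- cmean_scal by auto 14 with cts.
  unfold cmean; apply injective_projections; destruct w as [a b], v as [c d]; simpl;
    unfold mean.
  - rewrite (is_RInt_unique _ _ _ (minus (exp (a * (T / 2) + c) * cos (b * (T / 2) + d))
      (exp (a * (- T / 2) + c) * cos (b * (- T / 2) + d)))).
    + unfold minus, plus, opp; simpl. rewrite !Rmult_0_r, !Rminus_0_r, !Rplus_0_l.
      unfold Rdiv; ring.
    + apply (is_RInt_ext (fun t => a * (exp (a * t + c) * cos (b * t + d)) -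
        b * (exp (a * t + c) * sin (b * t + d)))).
      { intros t _. rewrite !Rmult_0_r, !Rminus_0_r, !Rplus_0_l. reflexivity. }
      apply (is_RInt_derive (V := R_CompleteNormedModule) (fun t => exp (a * t + c) * cos (b * t + d))).
      * intros t _; auto_derive; auto; ring.
      * intros t _.
        apply (cts_minus (fun t => a * (exp (a * t + c) * cos (b * t + d)))); auto 14 with cts.
  - rewrite (is_RInt_unique _ _ _ (minus (exp (a * (T / 2) + c) * sin (b * (T / 2) + d))
      (exp (a * (- T / 2) + c) * sin (b * (- T / 2) + d)))).
    + unfold minus, plus, opp; simpl. rewrite !Rmult_0_r, !Rminus_0_r, !Rplus_0_l.
      unfold Rdiv; ring.
    + apply (is_RInt_ext (fun t => a * (exp (a * t + c) * sin (b * t + d)) +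
        b * (exp (a * t + c) * cos (b * t + d)))).
      { intros t _. rewrite !Rmult_0_r, !Rminus_0_r, !Rplus_0_l. reflexivity. }
      apply (is_RInt_derive (V := R_CompleteNormedModule) (fun t => exp (a * t + c) * sin (b * t + d))).
      * intros t _; auto_derive; auto; ring.
      * intros t _.
        apply (cts_plus (fun t => a * (exp (a * t + c) * sin (b * t + d)))); auto 14 with cts.
Qed.

Lemma Cexp_Ci (x : R) : Cexp (Ci * x)%C = cis x.
Proof.
  rewrite Cexp_cis; simpl.
  replace (0 * x - 1 * 0) with 0 by ring; replace (0 * 0 + 1 * x) with x by ring.
  rewrite exp_0; ring.
Qed.

Lemma cmean_cis (T w : R) : 0 < T -> w <> 0 ->
  cmean T (fun t => cis (w * t)) = RtoC (2 * sin (w * T / 2) / (w * T)).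
Proof.
  intros HT Hw.
  assert (H := cmean_Cexp T (Ci * w)%C 0 HT).
  assert (A : forall t : R, Cexp (Ci * w * t + 0)%C = cis (w * t)).
  { intros t; rewrite <- Cexp_Ci, RtoC_mult; f_equal; ring. }
  rewrite (cmean_ext T _ (fun t => cis (w * t))), !A in H by auto.
  set (X := cmean T (fun t => cis (w * t))) in *.
  assert (E : (Ci * w * X = Ci * w * RtoC (2 * sin (w * T / 2) / (w * T)))%C).
  { rewrite H. replace (w * (- T / 2)) with (- (w * (T / 2))) by field.
    replace (w * T / 2) with (w * (T / 2)) by field.
    rewrite cis_opp; unfold cis; apply injective_projections; simpl; field; lra. }
  assert (N : (Ci * w)%C <> 0%C).
  { intros E0. apply Hw. assert (E1 := f_equal snd E0); simpl in E1; lra. }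
  transitivity (/ (Ci * w) * (Ci * w * X))%C.
  2: rewrite E.
  all: rewrite Cmult_assoc, Cinv_l, Cmult_1_l; auto.
Qed.

Lemma cmean_const (T : R) (c : C) : 0 < T -> cmean T (fun _ => c) = c.
Proof. intros HT; unfold cmean; rewrite !mean_const by assumption; now destruct c. Qed.

(** On the segment from 0 to w the real part stays below K, because K >= 0. The case K = 0 matters
    most: for Re w <= 0 the bound is |w|, with no exponential loss. *)
Lemma Cexp_sub1_le (w : C) (K : R) : 0 <= K -> Re w <= K ->
  Cmod (Cexp w - 1)%C <= Cmod w * exp K.
Proof.
  intros HK Hw.
  assert (H := cmean_Cexp 1 w (w * (1 / 2)%R)%C Rlt_0_1).
  replace (w * (1 / 2)%R + w * (1 / 2)%R)%C with w in H
    by (apply injective_projections; simpl; field).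
  replace (w * (- (1) / 2)%R + w * (1 / 2)%R)%C with (RtoC 0) in H
    by (apply injective_projections; simpl; field).
  rewrite Cexp_0, Rinv_1, Cmult_1_l in H.
  rewrite <- H, Cmod_mult.
  apply Rmult_le_compat_l; [apply Cmod_ge_0|].
  eapply Rle_trans; [apply Cmod_cmean; auto 14 with cts; lra|].
  rewrite <- (mean_const 1 (exp K) Rlt_0_1).
  apply mean_le; auto 14 with cts; try lra.
  intros t Ht; rewrite Cmod_Cexp.
  replace (Re _) with ((t + 1 / 2) * Re w) by (destruct w; simpl; field).
  apply exp_le. nra.
Qed.

(** The first-order bound is inserted under the integral representation of exp w - 1. *)
Lemma Cexp_sub1_sub_le (w : C) :
  Cmod (Cexp w - 1 - w)%C <= Cmod w ^ 2 * exp (Cmod w).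
Proof.
  assert (H := cmean_Cexp 1 w (w * (1 / 2)%R)%C Rlt_0_1).
  replace (w * (1 / 2)%R + w * (1 / 2)%R)%C with w in H
    by (apply injective_projections; simpl; field).
  replace (w * (- (1) / 2)%R + w * (1 / 2)%R)%C with (RtoC 0) in H
    by (apply injective_projections; simpl; field).
  rewrite Cexp_0, Rinv_1, Cmult_1_l in H.
  replace (Cexp w - 1 - w)%C with (w * cmean 1 (fun t => Cexp (w * t + w * (1 / 2)%R) - 1))%C.
  2:{ rewrite cmean_minus; auto 14 with cts.
      rewrite <- H, cmean_const by lra; ring. }
  rewrite Cmod_mult. simpl (_ ^ 2). rewrite Rmult_1_r, Rmult_assoc.
  apply Rmult_le_compat_l; [apply Cmod_ge_0|].
  eapply Rle_trans; [apply Cmod_cmean; auto 14 with cts; lra|].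
  rewrite <- (mean_const 1 (Cmod w * exp (Cmod w)) Rlt_0_1).
  apply mean_le; auto 14 with cts; try lra.
  intros t Ht.
  replace (w * t + w * (1 / 2)%R)%C with (RtoC (t + 1 / 2) * w)%C
    by (apply injective_projections; simpl; field).
  assert (Hm : Cmod (RtoC (t + 1 / 2) * w) <= Cmod w).
  { rewrite Cmod_mult, Cmod_RtoC by lra. generalize (Cmod_ge_0 w); nra. }
  eapply Rle_trans; [apply (Cexp_sub1_le _ (Cmod w)); [apply Cmod_ge_0|]|].
  - eapply Rle_trans; [apply Re_le_Cmod | exact Hm].
  - apply Rmult_le_compat_r; [left; apply exp_pos | exact Hm].
Qed.

(** Telescoping gives n m^(n-1); the coarser m^n, available since m >= 1, avoids the predecessor. *)
Lemma Cmod_pow_sub_le (x y : C) (m : R) (n : nat) : 1 <= m -> Cmod x <= m -> Cmod y <= m ->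
  Cmod (Cpow x n - Cpow y n)%C <= INR n * m ^ n * Cmod (x - y)%C.
Proof.
  intros Hm Hx Hy; induction n as [|n IH].
  - simpl. replace (1 - 1)%C with (RtoC 0) by ring. rewrite Cmod_0; lra.
  - rewrite S_INR. simpl Cpow.
    replace (x * x ^ n - y * y ^ n)%C with (x * (x ^ n - y ^ n) + (x - y) * y ^ n)%C by ring.
    eapply Rle_trans; [apply Cmod_triangle|]; rewrite !Cmod_mult, Cmod_pow.
    set (d := Cmod (x - y)) in *.
    assert (0 <= d) by apply Cmod_ge_0.
    assert (Cmod y ^ n <= m ^ n) by (apply pow_incr; split; [apply Cmod_ge_0 | assumption]).
    assert (P : 0 <= m ^ n) by (apply pow_le; lra).
    assert (0 <= Cmod y ^ n) by (apply pow_le, Cmod_ge_0).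
    apply Rle_trans with (m * (INR n * m ^ n * d) + d * m ^ n).
    + apply Rplus_le_compat; [|nra].
      apply Rmult_le_compat; auto using Cmod_ge_0.
    + simpl. assert (0 <= m ^ n * d) by nra. assert (0 <= INR n) by apply pos_INR. nra.
Qed.

Lemma Cexp_pow (w : C) (n : nat) : Cpow (Cexp w) n = Cexp (INR n * w).
Proof.
  induction n as [|n IH].
  - simpl. replace (0 * w)%C with (RtoC 0) by ring. now rewrite Cexp_0.
  - rewrite S_INR. simpl Cpow. rewrite IH, <- Cexp_plus. f_equal.
    rewrite RtoC_plus; ring.
Qed.

Definition zpow (T : R) (n : nat) (t : R) : C := cis (- (2 * PI * INR n * t / T)).

Lemma zpow_0 (T t : R) : zpow T 0 t = 1%C.
Proof. unfold zpow; simpl. unfold Rdiv; rewrite Rmult_0_r, !Rmult_0_l, Ropp_0; apply cis_0. Qed.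

Lemma zpow_plus (T : R) (n m : nat) (t : R) : zpow T (n + m) t = (zpow T n t * zpow T m t)%C.
Proof. unfold zpow; rewrite <- cis_plus, plus_INR; f_equal; unfold Rdiv; ring. Qed.

Lemma Cmod_zpow (T : R) (n : nat) (t : R) : Cmod (zpow T n t) = 1.
Proof. apply Cmod_cis. Qed.

Lemma ccts_zpow (T : R) (n : nat) : ccts (zpow T n).
Proof. unfold zpow; auto 14 with cts. Qed.
#[local] Hint Resolve ccts_zpow : cts.

Lemma cmean_zpow (T : R) (n m : nat) : 0 < T ->
  cmean T (fun t => zpow T n t * Cconj (zpow T m t))%C =
  if Nat.eq_dec n m then 1%C else 0%C.
Proof.
  intros HT.
  assert (E : forall t, (zpow T n t * Cconj (zpow T m t))%C =
    cis (2 * PI * (INR m - INR n) / T * t)).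
  { intros t; unfold zpow; rewrite <- cis_opp, <- cis_plus; f_equal; field; lra. }
  rewrite (cmean_ext T _ (fun t => cis (2 * PI * (INR m - INR n) / T * t))) by auto.
  destruct (Nat.eq_dec n m) as [->|Hn].
  - rewrite (cmean_ext T _ (fun _ => 1%C)); [now apply cmean_const | assumption |].
    intros t _; replace (2 * PI * (INR m - INR m) / T * t) with 0 by (field; lra); apply cis_0.
  - assert (INR m - INR n <> 0) by (intros Z; apply Hn, INR_eq; lra).
    rewrite cmean_cis; auto.
    2:{ intros Z. apply H. apply Rmult_eq_reg_l with (2 * PI / T).
        - rewrite Rmult_0_r, <- Z; field; lra.
        - apply Rgt_not_eq, Rdiv_lt_0_compat; generalize PI_RGT_0; lra. }
    replace (2 * PI * (INR m - INR n) / T * T / 2) with (IZR (Z.of_nat m - Z.of_nat n) * PI).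
    + rewrite (sin_eq_0_1 (IZR (Z.of_nat m - Z.of_nat n) * PI)) by (eexists; reflexivity).
      f_equal; unfold Rdiv; ring.
    + rewrite minus_IZR, <- !INR_IZR_INZ; field; lra.
Qed.

(* Polynomials in [e^(-2 i pi t / T)]: the antianalytic T-periodic trigonometric polynomials. *)
Definition apoly (T : R) (c : nat -> C) (M : nat) (t : R) : C :=
  csum (fun n => c n * zpow T n t)%C M.

Lemma ccts_apoly (T : R) (c : nat -> C) (M : nat) : ccts (apoly T c M).
Proof. unfold apoly; auto 14 with cts. Qed.
#[local] Hint Resolve ccts_apoly : cts.

Lemma cmean_apoly_conj (T : R) (c : nat -> C) (M m : nat) : 0 < T ->
  cmean T (fun t => apoly T c M t * Cconj (zpow T m t))%C = if lt_dec m M then c m else 0%C.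
Proof.
  intros HT.
  rewrite (cmean_ext T _ (fun t => csum (fun n => c n * (zpow T n t * Cconj (zpow T m t))) M)%C); auto.
  2:{ intros t _; unfold apoly; rewrite Cmult_comm, <- csum_scal; apply csum_ext; intros; ring. }
  rewrite cmean_csum; auto 14 with cts.
  rewrite (csum_ext _ (fun n => if Nat.eq_dec n m then c n else 0%C)).
  2:{ intros k _; rewrite cmean_scal, cmean_zpow; auto 14 with cts.
      destruct (Nat.eq_dec k m); ring. }
  destruct (lt_dec m M) as [H|H]; [now apply csum_single|].
  rewrite (csum_ext _ (fun _ => 0%C)); [apply csum_0|].
  intros k Hk; destruct (Nat.eq_dec k m); [lia | reflexivity].
Qed.

Lemma Cmod_plus_sqr (z w : C) :
  Cmod (z + w)%C ^ 2 = Cmod z ^ 2 + 2 * Re (z * Cconj w)%C + Cmod w ^ 2.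
Proof. rewrite !Cmod2_alt; destruct z, w; simpl; ring. Qed.

Lemma mean_Re (T : R) (f : R -> C) : mean T (fun t => Re (f t)) = Re (cmean T f).
Proof. reflexivity. Qed.

(** Adding the term of index M creates a cross term that is the M-th coefficient of a polynomial of
    smaller degree, hence 0. *)
Lemma parseval (T : R) (c : nat -> C) (M : nat) : 0 < T ->
  mean T (fun t => Cmod (apoly T c M t) ^ 2) = rsum (fun n => Cmod (c n) ^ 2) M.
Proof.
  intros HT; induction M as [|M IH].
  - rewrite (mean_ext T _ (fun _ => 0)); [now rewrite mean_const | assumption |].
    intros; unfold apoly; simpl; rewrite Cmod_0; ring.
  - rewrite (mean_ext T _ (fun t => (Cmod (apoly T c M t) ^ 2 +
      2 * Re (Cconj (c M) * (apoly T c M t * Cconj (zpow T M t)))%C) + Cmod (c M) ^ 2)); auto.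
    2:{ intros t _; unfold apoly; simpl csum; rewrite Cmod_plus_sqr, Cmod_mult.
        rewrite Cmod_zpow, Rmult_1_r, Cmult_conj.
        f_equal; f_equal; f_equal; f_equal; ring. }
    rewrite mean_plus, mean_plus, mean_scal, mean_const, IH, mean_Re, cmean_scal,
      cmean_apoly_conj; auto 14 with cts.
    simpl rsum. destruct (lt_dec M M); [lia|]. rewrite Cmult_0_r; simpl; ring.
Qed.

Definition is_apoly (T : R) (f : R -> C) : Prop :=
  exists c M, forall t, f t = apoly T c M t.

Lemma is_apoly_zpow (T : R) (m : nat) : is_apoly T (zpow T m).
Proof.
  exists (fun n => if Nat.eq_dec n m then 1%C else 0%C), (S m); intros t; unfold apoly.
  rewrite (csum_ext _ (fun n => if Nat.eq_dec n m then zpow T n t else 0%C)).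
  - rewrite csum_single; [reflexivity | lia].
  - intros k _; destruct (Nat.eq_dec k m); ring.
Qed.

Lemma is_apoly_scal (T : R) (a : C) (f : R -> C) :
  is_apoly T f -> is_apoly T (fun t => a * f t)%C.
Proof.
  intros (c & M & H); exists (fun n => a * c n)%C, M; intros t.
  rewrite H; unfold apoly; rewrite <- csum_scal; apply csum_ext; intros; ring.
Qed.

Lemma is_apoly_plus (T : R) (f g : R -> C) :
  is_apoly T f -> is_apoly T g -> is_apoly T (fun t => f t + g t)%C.
Proof.
  intros (c & M & H) (d & L & K).
  exists (fun n => (if lt_dec n M then c n else 0) + (if lt_dec n L then d n else 0))%C, (max M L).
  intros t; rewrite H, K; unfold apoly.
  rewrite <- (csum_extend _ M (max M L)), <- (csum_extend _ L (max M L)), <- csum_plus by lia.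
  apply csum_ext; intros k _; destruct (lt_dec k M), (lt_dec k L); ring.
Qed.

Lemma is_apoly_ext (T : R) (f g : R -> C) :
  (forall t, f t = g t) -> is_apoly T f -> is_apoly T g.
Proof. intros E (c & M & H); exists c, M; intros; now rewrite <- E. Qed.

Lemma is_apoly_const (T : R) (a : C) : is_apoly T (fun _ => a).
Proof.
  apply (is_apoly_ext T (fun t => a * zpow T 0 t)%C).
  - intros; rewrite zpow_0; ring.
  - apply is_apoly_scal, is_apoly_zpow.
Qed.

Lemma is_apoly_csum (T : R) (f : nat -> R -> C) (n : nat) :
  (forall k, is_apoly T (f k)) -> is_apoly T (fun t => csum (fun k => f k t) n).
Proof.
  intros H; induction n as [|n IH]; simpl; [apply is_apoly_const | now apply is_apoly_plus].
Qed.

Lemma is_apoly_mult (T : R) (f g : R -> C) :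
  is_apoly T f -> is_apoly T g -> is_apoly T (fun t => f t * g t)%C.
Proof.
  intros (c & M & H) (d & L & K).
  apply (is_apoly_ext T (fun t => csum (fun n => csum (fun m => (c n * d m) * zpow T (n + m) t) L) M)%C).
  - intros t; rewrite H, K; unfold apoly.
    rewrite (Cmult_comm (csum _ M)), <- csum_scal; apply csum_ext; intros n _.
    rewrite (Cmult_comm (csum _ L)), <- csum_scal; apply csum_ext; intros m _.
    rewrite zpow_plus; ring.
  - apply is_apoly_csum; intros n; apply is_apoly_csum; intros m.
    apply is_apoly_scal, is_apoly_zpow.
Qed.

Lemma is_apoly_pow (T : R) (f : R -> C) (n : nat) :
  is_apoly T f -> is_apoly T (fun t => Cpow (f t) n).
Proof.
  intros H; induction n as [|n IH]; simpl; [apply is_apoly_const | now apply is_apoly_mult].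
Qed.

Lemma is_apoly_bounded (T : R) (f : R -> C) : is_apoly T f ->
  exists K, 0 <= K /\ forall t, Cmod (f t) <= K.
Proof.
  intros (c & M & H); exists (rsum (fun n => Cmod (c n)) M); split.
  - apply rsum_ge0; intros; apply Cmod_ge_0.
  - intros t; rewrite H; eapply Rle_trans; [apply Cmod_csum|].
    apply rsum_le; intros n _; rewrite Cmod_mult, Cmod_zpow; lra.
Qed.

Lemma is_apoly_ccts (T : R) (f : R -> C) : is_apoly T f -> ccts f.
Proof.
  intros (c & M & H); assert (Hc := ccts_apoly T c M).
  destruct Hc as [H1 H2]; split; intros t.
  - apply (continuous_ext (fun t => Re (apoly T c M t))); [intros; now rewrite H | apply H1].
  - apply (continuous_ext (fun t => Im (apoly T c M t))); [intros; now rewrite H | apply H2].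
Qed.

(* [(1 - H/n)^n] is again antianalytic and tends to [exp (-H)]. *)
Lemma is_apoly_Cexp_approx (T : R) (H : R -> C) (delta : R) : is_apoly T H -> 0 < delta ->
  exists P, is_apoly T P /\ forall t, Cmod (P t - Cexp (- H t))%C <= delta.
Proof.
  intros HH Hd; destruct (is_apoly_bounded _ _ HH) as (K & HK & HB).
  (* The error found below is n e^K (K/n)^2 e^K = K^2 e^(2K) / n; the [+ 1] keeps the denominator
     positive when K = 0. *)
  destruct (archimed_cor1 (delta / ((K ^ 2 + 1) * exp K * exp K))) as (n & Hn & Hn0).
  { apply Rdiv_lt_0_compat; auto. generalize (exp_pos K); intros; nra. }
  assert (Hn' : 0 < INR n) by now apply lt_0_INR.
  assert (Hn1 : 1 <= INR n) by now apply (le_INR 1).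
  exists (fun t => Cpow (1 + RtoC (- / INR n) * H t)%C n); split.
  - apply is_apoly_pow, is_apoly_plus; [apply is_apoly_const | now apply is_apoly_scal].
  - intros t; set (w := (RtoC (- / INR n) * H t)%C).
    assert (Hw : Cmod w <= K / INR n).
    { unfold w; rewrite Cmod_mult, Cmod_R, Rabs_Ropp, Rabs_pos_eq.
      - unfold Rdiv; rewrite Rmult_comm; apply Rmult_le_compat_r; auto.
        left; now apply Rinv_0_lt_compat.
      - left; now apply Rinv_0_lt_compat. }
    replace (Cexp (- H t)) with (Cpow (Cexp w) n).
    2:{ rewrite Cexp_pow; f_equal; unfold w.
        transitivity (RtoC (INR n * - / INR n) * H t)%C; [rewrite RtoC_mult; ring|].
        replace (INR n * - / INR n) with (- (1)) by (field; lra).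
        rewrite RtoC_opp; ring. }
    assert (HKn : 0 <= K / INR n) by (apply Rdiv_le_0_compat; lra).
    assert (HKK : K / INR n <= K).
    { apply Rmult_le_reg_r with (INR n); auto. unfold Rdiv; rewrite Rmult_assoc, Rinv_l; nra. }
    (* A common bound for 1 + w and exp w whose n-th power e^K does not depend on n. *)
    set (m := exp (K / INR n)).
    assert (Hm : m ^ n = exp K).
    { unfold m; rewrite exp_pow; f_equal; field; lra. }
    eapply Rle_trans; [apply (Cmod_pow_sub_le _ _ m)|].
    + unfold m; rewrite <- exp_0; now apply exp_le.
    + eapply Rle_trans; [apply Cmod_triangle|]; rewrite Cmod_1.
      apply Rle_trans with (1 + K / INR n); [lra | unfold m; apply exp_ineq1_le].
    + rewrite Cmod_Cexp; apply exp_le; eapply Rle_trans; [apply Re_le_Cmod | exact Hw].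
    + rewrite Hm.
      replace (1 + w - Cexp w)%C with (- (Cexp w - 1 - w))%C by ring; rewrite Cmod_opp.
      assert (Q : Cmod (Cexp w - 1 - w)%C <= (K / INR n) ^ 2 * exp K).
      { eapply Rle_trans; [apply Cexp_sub1_sub_le|].
        apply Rmult_le_compat; [apply pow2_ge_0 | left; apply exp_pos | |].
        - apply pow_incr; split; [apply Cmod_ge_0 | exact Hw].
        - apply exp_le; lra. }
      apply Rle_trans with (INR n * exp K * ((K / INR n) ^ 2 * exp K)).
      { apply Rmult_le_compat_l; [|exact Q]. generalize (exp_pos K); nra. }
      replace (INR n * exp K * ((K / INR n) ^ 2 * exp K))
        with (K ^ 2 * exp K * exp K * / INR n) by (field; lra).
      apply Rle_trans with ((K ^ 2 + 1) * exp K * exp K * / INR n).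
      * apply Rmult_le_compat_r; [left; now apply Rinv_0_lt_compat|].
        generalize (exp_pos K); intros; nra.
      * assert (0 < (K ^ 2 + 1) * exp K * exp K) by (generalize (exp_pos K); intros; nra).
        apply Rle_trans with ((K ^ 2 + 1) * exp K * exp K * (delta / ((K ^ 2 + 1) * exp K * exp K))).
        -- apply Rmult_le_compat_l; lra.
        -- right; field; split; [apply Rgt_not_eq, exp_pos | nra].
Qed.

(* Fourier coefficient of a weight at angular frequency [-s]. *)
Definition wcoef (T : R) (G : R -> R) (s : R) : C := cmean T (fun t => cis (s * t) * G t)%C.

(** Replace exp(-H) by a nearby antianalytic polynomial P. Since Re H >= 0, |P| is at most about 1
    on the interval, so by Parseval its coefficients have l^2 norm at most about 1. The mean is
    their pairing with the transform of G at the shifted frequencies, and Cauchy-Schwarz gives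
    sigma, independently of the size or degree of H. *)
Lemma wcoef_leak (T : R) (G : R -> R) (s sigma : R) (H : R -> C) : 0 < T -> cts G ->
  (forall t, - T / 2 <= t <= T / 2 -> 0 <= G t <= 1) ->
  0 <= sigma ->
  (forall M, rsum (fun n => Cmod (wcoef T G (s - 2 * PI * INR n / T)) ^ 2) M <= sigma ^ 2) ->
  is_apoly T H -> (forall t, - T / 2 <= t <= T / 2 -> 0 <= Re (H t)) ->
  Cmod (cmean T (fun t => Cexp (- H t) * (cis (s * t) * G t))%C) <= sigma.
Proof.
  intros HT HG HG1 Hsig Hsum HH HRe.
  assert (HHc := is_apoly_ccts _ _ HH).
  assert (Hk : ccts (fun t => cis (s * t) * G t)%C) by auto 14 with cts.
  assert (Hk1 : forall t, - T / 2 <= t <= T / 2 -> Cmod (cis (s * t) * G t)%C <= 1).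
  { intros t Ht; destruct (HG1 t Ht); rewrite Cmod_mult, Cmod_cis, Cmod_RtoC; lra. }
  apply le_epsilon; intros e He.
  (* Chosen so that (1 + delta) sigma + delta = sigma + e. *)
  set (delta := e / (sigma + 1)).
  assert (Hd : 0 < delta) by (apply Rdiv_lt_0_compat; lra).
  destruct (is_apoly_Cexp_approx T H delta HH Hd) as (P & HP & HPE).
  assert (HPc := is_apoly_ccts _ _ HP).
  set (k := fun t => (cis (s * t) * G t)%C) in *.
  assert (E : cmean T (fun t => Cexp (- H t) * k t)%C =
    (cmean T (fun t => P t * k t) - cmean T (fun t => (P t - Cexp (- H t)) * k t))%C).
  { rewrite <- cmean_minus; auto 14 with cts. apply cmean_ext; auto; intros; ring. }
  change (Cmod (cmean T (fun t => Cexp (- H t) * k t)%C) <= sigma + e).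
  rewrite E. unfold Cminus at 1.
  eapply Rle_trans; [apply Cmod_triangle|]; rewrite Cmod_opp.
  replace (sigma + e) with ((1 + delta) * sigma + delta) by (unfold delta; field; lra).
  apply Rplus_le_compat.
  - destruct HP as (c & M & HP).
    rewrite (cmean_ext T _ (fun t => csum (fun n => c n * (cis ((s - 2 * PI * INR n / T) * t) * G t)) M)%C); auto.
    2:{ intros t _; rewrite HP; unfold apoly, k; rewrite Cmult_comm, <- csum_scal.
        apply csum_ext; intros n _; unfold zpow.
        replace ((s - 2 * PI * INR n / T) * t) with (s * t + - (2 * PI * INR n * t / T)) by (field; lra).
        rewrite cis_plus; ring. }
    rewrite cmean_csum; auto 14 with cts.
    eapply Rle_trans; [apply Cmod_csum|].
    rewrite (rsum_ext _ (fun n => Cmod (c n) * Cmod (wcoef T G (s - 2 * PI * INR n / T)))).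
    2:{ intros n _; rewrite cmean_scal, Cmod_mult; auto 14 with cts. }
    apply rsum_cauchy_schwarz; auto; [lra|].
    rewrite <- (parseval T c M HT).
    rewrite <- (mean_const T ((1 + delta) ^ 2)) by assumption.
    apply mean_le; auto 14 with cts.
    intros t Ht; apply pow_incr; split; [apply Cmod_ge_0|].
    rewrite <- HP. replace (P t) with (Cexp (- H t) + (P t - Cexp (- H t)))%C by ring.
    eapply Rle_trans; [apply Cmod_triangle|]; apply Rplus_le_compat; [|apply HPE].
    rewrite Cmod_Cexp, <- exp_0; apply exp_le.
    specialize (HRe t Ht); destruct (H t); simpl in *; lra.
  - eapply Rle_trans; [apply Cmod_cmean; auto 14 with cts|].
    rewrite <- (mean_const T delta) by assumption.
    apply mean_le; auto 14 with cts.
    intros t Ht; rewrite Cmod_mult.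
    rewrite <- (Rmult_1_r delta).
    apply Rmult_le_compat; auto using Cmod_ge_0; now apply Hk1.
Qed.

(** * Antianalytic majorants *)

Definition fourier_weight (d : nat) : R := match d with O => 1 | S _ => 2 end.

(** This is n times the usual Fejer kernel of order n, with the frequencies d and -d merged into one
    cosine. *)
Definition fejer_sum (n : nat) (x : R) : R :=
  rsum (fun d => fourier_weight d * (INR n - INR d) * cos (INR d * x)) n.

Lemma dirichlet_kernel_identity (n : nat) (x : R) :
  rsum (fun d => fourier_weight d * cos (INR d * x)) (S n) * sin (x / 2) = sin ((INR n + 1 / 2) * x).
Proof.
  induction n as [|n IH].
  - simpl. rewrite Rmult_0_l, cos_0. replace ((0 + 1 / 2) * x) with (x / 2) by field. ring.
  - change (rsum _ (S (S n))) with (rsum (fun d => fourier_weight d * cos (INR d * x)) (S n) +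
      2 * cos (INR (S n) * x)).
    rewrite Rmult_plus_distr_r, IH, S_INR.
    replace ((INR n + 1 / 2) * x) with ((INR n + 1) * x - x / 2) by field.
    replace ((INR n + 1 + 1 / 2) * x) with ((INR n + 1) * x + x / 2) by field.
    rewrite sin_minus, sin_plus; ring.
Qed.

(** Passing from n to n + 1 adds one Dirichlet kernel, whose closed form is the preceding
    identity. *)
Lemma fejer_sum_identity (n : nat) (x : R) :
  fejer_sum n x * sin (x / 2) ^ 2 = sin (INR n * x / 2) ^ 2.
Proof.
  induction n as [|n IH].
  - unfold fejer_sum; simpl. replace (0 * x / 2) with 0 by field. rewrite sin_0; ring.
  - assert (E : fejer_sum (S n) x = fejer_sum n x +
      rsum (fun d => fourier_weight d * cos (INR d * x)) (S n)).
    { unfold fejer_sum.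
      rewrite (rsum_ext _ (fun d => fourier_weight d * (INR n - INR d) * cos (INR d * x) +
        fourier_weight d * cos (INR d * x))) by (intros; rewrite S_INR; ring).
      rewrite rsum_plus; simpl rsum; ring. }
    rewrite E, Rmult_plus_distr_r, IH.
    replace (rsum _ _ * sin (x / 2) ^ 2) with
      (rsum (fun d => fourier_weight d * cos (INR d * x)) (S n) * sin (x / 2) * sin (x / 2)) by ring.
    rewrite dirichlet_kernel_identity, S_INR.
    replace ((INR n + 1 / 2) * x) with ((INR n * x / 2 + INR n * x / 2) + x / 2) by field.
    replace ((INR n + 1) * x / 2) with (INR n * x / 2 + x / 2) by field.
    rewrite !sin_plus, cos_plus.
    assert (Ha := sin2_cos2 (INR n * x / 2)). assert (Hb := sin2_cos2 (x / 2)).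
    unfold Rsqr in *.
    set (sa := sin (INR n * x / 2)) in *; set (ca := cos (INR n * x / 2)) in *.
    set (sb := sin (x / 2)) in *; set (cb := cos (x / 2)) in *.
    assert (ca * ca = 1 - sa * sa) by lra. assert (cb * cb = 1 - sb * sb) by lra.
    transitivity (sa * sa * (cb * cb) + sa * sa * (sb * sb) + 2 * sa * ca * cb * sb + (ca * ca) * (sb * sb) - sa * sa * (sb * sb)).
    + rewrite H0; ring.
    + ring.
Qed.

(** The closed form says nothing where sin(x/2) = 0; there every cosine equals 1 and all terms are
    nonnegative. *)
Lemma fejer_sum_ge0 (n : nat) (x : R) : 0 <= fejer_sum n x.
Proof.
  destruct (Req_dec (sin (x / 2)) 0) as [E|E].
  - assert (C1 : cos x = 1).
    { replace x with (2 * (x / 2)) by field. rewrite cos_2a_sin, E; ring. }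
    assert (S1 : sin x = 0).
    { replace x with (2 * (x / 2)) by field. rewrite sin_2a, E; ring. }
    assert (Hd : forall d, cos (INR d * x) = 1).
    { induction d as [|d IH]; [simpl; now rewrite Rmult_0_l, cos_0|].
      rewrite S_INR, Rmult_plus_distr_r, Rmult_1_l, cos_plus, IH, C1, S1; ring. }
    apply rsum_ge0; intros d Hdn. rewrite Hd.
    assert (INR d <= INR n) by (apply le_INR; lia).
    destruct d; simpl in *; nra.
  - assert (H := fejer_sum_identity n x).
    assert (0 < sin (x / 2) ^ 2) by (apply pow2_gt_0; auto).
    apply Rmult_le_reg_r with (sin (x / 2) ^ 2); auto.
    rewrite H, Rmult_0_l; apply pow2_ge_0.
Qed.

Definition fcoef (T : R) (p : R -> R) (d : nat) : C :=
  cmean T (fun s => RtoC (p s) * Cconj (zpow T d s))%C.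

(** From Re z Re w = (Re(z w) + Re(z conj w))/2; the first product has mean 0 unless both
    frequencies vanish. *)
Lemma mean_Re_mult_zpow (T : R) (a b : C) (n m : nat) : 0 < T ->
  mean T (fun t => Re (a * zpow T n t)%C * Re (b * zpow T m t)%C) =
  / 2 * (Re (a * b * (if Nat.eq_dec (n + m) 0 then 1 else 0))%C +
         Re (a * Cconj b * (if Nat.eq_dec n m then 1 else 0))%C).
Proof.
  intros HT.
  rewrite (mean_ext T _ (fun t => / 2 * (Re (a * b * (zpow T (n + m) t * Cconj (zpow T 0 t)))%C +
    Re (a * Cconj b * (zpow T n t * Cconj (zpow T m t)))%C))); auto.
  2:{ intros t _; rewrite zpow_plus, zpow_0.
      destruct a, b, (zpow T n t), (zpow T m t); simpl; field. }
  rewrite mean_scal, mean_plus, !mean_Re, !cmean_scal, !cmean_zpow; auto 14 with cts.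
Qed.

Lemma Re_mult_conj (a : C) : Re (a * Cconj a)%C = Cmod a ^ 2.
Proof. rewrite Cmod2_alt; destruct a; simpl; ring. Qed.

(** For real p the coefficients at d and -d are conjugate, which is why each d > 0 counts twice. The
    difference of the two sides is the mean square of p minus its partial Fourier sum; the induction
    adds one orthogonal term at a time. *)
Lemma bessel (T : R) (p : R -> R) (M : nat) : 0 < T -> cts p ->
  rsum (fun d => fourier_weight d * Cmod (fcoef T p d) ^ 2) M <= mean T (fun t => p t ^ 2).
Proof.
  intros HT Hp.
  set (c := fcoef T p).
  set (S_ := fun M t => rsum (fun d => fourier_weight d * Re (c d * zpow T d t)%C) M).
  assert (HS : forall M, cts (S_ M)) by (intros; unfold S_; auto 14 with cts).
  (* At d = 0 the partial sum only contains Re (c 0), so the constant coefficient must be known to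
     be real. *)
  assert (Hc0 : Im (c O) = 0).
  { change (mean T (fun s => Im (p s * Cconj (zpow T 0 s))%C) = 0).
    rewrite <- (mean_const T 0 HT).
    apply mean_ext; auto; intros t _; rewrite zpow_0; simpl; ring. }
  assert (E : mean T (fun t => (p t - S_ M t) ^ 2) =
    mean T (fun t => p t ^ 2) - rsum (fun d => fourier_weight d * Cmod (c d) ^ 2) M).
  { clear -HT Hp HS Hc0; induction M as [|M IH].
    - simpl rsum; rewrite Rminus_0_r; apply mean_ext; auto; intros; unfold S_; simpl; ring.
    - set (v := fun t => fourier_weight M * Re (c M * zpow T M t)%C).
      assert (Hv : cts v) by (unfold v; auto 14 with cts).
      rewrite (mean_ext T _ (fun t => (p t - S_ M t) ^ 2 +
        (-2 * (p t * v t) + (2 * (S_ M t * v t) + v t ^ 2)))); auto.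
      2:{ intros t _; unfold S_, v; simpl; ring. }
      rewrite !mean_plus, !mean_scal, IH; auto 14 with cts.
      assert (E1 : mean T (fun t => p t * v t) = fourier_weight M * Cmod (c M) ^ 2).
      { rewrite (mean_ext T _ (fun t => fourier_weight M *
          Re (Cconj (c M) * (RtoC (p t) * Cconj (zpow T M t)))%C)); auto.
        2:{ intros t _; unfold v; destruct (c M), (zpow T M t); simpl; ring. }
        rewrite mean_scal, mean_Re, cmean_scal; auto 14 with cts.
        fold (fcoef T p M); fold c; rewrite Cmult_comm, Re_mult_conj; reflexivity. }
      assert (E2 : mean T (fun t => S_ M t * v t) = 0).
      { rewrite (mean_ext T _ (fun t => rsum (fun d => fourier_weight d * fourier_weight M *
          (Re (c d * zpow T d t)%C * Re (c M * zpow T M t)%C)) M)); auto.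
        2:{ intros t _; unfold S_, v; rewrite Rmult_comm, <- rsum_scal.
            apply rsum_ext; intros; ring. }
        rewrite mean_rsum; auto 14 with cts.
        rewrite (rsum_ext _ (fun _ => 0)), rsum_0; [reflexivity|].
        intros d Hd; rewrite mean_scal, mean_Re_mult_zpow; auto 14 with cts.
        destruct (Nat.eq_dec (d + M) 0), (Nat.eq_dec d M); try lia.
        rewrite !Cmult_0_r; simpl; ring. }
      assert (E3 : mean T (fun t => v t ^ 2) = fourier_weight M * Cmod (c M) ^ 2).
      { rewrite (mean_ext T _ (fun t => fourier_weight M ^ 2 *
          (Re (c M * zpow T M t)%C * Re (c M * zpow T M t)%C))); auto.
        2:{ intros t _; unfold v; ring. }
        rewrite mean_scal, mean_Re_mult_zpow; auto 14 with cts.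
        destruct (Nat.eq_dec (M + M) 0), (Nat.eq_dec M M); try lia.
        - assert (M = O) as -> by lia; rewrite !Cmult_1_r, Re_mult_conj, Cmod2_alt, Hc0.
          unfold Im in Hc0; destruct (c O); simpl in *; subst; field.
        - rewrite Cmult_1_r, Re_mult_conj, Cmult_0_r; destruct M; [lia|]; simpl; field. }
      simpl rsum; rewrite E1, E2, E3; ring. }
  assert (0 <= mean T (fun t => (p t - S_ M t) ^ 2)).
  { apply mean_ge0; auto 14 with cts; intros; apply pow2_ge_0. }
  fold c; lra.
Qed.

(** With y = PI |x| / T <= 2, the bound sin y >= y - y^3/6 gives sin y >= y/3, and PI/3 > 1. It
    turns distance modulo T into the quantity that the Fejer kernel controls. *)
Lemma Rabs_le_sin (T x : R) : 0 < T -> Rabs x <= T / 2 -> Rabs x <= T * Rabs (sin (PI * x / T)).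
Proof.
  intros HT Hx.
  assert (HP : 3 < PI) by (generalize PI2_3_2; lra). assert (HP4 := PI_4).
  assert (Hs : Rabs (sin (PI * x / T)) = Rabs (sin (PI * Rabs x / T))).
  { unfold Rabs at 3; destruct (Rcase_abs x); [|reflexivity].
    replace (PI * - x / T) with (- (PI * x / T)) by (field; lra).
    now rewrite sin_neg, Rabs_Ropp. }
  rewrite Hs; set (y := PI * Rabs x / T).
  assert (Hx0 := Rabs_pos x).
  assert (Hy0 : 0 <= y) by (apply Rdiv_le_0_compat; nra).
  assert (Hyx : T * y = PI * Rabs x) by (unfold y; field; lra).
  assert (Hy2 : y <= 2) by (apply Rmult_le_reg_l with T; nra).
  assert (B := proj1 (pre_sin_bound y 0 Hy0 ltac:(lra))).
  unfold sin_approx, sin_term in B; simpl in B.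
  assert (y / 3 <= sin y) by nra.
  rewrite (Rabs_pos_eq (sin y)) by lra. nra.
Qed.

Lemma bernoulli_ge (x : R) (n : nat) : 0 <= x <= 1 -> 1 - x ^ n <= INR n * (1 - x).
Proof.
  intros Hx; induction n as [|n IH]; [simpl; lra|].
  rewrite S_INR; simpl.
  assert (0 <= x ^ n <= 1) by (split; [apply pow_le; lra | rewrite <- (pow1 n); apply pow_incr; lra]).
  nra.
Qed.

Lemma mean_pow (T : R) (q : nat) : 0 < T ->
  mean T (fun s => ((2 * s / T) ^ 2) ^ q) = / INR (2 * q + 1).
Proof.
  intros HT.
  assert (HN : 0 < INR (2 * q + 1)) by (apply lt_0_INR; lia).
  rewrite (mean_ext T _ (fun s => (2 * s / T) ^ (2 * q))) by (auto; intros; now rewrite <- pow_mult).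
  unfold mean.
  set (F := fun s => T / 2 * (2 * s / T) ^ (2 * q + 1) / INR (2 * q + 1)).
  rewrite (is_RInt_unique _ _ _ (minus (F (T / 2)) (F (- T / 2)))).
  - unfold minus, plus, opp, F; simpl.
    replace (2 * (T / 2) / T) with 1 by (field; lra).
    replace (2 * (- T / 2) / T) with (-1) by (field; lra).
    rewrite pow1. replace (q + (q + 0) + 1)%nat with (S (2 * q)) by lia.
    rewrite pow_1_odd. replace (S (2 * q)) with (2 * q + 1)%nat by lia. field; lra.
  - apply (is_RInt_derive (V := R_CompleteNormedModule) F).
    + intros s _; unfold F; auto_derive; auto.
      replace (q + (q + 0) + 1)%nat with (2 * q + 1)%nat by lia.
      replace (Nat.pred (2 * q + 1)) with (2 * q)%nat by lia.
      change (2 * s * / T) with (2 * s / T); generalize ((2 * s / T) ^ (2 * q)); intros y.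
      field; split; lra.
    + intros s _. apply (cts_pow (fun s => 2 * s / T)); auto with cts.
Qed.

Section AntianalyticMajorant.
Variables (T L Cb : R) (phi : R -> R) (q : nat).
Hypothesis HT : 0 < T.
Hypothesis Hbound : forall t, 0 <= phi t <= Cb.
Hypothesis HLip : forall t s, Rabs (phi t - phi s) <= L * Rabs (t - s).

(* The bump at the end points absorbs the jump of the T-periodic extension of [phi]. *)
Definition bumped (s : R) : R := phi s + Cb * ((2 * s / T) ^ 2) ^ q.

(** If |t - s| <= T/2 the Lipschitz bound suffices. Otherwise t and s are close only across the
    seam: s is then near an end point, where the bump is nearly [Cb] and so already exceeds phi t up
    to a multiple of the sine. *)
Lemma bumped_lower (t s : R) : - T / 2 <= t <= T / 2 -> - T / 2 <= s <= T / 2 ->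
  phi t - (L * T + 4 * INR q * Cb) * Rabs (sin (PI * (t - s) / T)) <= bumped s.
Proof.
  intros Ht Hs.
  assert (HC : 0 <= Cb) by (generalize (Hbound 0); lra).
  assert (HL : 0 <= L).
  { generalize (HLip 1 0) (Rabs_pos (phi 1 - phi 0)).
    rewrite (Rabs_pos_eq (1 - 0)) by lra; lra. }
  assert (Hq := pos_INR q).
  set (S := Rabs (sin (PI * (t - s) / T))). assert (HS : 0 <= S) by apply Rabs_pos.
  assert (HX : 0 <= (2 * s / T) ^ 2) by apply pow2_ge_0.
  assert (HXq : 0 <= ((2 * s / T) ^ 2) ^ q) by now apply pow_le.
  assert (HqCS : 0 <= 4 * INR q * Cb * S) by (repeat apply Rmult_le_pos; lra).
  assert (HLTS : 0 <= L * T * S) by (repeat apply Rmult_le_pos; lra).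
  unfold bumped.
  destruct (Rle_dec (Rabs (t - s)) (T / 2)) as [H|H].
  - assert (H1 := Rabs_le_sin T _ HT H). fold S in H1.
    assert (H2 := HLip t s). assert (H3 := Rle_abs (phi t - phi s)).
    assert (L * Rabs (t - s) <= L * (T * S)) by (apply Rmult_le_compat_l; lra).
    assert (0 <= Cb * ((2 * s / T) ^ 2) ^ q) by (apply Rmult_le_pos; lra).
    lra.
  - assert (Hd : Rabs (t - s) <= T / 2 + Rabs s /\ Rabs s <= T / 2 /\ Rabs (t - s) <= T).
    { repeat split; unfold Rabs; repeat destruct (Rcase_abs _); lra. }
    (* The representative of t - s modulo T of length at most T/2; it has the same sine up to sign.
       It yields 1 - 2|s|/T <= 2S, hence 1 - x <= 4S, and Bernoulli turns this into a bound on 1 -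
       x^q. *)
    set (y := if Rle_dec 0 (t - s) then t - s - T else t - s + T).
    assert (Hy : Rabs y = T - Rabs (t - s)).
    { unfold y; destruct (Rle_dec 0 (t - s)); unfold Rabs; repeat destruct (Rcase_abs _); lra. }
    assert (HyS : Rabs (sin (PI * y / T)) = S).
    { unfold y, S; destruct (Rle_dec 0 (t - s)).
      - replace (PI * (t - s - T) / T) with (PI * (t - s) / T - PI) by (field; lra).
        rewrite sin_minus, sin_PI, cos_PI.
        replace (_ - _) with (- sin (PI * (t - s) / T)) by ring. apply Rabs_Ropp.
      - replace (PI * (t - s + T) / T) with (PI * (t - s) / T + PI) by (field; lra).
        rewrite neg_sin. apply Rabs_Ropp. }
    assert (H1 := Rabs_le_sin T y HT ltac:(lra)). rewrite HyS in H1.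
    set (x := (2 * s / T) ^ 2) in *.
    assert (Hx : x = (2 * Rabs s / T) ^ 2).
    { unfold x; rewrite <- (pow2_abs (2 * s / T)); unfold Rdiv; rewrite !Rabs_mult.
      rewrite (Rabs_pos_eq 2), (Rabs_pos_eq (/ T)); [reflexivity | | lra].
      left; now apply Rinv_0_lt_compat. }
    assert (Hv : 0 <= 2 * Rabs s / T <= 1).
    { split; [apply Rdiv_le_0_compat; generalize (Rabs_pos s); lra|].
      apply Rmult_le_reg_r with T; auto. unfold Rdiv; rewrite Rmult_assoc, Rinv_l; lra. }
    assert (Hv2 : 1 - 2 * Rabs s / T <= 2 * S).
    { apply Rmult_le_reg_r with T; auto.
      replace ((1 - 2 * Rabs s / T) * T) with (T - 2 * Rabs s) by (field; lra). lra. }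
    assert (Hx1 : 1 - x <= 4 * S) by (rewrite Hx; nra).
    assert (B := bernoulli_ge x q ltac:(rewrite Hx; nra)).
    assert (INR q * (1 - x) <= INR q * (4 * S)) by (apply Rmult_le_compat_l; lra).
    assert (Cb * (1 - x ^ q) <= Cb * (INR q * (4 * S))) by (apply Rmult_le_compat_l; lra).
    generalize (Hbound t) (Hbound s); intros; lra.
Qed.

(** With w the q-th power in the bump, 0 <= w <= 1 and phi <= Cb give (phi + Cb w)^2 <= phi^2 + 3
    Cb^2 w, and the mean of w is 1/(2q + 1). A large q makes the bump invisible in mean square. *)
Lemma bumped_sqr_mean : cts phi ->
  mean T (fun s => bumped s ^ 2) <= mean T (fun s => phi s ^ 2) + 3 * Cb ^ 2 / INR (2 * q + 1).
Proof.
  intros Hphi.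
  apply Rle_trans with (mean T (fun s => phi s ^ 2 + 3 * Cb ^ 2 * ((2 * s / T) ^ 2) ^ q)).
  - unfold bumped; apply mean_le; auto 14 with cts.
    intros s Hs; set (x := (2 * s / T) ^ 2).
    assert (Hx : 0 <= x <= 1).
    { unfold x; split; [apply pow2_ge_0|].
      assert (-1 <= 2 * s / T <= 1).
      { split; apply Rmult_le_reg_r with T; auto; unfold Rdiv; rewrite ?Rmult_assoc, ?Rinv_l; lra. }
      nra. }
    assert (0 <= x ^ q <= 1).
    { split; [apply pow_le; lra | rewrite <- (pow1 q); apply pow_incr; lra]. }
    destruct (Hbound s). set (w := x ^ q) in *.
    assert (phi s * (Cb * w) <= Cb * (Cb * w)) by (apply Rmult_le_compat_r; nra).
    assert (Cb ^ 2 * (w * w) <= Cb ^ 2 * w) by (apply Rmult_le_compat_l; nra).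
    replace ((phi s + Cb * w) ^ 2) with (phi s ^ 2 + 2 * (phi s * (Cb * w)) + Cb ^ 2 * (w * w)) by ring.
    lra.
  - rewrite mean_plus, mean_scal, mean_pow; auto 14 with cts. lra.
Qed.

(** The Fejer mean of [bumped] with its positive frequencies dropped and its negative ones doubled;
    as [bumped] is real, this leaves the real part unchanged. *)
Definition fejer_antianalytic (n : nat) (t : R) : C :=
  apoly T (fun d => RtoC (fourier_weight d * (1 - INR d / INR n)) * fcoef T bumped d)%C n t.

Lemma Re_fejer_antianalytic (n : nat) (t : R) : cts phi -> (0 < n)%nat ->
  Re (fejer_antianalytic n t) =
  mean T (fun s => bumped s * (fejer_sum n (2 * PI * (t - s) / T) / INR n)).
Proof.
  intros Hphi Hn.
  assert (HN : 0 < INR n) by now apply lt_0_INR.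
  assert (Hb : cts bumped) by (unfold bumped; auto 14 with cts).
  unfold fejer_antianalytic, apoly; rewrite Re_csum.
  rewrite (mean_ext T _ (fun s => rsum (fun d => (fourier_weight d * (1 - INR d / INR n)) *
    Re (zpow T d t * (RtoC (bumped s) * Cconj (zpow T d s)))%C) n)); auto.
  2:{ intros s _; unfold fejer_sum; unfold Rdiv at 1; rewrite <- Rmult_assoc, (Rmult_comm _ (/ INR n)).
      rewrite <- Rmult_assoc, <- rsum_scal.
      apply rsum_ext; intros d _.
      replace (zpow T d t * (bumped s * Cconj (zpow T d s)))%C with
        (RtoC (bumped s) * (zpow T d t * Cconj (zpow T d s)))%C by ring.
      unfold zpow; rewrite <- cis_opp, <- cis_plus.
      replace (- (2 * PI * INR d * t / T) + - - (2 * PI * INR d * s / T)) with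
        (- (INR d * (2 * PI * (t - s) / T))) by (field; lra).
      unfold cis; rewrite cos_neg; simpl; field; lra. }
  rewrite mean_rsum; auto 14 with cts.
  apply rsum_ext; intros d _.
  rewrite mean_scal, mean_Re, cmean_scal; auto 14 with cts.
  fold (fcoef T bumped d).
  destruct (fcoef T bumped d), (zpow T d t); simpl; ring.
Qed.

Lemma mean_fejer (n : nat) (t : R) : (0 < n)%nat ->
  mean T (fun s => fejer_sum n (2 * PI * (t - s) / T) / INR n) = 1.
Proof.
  intros Hn.
  assert (HN : 0 < INR n) by now apply lt_0_INR.
  rewrite (mean_ext T _ (fun s => rsum (fun d => (fourier_weight d * (1 - INR d / INR n)) *
    Re (zpow T d t * (zpow T 0 s * Cconj (zpow T d s)))%C) n)); auto.
  2:{ intros s _; unfold fejer_sum; unfold Rdiv at 1; rewrite Rmult_comm, <- rsum_scal.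
      apply rsum_ext; intros d _.
      replace (zpow T d t * (zpow T 0 s * Cconj (zpow T d s)))%C with
        (zpow T d t * Cconj (zpow T d s))%C by (rewrite zpow_0; ring).
      unfold zpow; rewrite <- cis_opp, <- cis_plus.
      replace (- (2 * PI * INR d * t / T) + - - (2 * PI * INR d * s / T)) with
        (- (INR d * (2 * PI * (t - s) / T))) by (field; lra).
      unfold cis; rewrite cos_neg; simpl; field; lra. }
  rewrite mean_rsum; auto 14 with cts.
  rewrite (rsum_ext _ (fun d => if Nat.eq_dec d 0 then 1 else 0)).
  - now rewrite (rsum_single (fun _ => 1)).
  - intros d _; rewrite mean_scal, mean_Re, cmean_scal, cmean_zpow; auto 14 with cts.
    destruct (Nat.eq_dec 0 d) as [<-|Hd], (Nat.eq_dec _ 0); try lia.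
    + rewrite zpow_0; simpl; field; lra.
    + rewrite Cmult_0_r; simpl; ring.
Qed.

Lemma cts_fejer (n : nat) (t : R) : cts (fun s => fejer_sum n (2 * PI * (t - s) / T) / INR n).
Proof. unfold fejer_sum; auto 14 with cts. Qed.

(** Averaging [bumped_lower] against the kernel leaves the mean of |sin| to be bounded. Splitting
    |S| <= beta/2 + S^2/(2 beta) reduces it to the total mass 1 and to K S^2 <= 1/n, which is the
    closed form of the kernel. *)
Lemma fejer_antianalytic_lower (n : nat) (beta t : R) : cts phi -> (0 < n)%nat -> 0 < beta ->
  - T / 2 <= t <= T / 2 ->
  phi t - (L * T + 4 * INR q * Cb) * (beta / 2 + / (2 * beta * INR n)) <= Re (fejer_antianalytic n t).
Proof.
  intros Hphi Hn Hbeta Ht.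
  assert (HN : 0 < INR n) by now apply lt_0_INR.
  assert (Hb : cts bumped) by (unfold bumped; auto 14 with cts).
  assert (HK := cts_fejer n t).
  set (K := fun s => fejer_sum n (2 * PI * (t - s) / T) / INR n) in *.
  set (L1 := L * T + 4 * INR q * Cb).
  assert (HL1 : 0 <= L1).
  { assert (0 <= Cb) by (generalize (Hbound 0); lra).
    assert (HL : 0 <= L).
    { generalize (HLip 1 0) (Rabs_pos (phi 1 - phi 0)).
      rewrite (Rabs_pos_eq (1 - 0)) by lra; lra. }
    assert (Hq := pos_INR q). unfold L1. apply Rplus_le_le_0_compat; repeat apply Rmult_le_pos; lra. }
  rewrite Re_fejer_antianalytic by assumption.
  change (fun s => bumped s * (fejer_sum n (2 * PI * (t - s) / T) / INR n)) with (fun s => bumped s * K s).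
  apply Rle_trans with (mean T (fun s => (phi t - L1 * (beta / 2)) * K s - L1 * / (2 * beta * INR n))).
  - rewrite mean_minus, mean_scal, mean_const; auto 14 with cts.
    unfold K; rewrite mean_fejer by assumption. lra.
  - apply mean_le; auto 14 with cts.
    intros s Hs.
    assert (Hlow := bumped_lower t s Ht Hs). fold L1 in Hlow.
    assert (HK0 : 0 <= K s) by (apply Rdiv_le_0_compat; [apply fejer_sum_ge0 | assumption]).
    set (S := sin (PI * (t - s) / T)) in *.
    assert (HKS : K s * S ^ 2 <= / INR n).
    { assert (E := fejer_sum_identity n (2 * PI * (t - s) / T)).
      replace (2 * PI * (t - s) / T / 2) with (PI * (t - s) / T) in E by (field; lra).
      fold S in E. unfold K.
      replace (_ / INR n * S ^ 2) with (fejer_sum n (2 * PI * (t - s) / T) * S ^ 2 * / INR n) by (field; lra).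
      rewrite E. rewrite <- (Rmult_1_l (/ INR n)) at 2.
      apply Rmult_le_compat_r; [left; now apply Rinv_0_lt_compat|].
      generalize (SIN_bound (INR n * (2 * PI * (t - s) / T) / 2)); nra. }
    assert (HAM : Rabs S <= beta / 2 + S ^ 2 / (2 * beta)).
    { rewrite <- (pow2_abs S). apply Rmult_le_reg_l with (2 * beta); [lra|].
      replace (2 * beta * (beta / 2 + Rabs S ^ 2 / (2 * beta))) with (beta ^ 2 + Rabs S ^ 2) by (field; lra).
      generalize (pow2_ge_0 (beta - Rabs S)); nra. }
    apply Rle_trans with ((phi t - L1 * (beta / 2 + S ^ 2 / (2 * beta))) * K s).
    + assert (K s * S ^ 2 / (2 * beta) <= / (2 * beta * INR n)).
      { rewrite Rinv_mult, (Rmult_comm _ (/ INR n)); unfold Rdiv.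
        apply Rmult_le_compat_r; [left; apply Rinv_0_lt_compat; lra | exact HKS]. }
      assert (L1 * (K s * S ^ 2 / (2 * beta)) <= L1 * / (2 * beta * INR n)) by now apply Rmult_le_compat_l.
      replace ((phi t - L1 * (beta / 2 + S ^ 2 / (2 * beta))) * K s) with
        ((phi t - L1 * (beta / 2)) * K s - L1 * (K s * S ^ 2 / (2 * beta))) by (field; lra).
      lra.
    + apply Rmult_le_compat_r; auto.
      assert (L1 * Rabs S <= L1 * (beta / 2 + S ^ 2 / (2 * beta))) by now apply Rmult_le_compat_l.
      lra.
Qed.

(** Doubling a coefficient multiplies its square by 4, which is twice its share 2 |c_d|^2 in
    Bessel's inequality; at d = 0, |eta + c_0|^2 <= 2 eta^2 + 2 |c_0|^2. Hence the overall factor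
    2. *)
Lemma fejer_antianalytic_mean_sqr (n : nat) (eta : R) : cts phi -> (0 < n)%nat ->
  mean T (fun t => Cmod (eta + fejer_antianalytic n t)%C ^ 2) <=
  2 * mean T (fun s => bumped s ^ 2) + 2 * eta ^ 2.
Proof.
  intros Hphi Hn.
  assert (HN : 0 < INR n) by now apply lt_0_INR.
  assert (Hb : cts bumped) by (unfold bumped; auto 14 with cts).
  set (c := fun d => (RtoC (fourier_weight d * (1 - INR d / INR n)) * fcoef T bumped d)%C).
  rewrite (mean_ext T _ (fun t => Cmod (apoly T (fun d => (if Nat.eq_dec d 0 then RtoC eta else 0) + c d)%C n t) ^ 2)); auto.
  2:{ intros t _; do 2 f_equal. unfold apoly.
      rewrite (csum_ext _ (fun d => (if Nat.eq_dec d 0 then RtoC eta else 0) + c d * zpow T d t)%C).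
      - rewrite csum_plus; f_equal. symmetry; apply (csum_single (fun _ => RtoC eta)); assumption.
      - intros d _; destruct (Nat.eq_dec d 0) as [->|]; rewrite ?zpow_0; ring. }
  rewrite parseval by assumption.
  apply Rle_trans with (rsum (fun d => 2 * (fourier_weight d * Cmod (fcoef T bumped d) ^ 2) +
    (if Nat.eq_dec d 0 then 2 * eta ^ 2 else 0)) n).
  - apply rsum_le; intros d Hd.
    assert (Hdn : 0 <= 1 - INR d / INR n <= 1).
    { assert (INR d <= INR n) by (apply le_INR; lia). assert (0 <= INR d) by apply pos_INR.
      split; apply Rmult_le_reg_r with (INR n); auto;
      replace ((1 - INR d / INR n) * INR n) with (INR n - INR d) by (field; lra); lra. }
    unfold c; destruct (Nat.eq_dec d 0) as [->|Hd0].
    + simpl fourier_weight; simpl INR.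
      replace (1 * (1 - 0 / INR n)) with 1 by (field; lra); rewrite Cmult_1_l.
      set (z := fcoef T bumped 0).
      assert (Cmod (eta + z) <= Rabs eta + Cmod z) by (rewrite <- Cmod_R; apply Cmod_triangle).
      assert (Hsq : Cmod (eta + z) ^ 2 <= (Rabs eta + Cmod z) ^ 2).
      { apply pow_incr; split; [apply Cmod_ge_0 | assumption]. }
      generalize (pow2_ge_0 (Rabs eta - Cmod z)) (pow2_abs eta); nra.
    + rewrite Cplus_0_l, !Cmod_mult, Rplus_0_r.
      destruct d; [lia|]; simpl fourier_weight. rewrite Cmod_RtoC by lra.
      set (y := 1 - INR (S d) / INR n) in *. set (z := Cmod (fcoef T bumped (S d))).
      replace ((2 * y * z) ^ 2) with (4 * (y * y) * z ^ 2) by ring.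
      replace (2 * (2 * z ^ 2)) with (4 * 1 * z ^ 2) by ring.
      apply Rmult_le_compat_r; [apply pow2_ge_0 | nra].
  - rewrite rsum_plus, rsum_scal.
    rewrite (rsum_single (fun _ => 2 * eta ^ 2)) by assumption.
    generalize (bessel T bumped n HT Hb); lra.
Qed.

End AntianalyticMajorant.

(** The strict inequality for [A] leaves room 2g: one g pays for the bump, the other for the
    constant eta, which lifts the Fejer mean above phi. The size of L does not enter the final
    bound; it only affects n. *)
Lemma antianalytic_majorant (T L Cb A : R) (phi : R -> R) : 0 < T -> cts phi ->
  (forall t, 0 <= phi t <= Cb) ->
  (forall t s, Rabs (phi t - phi s) <= L * Rabs (t - s)) ->
  mean T (fun t => phi t ^ 2) < A ->
  exists h, is_apoly T h /\ (forall t, - T / 2 <= t <= T / 2 -> phi t <= Re (h t)) /\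
    mean T (fun t => Cmod (h t) ^ 2) <= 2 * A.
Proof.
  intros HT Hphi HB HL HA.
  set (g := (A - mean T (fun t => phi t ^ 2)) / 2).
  assert (Hg : 0 < g) by (unfold g; lra).
  destruct (archimed_cor1 (g / (3 * Cb ^ 2 + 1))) as (q & Hq & Hq0).
  { apply Rdiv_lt_0_compat; nra. }
  (* Both bounds are used together: eta <= 1 and eta <= g give eta^2 <= g. *)
  set (eta := Rmin 1 g).
  assert (He : 0 < eta <= 1 /\ eta <= g).
  { unfold eta; repeat split; [apply Rmin_glb_lt; lra | apply Rmin_l | apply Rmin_r]. }
  set (L1 := L * T + 4 * INR q * Cb).
  set (beta := eta / (Rabs L1 + 1)).
  assert (HL1 := Rabs_pos L1).
  assert (Hbeta : 0 < beta) by (apply Rdiv_lt_0_compat; lra).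
  destruct (archimed_cor1 (beta * eta / (Rabs L1 + 1))) as (n & Hn & Hn0).
  { apply Rdiv_lt_0_compat; nra. }
  assert (HN : 0 < INR n) by now apply lt_0_INR.
  exists (fun t => eta + fejer_antianalytic T Cb phi q n t)%C; split; [|split].
  - apply is_apoly_plus; [apply is_apoly_const|].
    eexists _, _; intros; reflexivity.
  - intros t Ht.
    assert (H := fejer_antianalytic_lower T L Cb phi q HT HB HL n beta t Hphi Hn0 Hbeta Ht).
    fold L1 in H.
    assert (L1 * (beta / 2 + / (2 * beta * INR n)) <= eta).
    { apply Rle_trans with ((Rabs L1 + 1) * (beta / 2 + / (2 * beta * INR n))).
      - apply Rmult_le_compat_r; [|generalize (Rle_abs L1); lra].
        apply Rplus_le_le_0_compat; [lra|]. left; apply Rinv_0_lt_compat; nra.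
      - rewrite Rmult_plus_distr_l.
        assert ((Rabs L1 + 1) * (beta / 2) = eta / 2) by (unfold beta; field; lra).
        assert ((Rabs L1 + 1) * / (2 * beta * INR n) <= eta / 2).
        { apply Rle_trans with ((Rabs L1 + 1) / (2 * beta) * (beta * eta / (Rabs L1 + 1))).
          - rewrite Rinv_mult. unfold Rdiv. rewrite <- Rmult_assoc.
            apply Rmult_le_compat_l; [|unfold Rdiv in Hn; lra].
            apply Rmult_le_pos; [lra|]. left; apply Rinv_0_lt_compat; lra.
          - right; field; lra. }
        lra. }
    simpl. unfold Re in H. lra.
  - eapply Rle_trans; [apply (fejer_antianalytic_mean_sqr T Cb phi q HT n eta Hphi Hn0)|].
    assert (H := bumped_sqr_mean T Cb phi q HT HB Hphi).
    assert (3 * Cb ^ 2 / INR (2 * q + 1) <= g).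
    { assert (H1 : 0 < INR q) by now apply lt_0_INR.
      assert (H2 : INR q <= INR (2 * q + 1)) by (apply le_INR; lia).
      assert (H3 : / INR (2 * q + 1) <= / INR q) by (apply Rinv_le_contravar; lra).
      apply Rle_trans with ((3 * Cb ^ 2 + 1) * (g / (3 * Cb ^ 2 + 1))).
      - unfold Rdiv at 1. apply Rmult_le_compat; [nra | | lra | lra].
        left; apply Rinv_0_lt_compat; lra.
      - right; field; nra. }
    assert (eta ^ 2 <= g) by nra.
    unfold g in *; lra.
Qed.

(** * The multiplier construction *)

(** Only finitely many majorants are selected, so no choice axiom is called for; [u0] fills the
    indices from m on. *)
Lemma finite_choice {U : Type} (u0 : U) (P : nat -> U -> Prop) (m : nat) :
  (forall i, (i < m)%nat -> exists u, P i u) ->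
  exists f : nat -> U, forall i, (i < m)%nat -> P i (f i).
Proof.
  induction m as [|m IH]; intros H; [exists (fun _ => u0); lia|].
  destruct IH as [f Hf]; [intros; apply H; lia|].
  destruct (H m) as [u Hu]; [lia|].
  exists (fun i => if Nat.eq_dec i m then u else f i); intros i Hi.
  destruct (Nat.eq_dec i m) as [->|]; [exact Hu | apply Hf; lia].
Qed.

Lemma geom_tail (x : R) (j m : nat) : 0 < x < 1 ->
  rsum (fun l => if le_dec j l then x ^ l else 0) m <= x ^ j / (1 - x).
Proof.
  intros Hx.
  assert (H : rsum (fun l => if le_dec j l then x ^ l else 0) m <= (x ^ j - x ^ max j m) / (1 - x)).
  { induction m as [|m IH]; simpl rsum.
    - rewrite Nat.max_0_r; right; field; lra.
    - destruct (le_dec j m).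
      + rewrite Nat.max_r in * by lia. simpl (x ^ S m).
        eapply Rle_trans; [apply Rplus_le_compat_r, IH|]; right; field; lra.
      + rewrite Nat.max_l in * by lia. lra. }
  eapply Rle_trans; [exact H|].
  apply Rmult_le_compat_r; [left; apply Rinv_0_lt_compat; lra|].
  assert (0 < x ^ max j m) by (apply pow_lt; lra). lra.
Qed.

(** Convexity of exp: the tangent at p = -eps x lies below exp at 0 and at -eps, and averaging the
    two inequalities with weights 1 - x and x cancels the linear terms. *)
Lemma exp_chord (eps x : R) : 0 <= x <= 1 -> exp (- eps * x) <= 1 - x + x * exp (- eps).
Proof.
  intros Hx; set (p := - eps * x).
  assert (H1 : exp p * (1 - p) <= 1).
  { generalize (exp_ineq1_le (- p)); intros. generalize (exp_pos p); intros.
    replace 1 with (exp p * exp (- p)) at 2 by (rewrite <- exp_plus, Rplus_opp_r; apply exp_0).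
    apply Rmult_le_compat_l; lra. }
  assert (H2 : exp p * (1 + (- eps - p)) <= exp (- eps)).
  { replace (exp (- eps)) with (exp p * exp (- eps - p)) by (rewrite <- exp_plus; f_equal; ring).
    apply Rmult_le_compat_l; [left; apply exp_pos | apply exp_ineq1_le]. }
  replace (exp p) with ((1 - x) * (exp p * (1 - p)) + x * (exp p * (1 + (- eps - p))))
    by (unfold p; ring).
  apply Rplus_le_compat; nra.
Qed.

(** One more index turns the sum S into exp(-eps y) S + x. As exp(-eps y) <= 1 - x (1 - exp(-eps)),
    this map preserves S <= B for B = 1/(1 - exp(-eps)), so the bound does not depend on m. *)
Lemma exp_damped_sum_le (eps : R) (x y : nat -> R) (m : nat) : 0 < eps ->
  (forall i, (i < m)%nat -> 0 <= x i <= 1) -> (forall i, (i < m)%nat -> x i <= y i) ->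
  rsum (fun i => x i * exp (- rsum (fun l => if lt_dec i l then eps * y l else 0) m)) m
  <= 1 / (1 - exp (- eps)).
Proof.
  intros He Hx Hy.
  assert (E1 : exp (- eps) < 1) by (rewrite <- exp_0; apply exp_increasing; lra).
  set (B := 1 / (1 - exp (- eps))).
  assert (HB : B * (1 - exp (- eps)) = 1) by (unfold B; field; lra).
  assert (HB0 : 0 < B) by (apply Rdiv_lt_0_compat; lra).
  induction m as [|m IH]; [simpl; lra|].
  specialize (IH ltac:(intros; apply Hx; lia) ltac:(intros; apply Hy; lia)).
  simpl rsum at 1.
  rewrite (rsum_ext _ (fun i => exp (- eps * y m) *
    (x i * exp (- rsum (fun l => if lt_dec i l then eps * y l else 0) m)))).
  2:{ intros i Hi; simpl; destruct (lt_dec i m); [|lia].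
      rewrite Ropp_plus_distr, exp_plus.
      replace (- (eps * y m)) with (- eps * y m) by ring. ring. }
  rewrite rsum_scal.
  rewrite (rsum_ext (fun l => if lt_dec m l then eps * y l else 0) (fun _ => 0)), rsum_0.
  2:{ intros k Hk; destruct (lt_dec m k); [lia | reflexivity]. }
  destruct (lt_dec m m); [lia|].
  rewrite Rplus_0_r, Ropp_0, exp_0, Rmult_1_r.
  assert (Hxm := Hx m ltac:(lia)). assert (Hym := Hy m ltac:(lia)).
  assert (H1 : exp (- eps * y m) <= 1 - x m + x m * exp (- eps)).
  { eapply Rle_trans; [|now apply exp_chord]. apply exp_le; nra. }
  assert (H2 : 0 < exp (- eps * y m)) by apply exp_pos.
  set (S := rsum _ m) in *.
  apply Rle_trans with (exp (- eps * y m) * B + x m).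
  - apply Rplus_le_compat_r, Rmult_le_compat_l; lra.
  - apply Rle_trans with ((1 - x m + x m * exp (- eps)) * B + x m).
    + apply Rplus_le_compat_r, Rmult_le_compat_r; lra.
    + replace ((1 - x m + x m * exp (- eps)) * B + x m) with (B + x m * (1 - B * (1 - exp (- eps)))) by ring.
      rewrite HB; lra.
Qed.

Lemma Cmod_cis_sub (x y : R) : Cmod (cis x - cis y)%C <= Rabs (x - y).
Proof.
  assert (H : Cmod (Cexp (Ci * (x - y)%R) - 1)%C <= Cmod (Ci * (x - y)%R)%C * exp 0).
  { apply Cexp_sub1_le; [lra|]. simpl; lra. }
  rewrite Cexp_Ci, exp_0, Rmult_1_r, Cmod_mult, Cmod_Ci, Rmult_1_l, Cmod_R in H.
  replace (cis x - cis y)%C with (cis y * (cis (x - y) - 1))%C.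
  - rewrite Cmod_mult, Cmod_cis; lra.
  - replace x with (y + (x - y)) at 2 by ring. rewrite cis_plus; ring.
Qed.

Lemma Cmod_sub_abs (z w : C) : Rabs (Cmod z - Cmod w) <= Cmod (z - w)%C.
Proof.
  assert (H1 := Cmod_triangle (z - w)%C w). assert (H2 := Cmod_triangle (w - z)%C z).
  replace (z - w + w)%C with z in H1 by ring. replace (w - z + z)%C with w in H2 by ring.
  replace (w - z)%C with (- (z - w))%C in H2 by ring. rewrite Cmod_opp in H2.
  apply Rabs_le; lra.
Qed.

(** Supplies the Lipschitz hypothesis of [antianalytic_majorant] for the modulus of a block
    polynomial. *)
Lemma cis_sum_lipschitz (c : nat -> C) (w : nat -> R) (N : nat) (t s : R) :
  (forall k, Cmod (c k) <= 1) ->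
  Rabs (Cmod (csum (fun k => c k * cis (w k * t))%C N) - Cmod (csum (fun k => c k * cis (w k * s))%C N))
  <= rsum (fun k => Rabs (w k)) N * Rabs (t - s).
Proof.
  intros Hc; eapply Rle_trans; [apply Cmod_sub_abs|].
  replace (csum (fun k => c k * cis (w k * t))%C N - csum (fun k => c k * cis (w k * s))%C N)%C
    with (csum (fun k => c k * (cis (w k * t) - cis (w k * s)))%C N).
  2:{ replace (csum (fun k => c k * cis (w k * s))%C N) with (- (-1 * csum (fun k => c k * cis (w k * s)) N))%C by ring.
      rewrite <- csum_scal.
      transitivity (csum (fun k => c k * cis (w k * t)) N + csum (fun k => -1 * (c k * cis (w k * s))) N)%C; [|ring].
      rewrite <- csum_plus; apply csum_ext; intros; ring. }
  eapply Rle_trans; [apply Cmod_csum|].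
  rewrite Rmult_comm, <- rsum_scal; apply rsum_le; intros k _; rewrite Cmod_mult.
  assert (H := Cmod_cis_sub (w k * t) (w k * s)).
  replace (w k * t - w k * s) with (w k * (t - s)) in H by ring.
  rewrite Rabs_mult in H.
  generalize (Hc k) (Cmod_ge_0 (c k)) (Cmod_ge_0 (cis (w k * t) - cis (w k * s)))
    (Rabs_pos (w k)) (Rabs_pos (t - s)); intros.
  nra.
Qed.

Definition csign (z : C) : C := if Req_EM_T (Cmod z) 0 then 0%C else (z / Cmod z)%C.

Lemma csign_le (z : C) : Cmod (csign z) <= 1.
Proof.
  unfold csign; destruct (Req_EM_T (Cmod z) 0) as [E|E]; [rewrite Cmod_0; lra|].
  assert (HC : RtoC (Cmod z) <> 0%C) by (intros H; apply E; now injection H).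
  rewrite Cmod_div, (Cmod_RtoC (Cmod z)) by (auto; apply Cmod_ge_0).
  right; field; exact E.
Qed.

Lemma conj_csign (z : C) : (Cconj z * csign z)%C = Cmod z.
Proof.
  unfold csign; destruct (Req_EM_T (Cmod z) 0) as [E|E]; [rewrite E; ring|].
  assert (HC : RtoC (Cmod z) <> 0%C) by (intros H; apply E; now injection H).
  transitivity ((z * Cconj z) / Cmod z)%C; [field; assumption|].
  rewrite <- Cmod2_conj. simpl; rewrite !RtoC_mult; field; assumption.
Qed.

(** Here x stands for 1/r, so x^(2i) is rho^(-i), the inverse of the block length; [b] assigns
    blocks and [w] gives angular frequencies. The coefficients [u] stay free so that the norm bounds
    can be stated without reference to [a]. *)
Definition block_poly (x : R) (b : nat -> nat) (u : nat -> C) (w : nat -> R) (N i : nat) (t : R) : C :=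
  csum (fun k => (if Nat.eq_dec (b k) i then RtoC (x ^ (2 * i)) * u k else 0) * cis (w k * t))%C N.

Lemma ccts_block_poly (x : R) (b : nat -> nat) (u : nat -> C) (w : nat -> R) (N i : nat) :
  ccts (block_poly x b u w N i).
Proof. unfold block_poly; auto 14 with cts. Qed.
#[local] Hint Resolve ccts_block_poly : cts.

Section MultiplierConstruction.
Variables (T eps x A1 A2 gam Delta : R) (N m : nat) (a : nat -> C) (w : nat -> R) (b : nat -> nat)
  (G : R -> R) (sigma : nat -> nat -> R).
Hypothesis HT : 0 < T.
Hypothesis Heps : 0 < eps.
Hypothesis Hx : 0 < x < 1.
Hypothesis HA1 : 0 < A1.
Hypothesis HA2 : 0 < A2.
Hypothesis HG : cts G.
Hypothesis HG1 : forall t, - T / 2 <= t <= T / 2 -> 0 <= G t <= 1.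
Hypothesis Hgam : wcoef T G 0 = gam.
Hypothesis Hb : forall k, (k < N)%nat -> (b k < m)%nat.
Hypothesis Hblock : forall i,
  rsum (fun k => if Nat.eq_dec (b k) i then x ^ (2 * i) else 0) N <= 1.
Hypothesis Hnorm1 : forall u i, (i < m)%nat -> (forall k, Cmod (u k) <= 1) ->
  mean T (fun t => Cmod (block_poly x b u w N i t) ^ 2) < A1 ^ 2 * x ^ (2 * i).
Hypothesis Hnorm2 : forall u i, (i < m)%nat -> (forall k, Cmod (u k) <= 1) ->
  mean T (fun t => Cmod (block_poly x b u w N i t) ^ 2 * G t) <= A2 ^ 2 * x ^ (2 * i).
Hypothesis Hsigma0 : forall l k, 0 <= sigma l k.
Hypothesis Hsigma : forall l k M, (l < N)%nat -> (k < N)%nat -> (b l < b k)%nat ->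
  rsum (fun n => Cmod (wcoef T G (w l - w k - 2 * PI * INR n / T)) ^ 2) M <= sigma l k ^ 2.
Hypothesis HDelta : forall k, (k < N)%nat ->
  rsum (fun l => if Nat.eq_dec l k then 0 else
    x ^ (2 * b l) * (if le_dec (b k) (b l) then Cmod (wcoef T G (w l - w k)) else sigma l k)) N
  <= Delta * x ^ (2 * b k).

Definition block_unimod : nat -> R -> C := block_poly x b (fun k => csign (a k)) w N.
Let f := block_unimod.

Lemma block_unimod_le1 (i : nat) (t : R) : Cmod (f i t) <= 1.
Proof.
  eapply Rle_trans; [apply Cmod_csum|]. eapply Rle_trans; [|apply (Hblock i)].
  apply rsum_le; intros k _; rewrite Cmod_mult, Cmod_cis, Rmult_1_r.
  destruct (Nat.eq_dec (b k) i); [|rewrite Cmod_0; lra].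
  assert (0 <= x ^ (2 * i)) by (apply pow_le; lra).
  rewrite Cmod_mult, Cmod_RtoC by assumption.
  generalize (csign_le (a k)); nra.
Qed.

(** [Hnorm1] is strict because the majorant is obtained only with an arbitrarily small loss. *)
Lemma antianalytic_family : exists h : nat -> R -> C,
  (forall i, (i < m)%nat -> is_apoly T (h i)) /\
  (forall i t, (i < m)%nat -> - T / 2 <= t <= T / 2 -> Cmod (f i t) <= Re (h i t)) /\
  (forall i, (i < m)%nat -> mean T (fun t => Cmod (h i t) ^ 2) <= (sqrt 2 * A1 * x ^ i) ^ 2).
Proof.
  destruct (finite_choice (fun _ : R => RtoC 0) (fun i h => is_apoly T h /\
    (forall t, - T / 2 <= t <= T / 2 -> Cmod (f i t) <= Re (h t)) /\
    mean T (fun t => Cmod (h t) ^ 2) <= 2 * (A1 ^ 2 * x ^ (2 * i))) m) as [h Hh].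
  - intros i Hi.
    apply (antianalytic_majorant T (rsum (fun k => Rabs (w k)) N) 1); auto.
    + apply cts_Cmod, ccts_block_poly.
    + intros t; split; [apply Cmod_ge_0 | apply block_unimod_le1].
    + intros t s; apply (cis_sum_lipschitz (fun k => if Nat.eq_dec (b k) i then RtoC (x ^ (2 * i)) * csign (a k) else 0)%C).
      intros k; destruct (Nat.eq_dec (b k) i); [|rewrite Cmod_0; lra].
      assert (0 <= x ^ (2 * i) <= 1).
      { split; [apply pow_le; lra | rewrite <- (pow1 (2 * i)); apply pow_incr; lra]. }
      rewrite Cmod_mult, Cmod_RtoC by lra.
      generalize (csign_le (a k)) (Cmod_ge_0 (csign (a k))); nra.
    + apply Hnorm1; auto; intros; apply csign_le.
  - exists h; repeat split; intros i; intros; destruct (Hh i) as (H1 & H2 & H3); auto.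
    eapply Rle_trans; [exact H3|]. rewrite !Rpow_mult_distr.
    replace (sqrt 2 ^ 2) with 2 by (simpl; rewrite Rmult_1_r, sqrt_sqrt; lra).
    rewrite <- pow_mult, (Nat.mul_comm i 2); lra.
Qed.

Section WithFamily.
Variable h : nat -> R -> C.
Hypothesis Hh1 : forall i, (i < m)%nat -> is_apoly T (h i).
Hypothesis Hh2 : forall i t, (i < m)%nat -> - T / 2 <= t <= T / 2 -> Cmod (f i t) <= Re (h i t).
Hypothesis Hh3 : forall i, (i < m)%nat ->
  mean T (fun t => Cmod (h i t) ^ 2) <= (sqrt 2 * A1 * x ^ i) ^ 2.

Definition tail_exponent (i : nat) (t : R) : C :=
  csum (fun l => if lt_dec i l then RtoC eps * h l t else 0)%C m.
Let H := tail_exponent.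
Let E (i : nat) (t : R) : C := Cexp (- H i t).

Lemma is_apoly_csum_lt (g : nat -> R -> C) (n : nat) :
  (forall k, (k < n)%nat -> is_apoly T (g k)) -> is_apoly T (fun t => csum (fun k => g k t) n).
Proof.
  induction n as [|n IH]; intros Hg; simpl; [apply is_apoly_const|].
  apply is_apoly_plus; [apply IH; intros; apply Hg; lia | apply Hg; lia].
Qed.

Lemma is_apoly_tail (i : nat) : is_apoly T (H i).
Proof.
  apply (is_apoly_csum_lt (fun l t => if lt_dec i l then RtoC eps * h l t else 0)%C).
  intros l Hl; destruct (lt_dec i l); [apply is_apoly_scal; auto | apply is_apoly_const].
Qed.

Lemma Re_tail (i : nat) (t : R) :
  Re (H i t) = rsum (fun l => if lt_dec i l then eps * Re (h l t) else 0) m.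
Proof.
  unfold H, tail_exponent; rewrite Re_csum; apply rsum_ext; intros l _.
  destruct (lt_dec i l); unfold Re; simpl; ring.
Qed.

Lemma Re_tail_ge0 (i : nat) (t : R) : - T / 2 <= t <= T / 2 -> 0 <= Re (H i t).
Proof.
  intros Ht; rewrite Re_tail; apply rsum_ge0; intros l Hl; destruct (lt_dec i l); [|lra].
  generalize (Hh2 l t Hl Ht) (Cmod_ge_0 (f l t)); nra.
Qed.

Lemma ccts_tail_factor (i : nat) : ccts (E i).
Proof. apply ccts_Cexp, ccts_opp, (is_apoly_ccts T), is_apoly_tail. Qed.
Local Hint Resolve ccts_tail_factor : cts.

Lemma ccts_block (i : nat) : ccts (f i).
Proof. apply ccts_block_poly. Qed.
Local Hint Resolve ccts_block : cts.

(** Since Re H >= 0, the bound |exp(-H) - 1| <= |H| is available. *)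
Lemma tail_factor_sub1 (i : nat) (t : R) : - T / 2 <= t <= T / 2 ->
  Cmod (E i t - 1)%C <= rsum (fun l => if lt_dec i l then eps * Cmod (h l t) else 0) m.
Proof.
  intros Ht; eapply Rle_trans; [apply (Cexp_sub1_le _ 0); [lra|]|].
  - generalize (Re_tail_ge0 i t Ht). unfold Re; simpl; lra.
  - rewrite exp_0, Rmult_1_r, Cmod_opp.
    eapply Rle_trans; [apply Cmod_csum|]. apply rsum_le; intros l _.
    destruct (lt_dec i l); [|rewrite Cmod_0; lra].
    rewrite Cmod_mult, Cmod_RtoC; lra.
Qed.

(** Each l > i contributes eps times the pairing of |f_i| G with |h_l|. Cauchy-Schwarz gives (A2
    x^i)(sqrt 2 A1 x^l), and summing over l > i leaves x^(i+1)/(1 - x). *)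
Lemma near_term (i : nat) : (i < m)%nat ->
  mean T (fun t => Cmod (f i t) * Cmod (E i t - 1)%C * G t) <=
  eps * sqrt 2 * A1 * A2 * (x ^ (2 * i) * (x / (1 - x))).
Proof.
  intros Hi.
  assert (Hs2 : 0 < sqrt 2) by (apply sqrt_lt_R0; lra).
  assert (Hch : forall l, (l < m)%nat -> ccts (h l)) by (intros; now apply (is_apoly_ccts T), Hh1).
  (* Nothing is known about [h l] for l >= m, not even continuity, whereas exchanging mean and sum
     asks for continuity at every index. *)
  set (g := fun l t => if lt_dec l m then Cmod (h l t) else 0).
  assert (Hg : forall l, cts (g l)).
  { intros l; unfold g; destruct (lt_dec l m); auto with cts. }
  apply Rle_trans with (mean T (fun t => rsum (fun l => (if lt_dec i l then eps else 0) *
    ((Cmod (f i t) * G t) * g l t)) m)).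
  - apply mean_le; auto 14 with cts.
    intros t Ht. assert (B := tail_factor_sub1 i t Ht).
    replace (Cmod (f i t) * Cmod (E i t - 1) * G t) with ((Cmod (f i t) * G t) * Cmod (E i t - 1)) by ring.
    eapply Rle_trans; [apply Rmult_le_compat_l; [|exact B]|].
    + destruct (HG1 t Ht); generalize (Cmod_ge_0 (f i t)); nra.
    + rewrite <- rsum_scal; right; apply rsum_ext; intros l Hl.
      unfold g; destruct (lt_dec l m), (lt_dec i l); try lia; ring.
  - rewrite mean_rsum; auto 14 with cts.
    apply Rle_trans with (rsum (fun l => (eps * sqrt 2 * A1 * A2 * x ^ i) *
      (if le_dec (S i) l then x ^ l else 0)) m).
    + apply rsum_le; intros l Hl; rewrite mean_scal; auto 14 with cts.
      destruct (lt_dec i l), (le_dec (S i) l); try lia; [|lra].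
      replace (eps * sqrt 2 * A1 * A2 * x ^ i * x ^ l) with
        (eps * ((A2 * x ^ i) * (sqrt 2 * A1 * x ^ l))) by ring.
      apply Rmult_le_compat_l; [lra|].
      assert (0 < x ^ i) by (apply pow_lt; lra). assert (0 < x ^ l) by (apply pow_lt; lra).
      apply mean_cauchy_schwarz; auto 14 with cts.
      * apply Rmult_lt_0_compat; lra.
      * repeat apply Rmult_lt_0_compat; lra.
      * apply Rle_trans with (mean T (fun t => Cmod (f i t) ^ 2 * G t)).
        (* G^2 <= G, because 0 <= G <= 1 on the interval. *)
        -- apply mean_le; auto 14 with cts; intros t Ht; destruct (HG1 t Ht).
           rewrite Rpow_mult_distr; apply Rmult_le_compat_l; [apply pow2_ge_0 | nra].
        -- eapply Rle_trans; [apply Hnorm2; auto; intros; apply csign_le|].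
           rewrite Rpow_mult_distr, <- pow_mult, (Nat.mul_comm i 2); lra.
      * eapply Rle_trans; [|apply (Hh3 l Hl)].
        apply mean_le; auto 14 with cts; intros t Ht; unfold g; destruct (lt_dec l m); [lra | lia].
    + rewrite rsum_scal.
      eapply Rle_trans; [apply Rmult_le_compat_l; [|apply (geom_tail x (S i) m Hx)]|].
      * assert (0 < x ^ i) by (apply pow_lt; lra). repeat apply Rmult_le_pos; lra.
      * right; replace (2 * i)%nat with (i + i)%nat by lia; rewrite pow_add; simpl; field; lra.
Qed.

Definition multiplier (t : R) : C :=
  csum (fun l => RtoC (x ^ (2 * b l)) * csign (a l) * cis (w l * t) * E (b l) t)%C N.

Lemma ccts_multiplier : ccts multiplier.
Proof. unfold multiplier; auto 14 with cts. Qed.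
Local Hint Resolve ccts_multiplier : cts.

Lemma multiplier_blocks (phi : nat -> R -> C) (t : R) :
  csum (fun l => RtoC (x ^ (2 * b l)) * csign (a l) * cis (w l * t) * phi (b l) t)%C N =
  csum (fun i => f i t * phi i t)%C m.
Proof.
  rewrite (csum_ext _ (fun l => csum (fun i => ((if Nat.eq_dec (b l) i then RtoC (x ^ (2 * i)) * csign (a l) else 0) *
    cis (w l * t)) * phi i t) m)%C).
  - rewrite csum_swap; apply csum_ext; intros i Hi.
    rewrite Cmult_comm. unfold f, block_unimod, block_poly; rewrite <- csum_scal; apply csum_ext; intros; ring.
  - intros l Hl.
    rewrite (csum_ext _ (fun i => if Nat.eq_dec i (b l) then
      RtoC (x ^ (2 * i)) * csign (a l) * cis (w l * t) * phi i t else 0)%C).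
    + now rewrite csum_single by auto.
    + intros i Hi; destruct (Nat.eq_dec (b l) i), (Nat.eq_dec i (b l)); try lia; ring.
Qed.

(** Grouped by blocks, the modulus is a damped sum with x_i = |f_i| and y_i = Re h_i. *)
Lemma multiplier_le (t : R) : - T / 2 <= t <= T / 2 -> Cmod (multiplier t) <= 1 / (1 - exp (- eps)).
Proof.
  intros Ht; unfold multiplier; rewrite multiplier_blocks.
  eapply Rle_trans; [apply Cmod_csum|].
  eapply Rle_trans; [|apply (exp_damped_sum_le eps (fun i => Cmod (f i t)) (fun i => Re (h i t)) m Heps)].
  - apply rsum_le; intros i Hi; rewrite Cmod_mult; unfold E; rewrite Cmod_Cexp.
    replace (Re (- H i t)) with (- Re (H i t)) by (destruct (H i t); reflexivity).
    rewrite Re_tail; lra.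
  - intros i Hi; split; [apply Cmod_ge_0 | apply block_unimod_le1].
  - intros i Hi; auto.
Qed.

(** The error has two sources: the deviation of the damping from 1 on the blocks i >= b k, summed
    geometrically in x^(2i), and the failure of the frequencies to be orthogonal on the interval,
    collected in [Delta]. *)
Lemma multiplier_coef (k : nat) : (k < N)%nat ->
  Cmod (cmean T (fun t => multiplier t * Cconj (cis (w k * t)) * G t)
        - RtoC (gam * x ^ (2 * b k)) * csign (a k))%C <=
  (eps * sqrt 2 * A1 * A2 * (x / ((1 - x) * (1 - x ^ 2))) + Delta) * x ^ (2 * b k).
Proof.
  intros Hk.
  (* For b l >= b k the damping is written 1 + (E - 1): the 1 goes to [X], where l = k gives the
     main term, and E - 1 goes to [Y]. For b l < b k the damping is kept whole, since only the full
     exponential is covered by [wcoef_leak]. *)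
  set (X := fun l t => (RtoC (x ^ (2 * b l)) * csign (a l) *
    (if le_dec (b k) (b l) then cis ((w l - w k) * t) * G t
     else Cexp (- H (b l) t) * (cis ((w l - w k) * t) * G t)))%C).
  set (Y := fun i t => (if le_dec (b k) i then f i t * (E i t - 1) * Cconj (cis (w k * t)) * G t else 0)%C).
  assert (HX : forall l, ccts (X l)).
  { intros l; unfold X; destruct (le_dec (b k) (b l)); auto 14 with cts.
    fold (E (b l)). apply ccts_mult; auto 14 with cts.
    apply ccts_mult; auto 14 with cts. apply ccts_tail_factor. }
  assert (HY : forall i, ccts (Y i)).
  { intros i; unfold Y; destruct (le_dec (b k) i); auto 14 with cts. }
  rewrite (cmean_ext T _ (fun t => csum (fun l => X l t) N + csum (fun i => Y i t) m)%C); auto.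
  2:{ intros t _. unfold Y.
      rewrite (csum_ext (fun i => if le_dec (b k) i then _ else _) (fun i => f i t *
        (if le_dec (b k) i then (E i t - 1) * Cconj (cis (w k * t)) * G t else 0))%C).
      2:{ intros i _; destruct (le_dec (b k) i); ring. }
      rewrite <- (multiplier_blocks (fun i t => if le_dec (b k) i then (E i t - 1) * Cconj (cis (w k * t)) * G t else 0)%C).
      rewrite <- csum_plus. unfold multiplier.
      rewrite <- Cmult_assoc, Cmult_comm, <- csum_scal; apply csum_ext; intros l _.
      unfold X. replace ((w l - w k) * t) with (w l * t + - (w k * t)) by ring.
      rewrite cis_plus, cis_opp. fold (E (b l) t).
      destruct (le_dec (b k) (b l)); ring. }
  rewrite cmean_plus, !cmean_csum; auto 14 with cts.
  set (SX := csum _ N). set (SY := csum _ m).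
  replace (SX + SY - RtoC (gam * x ^ (2 * b k)) * csign (a k))%C with
    ((SX - RtoC (gam * x ^ (2 * b k)) * csign (a k)) + SY)%C by ring.
  eapply Rle_trans; [apply Cmod_triangle|].
  rewrite Rmult_plus_distr_r, Rplus_comm; apply Rplus_le_compat.
  - unfold SY; eapply Rle_trans; [apply Cmod_csum|].
    apply Rle_trans with (rsum (fun i => eps * sqrt 2 * A1 * A2 * (x / (1 - x)) *
      (if le_dec (b k) i then (x ^ 2) ^ i else 0)) m).
    + apply rsum_le; intros i Hi. unfold Y; destruct (le_dec (b k) i).
      * eapply Rle_trans; [apply Cmod_cmean; auto 14 with cts|].
        eapply Rle_trans; [|eapply Rle_trans; [apply (near_term i Hi)|]].
        -- apply mean_le; auto 14 with cts; intros t Ht; destruct (HG1 t Ht).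
           rewrite !Cmod_mult, Cmod_conj, Cmod_cis, Cmod_RtoC; lra.
        -- right; rewrite <- pow_mult; field; lra.
      * rewrite cmean_const, Cmod_0; auto; lra.
    + rewrite rsum_scal.
      eapply Rle_trans; [apply Rmult_le_compat_l; [|apply (geom_tail (x ^ 2) (b k) m)]|].
      * assert (0 <= sqrt 2) by apply sqrt_pos.
        assert (0 <= x / (1 - x)) by (apply Rdiv_le_0_compat; lra).
        apply Rmult_le_pos; [repeat apply Rmult_le_pos; lra | assumption].
      * split; [apply pow_lt; lra | nra].
      * assert (x ^ 2 < 1) by nra. rewrite <- pow_mult; right; field; lra.
  - replace (SX - RtoC (gam * x ^ (2 * b k)) * csign (a k))%C with
      (csum (fun l => if Nat.eq_dec l k then 0 else cmean T (X l))%C N).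
    2:{ assert (E0 : SX = (csum (fun l => if Nat.eq_dec l k then cmean T (X l) else 0)%C N +
          csum (fun l => if Nat.eq_dec l k then 0 else cmean T (X l))%C N)%C).
        { rewrite <- csum_plus; apply csum_ext; intros l _; destruct (Nat.eq_dec l k); ring. }
        rewrite E0, csum_single by assumption.
        replace (cmean T (X k)) with (RtoC (gam * x ^ (2 * b k)) * csign (a k))%C; [ring|].
        unfold X; destruct (le_dec (b k) (b k)); [|lia].
        rewrite cmean_scal by auto 14 with cts.
        fold (wcoef T G (w k - w k)). replace (w k - w k) with 0 by ring.
        rewrite Hgam, RtoC_mult; ring. }
    eapply Rle_trans; [apply Cmod_csum|]. eapply Rle_trans; [|apply (HDelta k Hk)].
    apply rsum_le; intros l Hl; destruct (Nat.eq_dec l k); [rewrite Cmod_0; lra|].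
    unfold X; rewrite cmean_scal.
    2:{ destruct (le_dec (b k) (b l)); auto 14 with cts.
        fold (E (b l)). apply ccts_mult; auto 14 with cts. apply ccts_tail_factor. }
    assert (0 <= x ^ (2 * b l)) by (apply pow_le; lra).
    rewrite !Cmod_mult, Cmod_RtoC, Rmult_assoc by assumption.
    apply Rmult_le_compat_l; auto.
    assert (HB : Cmod (cmean T (fun t => if le_dec (b k) (b l) then cis ((w l - w k) * t) * G t
      else Cexp (- H (b l) t) * (cis ((w l - w k) * t) * G t))%C) <=
      (if le_dec (b k) (b l) then Cmod (wcoef T G (w l - w k)) else sigma l k)).
    { destruct (le_dec (b k) (b l)); [apply Rle_refl|].
      apply wcoef_leak; auto using is_apoly_tail, Re_tail_ge0.
      intros M; apply Hsigma; auto; lia. }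
    generalize (csign_le (a l)) (Cmod_ge_0 (csign (a l)))
      (Cmod_ge_0 (cmean T (fun t => if le_dec (b k) (b l) then cis ((w l - w k) * t) * G t
      else Cexp (- H (b l) t) * (cis ((w l - w k) * t) * G t))%C)); nra.
Qed.

(** The mean of F conj(p) G is bounded below through the coefficients of F, whose phases match those
    of a_k, and above by sup |F| times the mean of |p|, as 0 <= G <= 1. *)
Lemma multiplier_duality :
  (gam - eps * sqrt 2 * A1 * A2 * (x / ((1 - x) * (1 - x ^ 2))) - Delta) *
    rsum (fun k => x ^ (2 * b k) * Cmod (a k)) N <=
  1 / (1 - exp (- eps)) * mean T (fun t => Cmod (csum (fun k => a k * cis (w k * t))%C N)).
Proof.
  set (p := fun t => csum (fun k => a k * cis (w k * t))%C N).
  assert (Hp : ccts p) by (unfold p; auto 14 with cts).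
  set (theta := eps * sqrt 2 * A1 * A2 * (x / ((1 - x) * (1 - x ^ 2)))).
  set (c := fun k => cmean T (fun t => multiplier t * Cconj (cis (w k * t)) * G t)%C).
  assert (Ec : cmean T (fun t => multiplier t * Cconj (p t) * G t)%C = csum (fun k => Cconj (a k) * c k)%C N).
  { rewrite (cmean_ext T _ (fun t => csum (fun k => Cconj (a k) *
      (multiplier t * Cconj (cis (w k * t)) * G t)) N)%C); auto.
    - rewrite cmean_csum; auto 14 with cts.
      apply csum_ext; intros k _; apply cmean_scal; auto 14 with cts.
    - intros t _; unfold p; rewrite Cconj_csum.
      rewrite <- Cmult_assoc, (Cmult_comm (csum _ N)), Cmult_assoc, <- csum_scal.
      apply csum_ext; intros k _; rewrite Cmult_conj; ring. }
  apply Rle_trans with (Re (csum (fun k => Cconj (a k) * c k)%C N)).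
  - rewrite Re_csum, <- rsum_scal; apply rsum_le; intros k Hk.
    assert (Hc := multiplier_coef k Hk). fold theta in Hc. fold (c k) in Hc.
    set (d := (c k - RtoC (gam * x ^ (2 * b k)) * csign (a k))%C) in *.
    replace (Cconj (a k) * c k)%C with
      (RtoC (gam * x ^ (2 * b k) * Cmod (a k)) + - (- Cconj (a k) * d))%C.
    2:{ unfold d; rewrite (RtoC_mult _ (Cmod (a k))), <- conj_csign; ring. }
    assert (Hd : Re (- Cconj (a k) * d)%C <= Cmod (a k) * ((theta + Delta) * x ^ (2 * b k))).
    { eapply Rle_trans; [apply Re_le_Cmod|]. rewrite Cmod_mult, Cmod_opp, Cmod_conj.
      apply Rmult_le_compat_l; [apply Cmod_ge_0 | exact Hc]. }
    set (z := (- Cconj (a k) * d)%C) in *.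
    replace (Re (RtoC (gam * x ^ (2 * b k) * Cmod (a k)) + - z)%C) with
      (gam * x ^ (2 * b k) * Cmod (a k) - Re z) by (destruct z; simpl; ring).
    lra.
  - rewrite <- Ec. eapply Rle_trans; [apply Re_le_Cmod|].
    eapply Rle_trans; [apply Cmod_cmean; auto 14 with cts|].
    rewrite <- mean_scal by auto with cts.
    apply mean_le; auto 14 with cts; intros t Ht.
    rewrite !Cmod_mult, Cmod_conj. destruct (HG1 t Ht).
    rewrite Cmod_RtoC by assumption.
    assert (Hm := multiplier_le t Ht).
    fold (p t). generalize (Cmod_ge_0 (p t)) (Cmod_ge_0 (multiplier t)); intros.
    apply Rle_trans with (Cmod (multiplier t) * Cmod (p t) * 1).
    + apply Rmult_le_compat_l; [apply Rmult_le_pos|]; assumption.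
    + rewrite Rmult_1_r; now apply Rmult_le_compat_r.
Qed.

End WithFamily.

(** Two norm bounds are kept apart: [A1] is unweighted, since the majorants are built without the
    weight, while [A2] is taken against G. With G = 1 they coincide; with the tent, A2 is about half
    of A1. *)
Lemma weighted_sum_le_mean :
  (gam - eps * sqrt 2 * A1 * A2 * (x / ((1 - x) * (1 - x ^ 2))) - Delta) *
    rsum (fun k => x ^ (2 * b k) * Cmod (a k)) N <=
  1 / (1 - exp (- eps)) * mean T (fun t => Cmod (csum (fun k => a k * cis (w k * t))%C N)).
Proof.
  destruct antianalytic_family as (h & H1 & H2 & H3).
  now apply (multiplier_duality h).
Qed.

End MultiplierConstruction.

(** * Geometric blocks and long intervals *)

(* Indices run from 0; block [b] is the interval from [block_start rho b] (included) to
   [block_start rho (S b)] (excluded), of length [rho ^ b]. *)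
Fixpoint block_start (rho b : nat) : nat :=
  match b with O => O | S c => (block_start rho c + rho ^ c)%nat end.

Fixpoint block_of (rho k : nat) : nat :=
  match k with
  | O => O
  | S l => if lt_dec (S l) (block_start rho (S (block_of rho l)))
           then block_of rho l else S (block_of rho l)
  end.

Lemma block_of_spec (rho k : nat) : (1 <= rho)%nat ->
  (block_start rho (block_of rho k) <= k < block_start rho (S (block_of rho k)))%nat.
Proof.
  intros Hr; induction k as [|k IH]; [simpl; lia|].
  change (block_of rho (S k)) with (if lt_dec (S k) (block_start rho (S (block_of rho k)))
           then block_of rho k else S (block_of rho k)).
  destruct (lt_dec (S k) (block_start rho (S (block_of rho k)))) as [H|H]; [lia|].
  assert (rho ^ S (block_of rho k) <> 0)%nat by (apply Nat.pow_nonzero; lia).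
  split; [lia|].
  change (block_start rho (S (S (block_of rho k)))) with
    (block_start rho (S (block_of rho k)) + rho ^ S (block_of rho k))%nat; lia.
Qed.

Lemma block_start_le (rho b c : nat) : (b <= c)%nat -> (block_start rho b <= block_start rho c)%nat.
Proof. induction 1; simpl; lia. Qed.

Lemma block_of_lt (rho k l : nat) : (1 <= rho)%nat -> (block_of rho k < block_of rho l)%nat -> (k < l)%nat.
Proof.
  intros Hr H; assert (Hk := block_of_spec rho k Hr); assert (Hl := block_of_spec rho l Hr).
  assert (block_start rho (S (block_of rho k)) <= block_start rho (block_of rho l))%nat
    by (apply block_start_le; lia). lia.
Qed.

Lemma block_of_unique (rho k b : nat) : (1 <= rho)%nat ->
  (block_start rho b <= k < block_start rho (S b))%nat -> block_of rho k = b.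
Proof.
  intros Hr H; assert (Hk := block_of_spec rho k Hr).
  destruct (lt_eq_lt_dec (block_of rho k) b) as [[L|E]|L]; [|exact E|].
  - assert (block_start rho (S (block_of rho k)) <= block_start rho b)%nat
      by (apply block_start_le; lia). lia.
  - assert (block_start rho (S b) <= block_start rho (block_of rho k))%nat
      by (apply block_start_le; lia). lia.
Qed.

Lemma INR_block_start (rho b : nat) :
  (INR rho - 1) * INR (block_start rho b) = INR rho ^ b - 1.
Proof.
  induction b as [|b IH]; [simpl; ring|].
  change (block_start rho (S b)) with (block_start rho b + rho ^ b)%nat.
  rewrite plus_INR, Rmult_plus_distr_l, IH, pow_INR; simpl; ring.
Qed.

Lemma block_count (rho i N : nat) (c : R) : (1 <= rho)%nat -> 0 <= c ->
  rsum (fun k => if Nat.eq_dec (block_of rho k) i then c else 0) N <= INR (rho ^ i) * c.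
Proof.
  intros Hr Hc.
  assert (H : rsum (fun k => if Nat.eq_dec (block_of rho k) i then c else 0) N <=
    INR (min N (block_start rho (S i)) - block_start rho i) * c).
  { induction N as [|N IH]; simpl rsum; [simpl; lra|].
    assert (Hs := block_of_spec rho N Hr).
    destruct (Nat.eq_dec (block_of rho N) i) as [E|E].
    - rewrite E in Hs.
      replace (min (S N) (block_start rho (S i)) - block_start rho i)%nat with
        (S (min N (block_start rho (S i)) - block_start rho i)) by lia.
      rewrite S_INR; lra.
    - rewrite Rplus_0_r; eapply Rle_trans; [exact IH|].
      apply Rmult_le_compat_r; [assumption|]; apply le_INR; lia. }
  eapply Rle_trans; [exact H|]. apply Rmult_le_compat_r; [assumption|].
  apply le_INR; simpl; lia.
Qed.

Lemma block_weight (r b : nat) : (1 <= r)%nat -> (/ INR r) ^ (2 * b) = / INR ((r * r) ^ b).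
Proof.
  intros Hr. rewrite pow_inv, pow_mult, pow_INR, mult_INR; do 2 f_equal; ring.
Qed.

Lemma block_weight_pos (r b : nat) : (1 <= r)%nat -> 0 < (/ INR r) ^ (2 * b).
Proof. intros Hr; apply pow_lt, Rinv_0_lt_compat, lt_0_INR; lia. Qed.

Lemma block_mass (r i N : nat) : (1 <= r)%nat ->
  rsum (fun k => if Nat.eq_dec (block_of (r * r) k) i then (/ INR r) ^ (2 * i) else 0) N <= 1.
Proof.
  intros Hr; eapply Rle_trans; [apply block_count; [nia | left; now apply block_weight_pos]|].
  rewrite block_weight by assumption. right; apply Rinv_r.
  apply not_0_INR, Nat.pow_nonzero; nia.
Qed.

(** A complete block has total weight exactly 1: its length times the inverse of its length. *)
Lemma complete_blocks_mass (r b N : nat) : (1 <= r)%nat -> (block_start (r * r) b <= N)%nat ->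
  INR b <= rsum (fun k => (/ INR r) ^ (2 * block_of (r * r) k)) N.
Proof.
  intros Hr HN.
  eapply Rle_trans; [|apply (rsum_le_extend _ _ _ HN)].
  2:{ intros k; left; now apply block_weight_pos. }
  clear N HN; induction b as [|b IH]; [simpl; lra|].
  assert (Hj : forall j, (j <= (r * r) ^ b)%nat ->
    rsum (fun k => (/ INR r) ^ (2 * block_of (r * r) k)) (block_start (r * r) b + j) =
    rsum (fun k => (/ INR r) ^ (2 * block_of (r * r) k)) (block_start (r * r) b) +
    INR j * (/ INR r) ^ (2 * b)).
  { induction j as [|j IHj]; intros Hj.
    - rewrite Nat.add_0_r; simpl; ring.
    - rewrite Nat.add_succ_r; cbn [rsum]. rewrite IHj by lia.
      rewrite (block_of_unique (r * r) _ b) by (simpl; nia). rewrite S_INR; simpl; ring. }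
  change (block_start (r * r) (S b)) with (block_start (r * r) b + (r * r) ^ b)%nat.
  rewrite (Hj ((r * r) ^ b)%nat (le_n _)), block_weight, Rinv_r, S_INR;
    [lra | apply not_0_INR, Nat.pow_nonzero; nia | assumption].
Qed.

(** Expand the square into a double sum. In each row |c_l| <= q, and the transform of V sums to at
    most V0 + D; the rows are then summed with the weights |c_k|, of total at most 1. For a block
    polynomial q is the inverse block length. *)
Lemma Cmod_csum_sqr_mean_le (T q D V0 : R) (V : R -> R) (c : nat -> C) (w : nat -> R) (N : nat) :
  0 < T -> cts V -> 0 <= q -> 0 <= D -> 0 <= V0 -> wcoef T V 0 = V0 ->
  (forall k, (k < N)%nat -> Cmod (c k) <= q) ->
  rsum (fun k => Cmod (c k)) N <= 1 ->
  (forall k, (k < N)%nat ->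
    rsum (fun l => if Nat.eq_dec l k then 0 else Cmod (wcoef T V (w k - w l))) N <= D) ->
  mean T (fun t => Cmod (csum (fun k => c k * cis (w k * t))%C N) ^ 2 * V t) <= q * (V0 + D).
Proof.
  intros HT HV Hq0 HD HV0 H0 Hq H1 HO.
  rewrite (mean_ext T _ (fun t => Re (csum (fun k => c k * csum (fun l => Cconj (c l) *
    (cis ((w k - w l) * t) * V t)) N) N)%C)); auto.
  2:{ intros t _. rewrite <- Re_mult_conj.
      set (P := csum (fun k => c k * cis (w k * t))%C N).
      transitivity (Re (P * Cconj P * V t)%C); [destruct (P * Cconj P)%C; simpl; ring|].
      f_equal. unfold P at 1.
      rewrite <- Cmult_assoc, Cmult_comm, <- csum_scal; apply csum_ext; intros k _.
      rewrite <- csum_scal. unfold P; rewrite Cconj_csum.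
      transitivity ((c k * cis (w k * t) * V t) * csum (fun l => Cconj (c l * cis (w l * t))) N)%C; [ring|].
      rewrite <- csum_scal; apply csum_ext; intros l _.
      replace ((w k - w l) * t) with (w k * t + - (w l * t)) by ring.
      rewrite cis_plus, cis_opp, Cmult_conj; ring. }
  rewrite mean_Re, cmean_csum by auto 14 with cts.
  eapply Rle_trans; [apply Re_le_Cmod|]. eapply Rle_trans; [apply Cmod_csum|].
  apply Rle_trans with (rsum (fun k => q * (V0 + D) * Cmod (c k)) N).
  - apply rsum_le; intros k Hk.
    rewrite cmean_scal, cmean_csum, Cmod_mult, Rmult_comm by auto 14 with cts.
    apply Rmult_le_compat_r; [apply Cmod_ge_0|].
    eapply Rle_trans; [apply Cmod_csum|].
    apply Rle_trans with (rsum (fun l => q * ((if Nat.eq_dec l k then V0 else 0) +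
      (if Nat.eq_dec l k then 0 else Cmod (wcoef T V (w k - w l))))) N).
    + apply rsum_le; intros l Hl.
      rewrite cmean_scal, Cmod_mult, Cmod_conj by auto 14 with cts.
      fold (wcoef T V (w k - w l)).
      apply Rmult_le_compat; auto using Cmod_ge_0.
      destruct (Nat.eq_dec l k) as [->|]; [|lra].
      replace (w k - w k) with 0 by ring. rewrite H0, Cmod_RtoC; lra.
    + rewrite rsum_scal, rsum_plus, (rsum_single (fun _ => V0)) by assumption.
      apply Rmult_le_compat_l; [assumption|]. specialize (HO k Hk); lra.
  - rewrite rsum_scal. rewrite <- (Rmult_1_r (q * (V0 + D))) at 2.
    apply Rmult_le_compat_l; [apply Rmult_le_pos; lra | exact H1].
Qed.

Lemma block_poly_mean_sqr_le (T D V0 : R) (V : R -> R) (r : nat) (u : nat -> C) (w : nat -> R) (N i : nat) :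
  0 < T -> cts V -> (1 <= r)%nat -> 0 <= D -> 0 <= V0 -> wcoef T V 0 = V0 ->
  (forall k, Cmod (u k) <= 1) ->
  (forall k, (k < N)%nat ->
    rsum (fun l => if Nat.eq_dec l k then 0 else Cmod (wcoef T V (w k - w l))) N <= D) ->
  mean T (fun t => Cmod (block_poly (/ INR r) (block_of (r * r)) u w N i t) ^ 2 * V t) <=
  (/ INR r) ^ (2 * i) * (V0 + D).
Proof.
  intros HT HV Hr HD HV0 H0 Hu HO.
  assert (Hp := block_weight_pos r i Hr).
  apply Cmod_csum_sqr_mean_le; auto; [lra| |].
  - intros k _; destruct (Nat.eq_dec _ i); [|rewrite Cmod_0; lra].
    rewrite Cmod_mult, Cmod_RtoC by lra. specialize (Hu k); nra.
  - eapply Rle_trans; [|apply (block_mass r i N Hr)].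
    apply rsum_le; intros k _; destruct (Nat.eq_dec _ i); [|rewrite Cmod_0; lra].
    rewrite Cmod_mult, Cmod_RtoC by lra. specialize (Hu k); nra.
Qed.

Lemma sum_inv_sqr_le (X : R) (M : nat) : 1 < X -> rsum (fun n => / (X + INR n) ^ 2) M <= / (X - 1).
Proof.
  intros HX.
  assert (H : rsum (fun n => / (X + INR n) ^ 2) M <= / (X - 1) - / (X - 1 + INR M)).
  { induction M as [|M IH]; cbn [rsum]; [simpl; rewrite Rplus_0_r; lra|].
    assert (HM := pos_INR M). rewrite S_INR.
    assert (/ (X + INR M) ^ 2 <= / (X - 1 + INR M) - / (X - 1 + (INR M + 1))); [|lra].
    replace (/ (X - 1 + INR M) - / (X - 1 + (INR M + 1))) with
      (/ ((X - 1 + INR M) * (X + INR M))) by (field; lra).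
    apply Rinv_le_contravar; nra. }
  assert (0 < / (X - 1 + INR M)) by (apply Rinv_0_lt_compat; generalize (pos_INR M); lra).
  lra.
Qed.

Lemma Rabs_sin_le1 (x : R) : Rabs (sin x) <= 1.
Proof. apply Rabs_le, SIN_bound. Qed.

Lemma wcoef_one_0 (T : R) : 0 < T -> wcoef T (fun _ => 1) 0 = 1.
Proof.
  intros HT; unfold wcoef; rewrite (cmean_ext T _ (fun _ => RtoC 1)); auto.
  - now apply cmean_const.
  - intros; rewrite Rmult_0_l, cis_0; ring.
Qed.

Lemma wcoef_one_le (T s : R) : 0 < T -> s <> 0 -> Cmod (wcoef T (fun _ => 1) s) <= 2 / (Rabs s * T).
Proof.
  intros HT Hs; unfold wcoef; rewrite (cmean_ext T _ (fun t => cis (s * t))); auto.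
  2:{ intros; ring. }
  assert (Hs' := Rabs_pos_lt s Hs).
  rewrite cmean_cis, Cmod_R by assumption. unfold Rdiv.
  rewrite !Rabs_mult, Rabs_inv, Rabs_mult, (Rabs_pos_eq 2), (Rabs_pos_eq T) by lra.
  apply Rmult_le_compat_r; [left; apply Rinv_0_lt_compat; nra|].
  generalize (Rabs_sin_le1 (s * T * / 2)); lra.
Qed.

(** The weight is 1 and N is fixed, so every off-diagonal quantity is O(T^(-1/2)); crude bounds
    summed over all N indices suffice, and [tau] absorbs them all. *)
Lemma large_T_bound (N r : nat) (a : nat -> C) (w : nat -> R) (eps delta tau : R) :
  (2 <= r)%nat -> 0 < eps -> 0 < delta -> 0 < tau ->
  (forall k l, (k < l)%nat -> (l < N)%nat -> w k + delta <= w l) ->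
  exists T0, 0 < T0 /\ forall T, T0 <= T ->
    (1 - eps * sqrt 2 * (1 + tau) * (/ INR r / ((1 - / INR r) * (1 - (/ INR r) ^ 2))) - tau) *
      rsum (fun k => (/ INR r) ^ (2 * block_of (r * r) k) * Cmod (a k)) N <=
    1 / (1 - exp (- eps)) * mean T (fun t => Cmod (csum (fun k => a k * cis (w k * t))%C N)).
Proof.
  intros Hr He Hd Htau Hw.
  set (x := / INR r).
  assert (Hr1 : (1 <= r)%nat) by lia.
  assert (HrR : 2 <= INR r) by now apply (le_INR 2).
  assert (Hx : 0 < x < 1).
  { unfold x; split; [apply Rinv_0_lt_compat; lra | rewrite <- Rinv_1; apply Rinv_lt_contravar; lra]. }
  set (m := S (block_of (r * r) N)).
  (* A lower bound for all block weights: errors below tau xm are small relative to each of them. *)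
  set (xm := x ^ (2 * m)). assert (Hxm : 0 < xm) by (apply pow_lt; lra).
  assert (HN := pos_INR N).
  set (y0 := tau * xm / (2 * (INR N + 1))).
  assert (Hy0 : 0 < y0) by (apply Rdiv_lt_0_compat; nra).
  assert (Hb : forall k, (k < N)%nat -> (block_of (r * r) k < m)%nat).
  { intros k Hk; unfold m. destruct (le_lt_dec (block_of (r * r) k) (block_of (r * r) N)); [lia|].
    assert (N < k)%nat by (apply (block_of_lt (r * r)); [nia | assumption]). lia. }
  assert (Hxi : forall i, (i <= m)%nat -> xm <= x ^ (2 * i) <= 1).
  { intros i Hi; unfold xm; replace (2 * m)%nat with (2 * i + (2 * m - 2 * i))%nat by lia.
    assert (0 < x ^ (2 * i)) by (apply pow_lt; lra).
    assert (x ^ (2 * m - 2 * i) <= 1) by (rewrite <- (pow1 (2 * m - 2 * i)); apply pow_incr; lra).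
    split; [rewrite pow_add; nra | rewrite <- (pow1 (2 * i)); apply pow_incr; lra]. }
  (* The 8/y0^2 forces sg <= y0, hence N sg <= tau xm / 2; the 2 gives 1/(delta T - 1) <= 2/(delta
     T). *)
  exists ((2 + 8 / y0 ^ 2) / delta).
  assert (H8 : 0 < 8 / y0 ^ 2) by (apply Rdiv_lt_0_compat; nra).
  split; [apply Rdiv_lt_0_compat; lra|].
  intros T HT0.
  assert (HdT : 2 + 8 / y0 ^ 2 <= delta * T).
  { apply Rmult_le_reg_l with (/ delta); [now apply Rinv_0_lt_compat|].
    rewrite <- Rmult_assoc, Rinv_l by lra. unfold Rdiv in HT0 at 1. lra. }
  assert (HT : 0 < T) by nra.
  (* One constant for both uses: its square bounds the leak sum 4/(delta T - 1), and sg itself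
     dominates the off-diagonal transform 2/(delta T). *)
  set (sg := sqrt (8 / (delta * T))).
  assert (Hsg2 : sg ^ 2 = 8 / (delta * T)).
  { unfold sg; simpl; rewrite Rmult_1_r; apply sqrt_sqrt; left; apply Rdiv_lt_0_compat; lra. }
  assert (Hsg0 : 0 <= sg) by apply sqrt_pos.
  assert (Hsgy : sg <= y0).
  { assert (sg ^ 2 <= y0 ^ 2); [|nra].
    rewrite Hsg2; apply Rmult_le_reg_r with (delta * T); [lra|].
    unfold Rdiv; rewrite Rmult_assoc, Rinv_l, Rmult_1_r by lra.
    apply Rle_trans with (y0 ^ 2 * (8 / y0 ^ 2)); [right; field; lra|].
    apply Rmult_le_compat_l; nra. }
  assert (Hsep : forall k l, (k < N)%nat -> (l < N)%nat -> k <> l -> delta <= Rabs (w k - w l)).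
  { intros k l Hk Hl Hkl; destruct (lt_eq_lt_dec k l) as [[H|H]|H]; [|lia|].
    - specialize (Hw k l H Hl); rewrite Rabs_left; lra.
    - specialize (Hw l k H Hk); rewrite Rabs_pos_eq; lra. }
  assert (Hmu : forall k l, (k < N)%nat -> (l < N)%nat -> k <> l ->
    Cmod (wcoef T (fun _ => 1) (w k - w l)) <= sg).
  { intros k l Hk Hl Hkl; assert (H := Hsep k l Hk Hl Hkl).
    eapply Rle_trans; [apply wcoef_one_le; auto; intros Z; rewrite Z, Rabs_R0 in H; lra|].
    apply Rle_trans with (2 / (delta * T)).
    - unfold Rdiv; apply Rmult_le_compat_l; [lra|]. apply Rinv_le_contravar; nra.
    - replace (2 / (delta * T)) with (sg ^ 2 / 4) by (rewrite Hsg2; field; nra).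
      assert (sg ^ 2 <= 4); [|nra].
      rewrite Hsg2; apply Rmult_le_reg_r with (delta * T); [lra|].
      unfold Rdiv; rewrite Rmult_assoc, Rinv_l by lra; lra. }
  assert (HNsg : INR N * sg <= tau * xm / 2).
  { apply Rle_trans with ((INR N + 1) * y0); [apply Rmult_le_compat; lra|].
    unfold y0; right; field; lra. }
  assert (Hoff : forall k, (k < N)%nat -> rsum (fun l => if Nat.eq_dec l k then 0 else
    Cmod (wcoef T (fun _ => 1) (w k - w l))) N <= tau * xm / 2).
  { intros k Hk; eapply Rle_trans; [|exact HNsg]. rewrite <- rsum_const.
    apply rsum_le; intros l Hl; destruct (Nat.eq_dec l k); auto. }
  assert (Hxm1 : xm <= 1) by (apply (Hxi m); lia).
  assert (Hnorm : forall u i, (i < m)%nat -> (forall k, Cmod (u k) <= 1) ->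
    mean T (fun t => Cmod (block_poly x (block_of (r * r)) u w N i t) ^ 2 * 1) <=
    x ^ (2 * i) * (1 + tau * xm / 2)).
  { intros u i Hi Hu; apply block_poly_mean_sqr_le; auto with cts; try nra. now apply wcoef_one_0. }
  assert (Hsq : sqrt (1 + tau) * sqrt (1 + tau) = 1 + tau) by (apply sqrt_sqrt; lra).
  assert (Hsq0 : 0 < sqrt (1 + tau)) by (apply sqrt_lt_R0; lra).
  replace (eps * sqrt 2 * (1 + tau)) with (eps * sqrt 2 * sqrt (1 + tau) * sqrt (1 + tau))
    by (rewrite <- Hsq at 3; ring).
  apply (weighted_sum_le_mean T eps x (sqrt (1 + tau)) (sqrt (1 + tau)) 1 tau N m a w
    (block_of (r * r)) (fun _ => 1) (fun _ _ => sg)); auto with cts.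
  - intros; lra.
  - now apply wcoef_one_0.
  - intros i; now apply block_mass.
  - intros u i Hi Hu. assert (H := Hnorm u i Hi Hu).
    rewrite (mean_ext T _ (fun t => Cmod (block_poly x (block_of (r * r)) u w N i t) ^ 2 * 1))
      by (auto; intros; ring).
    destruct (Hxi i ltac:(lia)).
    replace (sqrt (1 + tau) ^ 2) with (1 + tau) by (simpl; lra).
    eapply Rle_lt_trans; [exact H|]. rewrite Rmult_comm; apply Rmult_lt_compat_r; nra.
  - intros u i Hi Hu. assert (H := Hnorm u i Hi Hu).
    destruct (Hxi i ltac:(lia)).
    replace (sqrt (1 + tau) ^ 2) with (1 + tau) by (simpl; lra).
    eapply Rle_trans; [exact H|]. rewrite Rmult_comm; apply Rmult_le_compat_r; nra.
  - intros l k M Hl Hk Hlk.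
    assert (Hlk' : (l < k)%nat) by (apply (block_of_lt (r * r)); [nia | assumption]).
    assert (Hwlk := Hw l k Hlk' Hk).
    (* As w l < w k, the shifts by -2 PI n / T move the frequency further from 0, so |s| T >= delta
       T + n. *)
    apply Rle_trans with (rsum (fun n => 4 * / (delta * T + INR n) ^ 2) M).
    + apply rsum_le; intros n _.
      assert (Hn := pos_INR n). assert (HP : 3 < PI) by (generalize PI2_3_2; lra).
      set (s := w l - w k - 2 * PI * INR n / T).
      assert (HsT : s * T = (w l - w k) * T - 2 * PI * INR n) by (unfold s; field; lra).
      assert (Hs1 : s * T <= - (delta * T + INR n)) by (rewrite HsT; nra).
      assert (Hs2 : s < 0) by nra.
      assert (H : Cmod (wcoef T (fun _ => 1) s) <= 2 * / (delta * T + INR n)).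
      { eapply Rle_trans; [apply wcoef_one_le; lra|].
        unfold Rdiv; apply Rmult_le_compat_l; [lra|]. apply Rinv_le_contravar; [lra|].
        rewrite Rabs_left; lra. }
      rewrite <- pow_inv. replace (4 * (/ (delta * T + INR n)) ^ 2) with ((2 * / (delta * T + INR n)) ^ 2) by ring.
      apply pow_incr; split; [apply Cmod_ge_0 | exact H].
    + rewrite rsum_scal, Hsg2.
      assert (H := sum_inv_sqr_le (delta * T) M ltac:(lra)).
      assert (/ (delta * T - 1) <= 2 / (delta * T)).
      { apply Rmult_le_reg_r with ((delta * T - 1) * (delta * T)); [nra|].
        replace (/ (delta * T - 1) * ((delta * T - 1) * (delta * T))) with (delta * T) by (field; lra).
        replace (2 / (delta * T) * ((delta * T - 1) * (delta * T))) with (2 * (delta * T - 1)) by (field; nra).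
        lra. }
      replace (8 / (delta * T)) with (4 * (2 / (delta * T))) by (field; nra). lra.
  - intros k Hk.
    apply Rle_trans with (INR N * sg).
    + rewrite <- rsum_const; apply rsum_le; intros l Hl.
      destruct (Nat.eq_dec l k); [lra|].
      destruct (Hxi (block_of (r * r) l) ltac:(generalize (Hb l Hl); lia)).
      destruct (le_dec _ _).
      * generalize (Hmu l k Hl Hk n) (Cmod_ge_0 (wcoef T (fun _ => 1) (w l - w k))); nra.
      * nra.
    + destruct (Hxi (block_of (r * r) k) ltac:(generalize (Hb k Hk); lia)). nra.
Qed.

(** * Besicovitch means *)

(** Phases make cosines sufficient for sines as well. The last constructor closes the class under
    pointwise equality, so functional extensionality is avoided. *)
Inductive real_trig : (R -> R) -> Prop :=
| real_trig_cos (c w v : R) : real_trig (fun t => c * cos (w * t + v))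
| real_trig_plus (f g : R -> R) : real_trig f -> real_trig g -> real_trig (fun t => f t + g t)
| real_trig_ext (f g : R -> R) : (forall t, f t = g t) -> real_trig f -> real_trig g.

Lemma real_trig_cts (f : R -> R) : real_trig f -> cts f.
Proof.
  induction 1 as [c w v|f g _ IHf _ IHg|f g E _ IH]; auto 14 with cts.
  intros t; apply (continuous_ext f); auto.
Qed.

Lemma real_trig_const (c : R) : real_trig (fun _ => c).
Proof.
  apply (real_trig_ext (fun t => c * cos (0 * t + 0))); [|constructor].
  intros t; rewrite Rmult_0_l, Rplus_0_l, cos_0; ring.
Qed.

(** The product-to-sum formula for cosines is the only analytic input. *)
Lemma real_trig_mult (f g : R -> R) : real_trig f -> real_trig g -> real_trig (fun t => f t * g t).
Proof.
  intros Hf Hg; induction Hf as [c w v|f1 f2 _ IH1 _ IH2|f1 f2 E _ IH].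
  - induction Hg as [d z y|g1 g2 _ IH1 _ IH2|g1 g2 E _ IH].
    + apply (real_trig_ext (fun t => c * d / 2 * cos ((w + z) * t + (v + y)) +
        c * d / 2 * cos ((w - z) * t + (v - y)))); [|repeat constructor].
      intros t.
      replace ((w + z) * t + (v + y)) with ((w * t + v) + (z * t + y)) by ring.
      replace ((w - z) * t + (v - y)) with ((w * t + v) - (z * t + y)) by ring.
      rewrite cos_plus, cos_minus; field.
    + eapply real_trig_ext; [|apply (real_trig_plus _ _ IH1 IH2)]; intros; simpl; ring.
    + eapply real_trig_ext; [|exact IH]; intros; simpl; now rewrite E.
  - eapply real_trig_ext; [|apply (real_trig_plus _ _ IH1 IH2)]; intros; simpl; ring.
  - eapply real_trig_ext; [|exact IH]; intros; simpl; now rewrite E.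
Qed.

Lemma real_trig_scal (c : R) (f : R -> R) : real_trig f -> real_trig (fun t => c * f t).
Proof. intros H; apply (real_trig_mult (fun _ => c)); [apply real_trig_const | exact H]. Qed.

Lemma real_trig_rsum (f : nat -> R -> R) (n : nat) :
  (forall k, real_trig (f k)) -> real_trig (fun t => rsum (fun k => f k t) n).
Proof.
  intros H; induction n as [|n IH]; simpl; [apply real_trig_const | now apply real_trig_plus].
Qed.

Definition mean_cv (f : R -> R) (l : R) : Prop :=
  forall e, 0 < e -> exists T0, 0 < T0 /\ forall T, T0 <= T -> Rabs (mean T f - l) <= e.

Lemma real_trig_mean_cv (f : R -> R) : real_trig f -> exists l, mean_cv f l.
Proof.
  induction 1 as [c w v|f g Hf [l1 H1] Hg [l2 H2]|f g E Hf [l H]].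
  - destruct (Req_dec w 0) as [->|Hw].
    + exists (c * cos v); intros e He; exists 1; split; [lra|]; intros T HT.
      rewrite (mean_ext T _ (fun _ => c * cos v)), mean_const; try lra.
      * rewrite Rminus_diag, Rabs_R0; lra.
      * intros; rewrite Rmult_0_l, Rplus_0_l; reflexivity.
    + exists 0; intros e He. assert (Hw' := Rabs_pos_lt w Hw).
      exists (2 * (Rabs c + 1) / (Rabs w * e)). assert (Hc := Rabs_pos c).
      assert (Hp : 0 < 2 * (Rabs c + 1) / (Rabs w * e)) by (apply Rdiv_lt_0_compat; nra).
      split; [exact Hp|]; intros T HT. assert (HT0 : 0 < T) by lra.
      rewrite (mean_ext T _ (fun t => Re (c * cis v * cis (w * t))%C)); auto.
      2:{ intros t _; rewrite cos_plus; unfold Re; simpl; ring. }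
      rewrite mean_Re, cmean_scal, cmean_cis, Rminus_0_r by auto 14 with cts.
      eapply Rle_trans; [apply re_le_Cmod|].
      rewrite !Cmod_mult, Cmod_cis, !Cmod_R, Rmult_1_r.
      unfold Rdiv; rewrite !Rabs_mult, Rabs_inv, Rabs_mult, (Rabs_pos_eq 2), (Rabs_pos_eq T) by lra.
      assert (Hs := Rabs_sin_le1 (w * T * / 2)).
      assert (Hs0 := Rabs_pos (sin (w * T * / 2))).
      apply Rle_trans with (Rabs c * (2 * / (Rabs w * T))).
      * apply Rmult_le_compat_l; [assumption|].
        apply Rmult_le_compat_r; [left; apply Rinv_0_lt_compat; nra | lra].
      * apply Rmult_le_reg_r with (Rabs w * T); [nra|].
        replace (Rabs c * (2 * / (Rabs w * T)) * (Rabs w * T)) with (2 * Rabs c) by (field; lra).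
        assert (2 * (Rabs c + 1) / (Rabs w * e) * (Rabs w * e) <= T * (Rabs w * e))
          by (apply Rmult_le_compat_r; nra).
        replace (2 * (Rabs c + 1) / (Rabs w * e) * (Rabs w * e)) with (2 * (Rabs c + 1)) in * by (field; lra).
        lra.
  - exists (l1 + l2); intros e He.
    destruct (H1 (e / 2)) as (T1 & HT1 & B1); [lra|].
    destruct (H2 (e / 2)) as (T2 & HT2 & B2); [lra|].
    exists (Rmax T1 T2); split; [apply Rlt_le_trans with T1; [lra | apply Rmax_l]|].
    intros T HT.
    assert (T1 <= T) by (eapply Rle_trans; [apply Rmax_l | exact HT]).
    assert (T2 <= T) by (eapply Rle_trans; [apply Rmax_r | exact HT]).
    rewrite mean_plus by now apply real_trig_cts.
    replace (mean T f + mean T g - (l1 + l2)) with ((mean T f - l1) + (mean T g - l2)) by ring.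
    eapply Rle_trans; [apply Rabs_triang|]. specialize (B1 T H); specialize (B2 T H0); lra.
  - exists l; intros e He; destruct (H e He) as (T0 & HT0 & B); exists T0; split; auto.
    intros T HT; rewrite <- (mean_ext T f g); auto; lra.
Qed.

(** Uniform closeness passes to means over every interval, so the means of f satisfy the Cauchy
    criterion as T grows. *)
Lemma uniform_limit_mean_cv (f : R -> R) : cts f ->
  (forall e, 0 < e -> exists g, real_trig g /\ forall t, Rabs (f t - g t) <= e) ->
  exists l, mean_cv f l.
Proof.
  intros Hf Happ.
  assert (HC : forall e, 0 < e -> exists T0, 0 < T0 /\ forall T U, T0 <= T -> T0 <= U ->
    Rabs (mean T f - mean U f) <= e).
  { intros e He; destruct (Happ (e / 4)) as (g & Hg & Hfg); [lra|].
    assert (Hgc := real_trig_cts g Hg).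
    destruct (real_trig_mean_cv g Hg) as (l & Hl).
    destruct (Hl (e / 4)) as (T0 & HT0 & B); [lra|].
    exists T0; split; auto.
    assert (D : forall T, T0 <= T -> Rabs (mean T f - l) <= e / 2).
    { intros T HT.
      assert (B1 := B T HT).
      assert (Rabs (mean T f - mean T g) <= e / 4).
      { rewrite <- mean_minus by assumption. apply Rabs_le; split.
        - rewrite <- (mean_const T (- (e / 4))) by lra.
          apply mean_le; auto with cts; [lra|]. intros t _; generalize (Rabs_le_between (f t - g t) (e / 4)).
          intros [K _]; specialize (K (Hfg t)); lra.
        - rewrite <- (mean_const T (e / 4)) by lra.
          apply mean_le; auto with cts; [lra|]. intros t _; generalize (Rabs_le_between (f t - g t) (e / 4)).
          intros [K _]; specialize (K (Hfg t)); lra. }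
      replace (mean T f - l) with ((mean T f - mean T g) + (mean T g - l)) by ring.
      eapply Rle_trans; [apply Rabs_triang|]; lra. }
    intros T U HT HU.
    replace (mean T f - mean U f) with ((mean T f - l) + - (mean U f - l)) by ring.
    eapply Rle_trans; [apply Rabs_triang|]; rewrite Rabs_Ropp.
    generalize (D T HT) (D U HU); lra. }
  assert (HINR : forall T0, exists n0, forall n, (n0 <= n)%nat -> T0 <= INR n).
  { intros T0; destruct (nfloor_ex (Rabs T0) (Rabs_pos T0)) as (n0 & Hn0 & Hn1).
    exists (S n0); intros n Hn. apply le_INR in Hn; rewrite S_INR in Hn.
    generalize (Rle_abs T0); lra. }
  (* Completeness is stated for sequences: the limit is found along integer lengths and then
     transferred to all T by the Cauchy property. *)
  destruct (Rcomplete.R_complete (fun n => mean (INR n) f)) as (l & Hl).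
  { intros e He; destruct (HC (e / 2)) as (T0 & _ & B); [lra|].
    destruct (HINR T0) as (n0 & Hn0); exists n0; intros n p Hn Hp.
    apply Rle_lt_trans with (e / 2); [|lra]. apply B; apply Hn0; lia. }
  exists l; intros e He.
  destruct (HC (e / 2)) as (T0 & HT0 & B); [lra|].
  exists T0; split; auto; intros T HT.
  destruct (Hl (e / 2)) as (n1 & Hn1); [lra|]. destruct (HINR T0) as (n0 & Hn0).
  set (n := max n0 n1).
  assert (K1 := B T (INR n) HT (Hn0 n ltac:(lia))).
  assert (K2 := Hn1 n ltac:(lia)). unfold Rdist in K2.
  replace (mean T f - l) with ((mean T f - mean (INR n) f) + (mean (INR n) f - l)) by ring.
  eapply Rle_trans; [apply Rabs_triang|]; lra.
Qed.

(* These polynomials increase to [sqrt x] on [0, 1]. *)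
Fixpoint sqrt_approx (n : nat) (x : R) : R :=
  match n with O => 0 | S k => sqrt_approx k x + (x - sqrt_approx k x * sqrt_approx k x) / 2 end.

(** The error e obeys e' = e (1 - y + e/2) <= e (1 - e/2), because e <= y. The map e (1 - e/2)
    increases on [0, 1] and sends 2/k below 2/(k + 1). *)
Lemma sqrt_approx_error (n : nat) (y : R) : 0 <= y <= 1 ->
  0 <= sqrt_approx n (y * y) <= y /\ y - sqrt_approx n (y * y) <= 2 / INR (n + 2).
Proof.
  intros Hy; induction n as [|n [IH1 IH2]]; [simpl; lra|].
  cbn [sqrt_approx]; set (p := sqrt_approx n (y * y)) in *.
  split; [split; nra|].
  replace (S n + 2)%nat with (S (n + 2)) by lia; rewrite S_INR.
  set (k := INR (n + 2)) in *.
  assert (Hk : 2 <= k) by (unfold k; apply (le_INR 2); lia).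
  set (e := y - p) in *.
  replace (y - (p + (y * y - p * p) / 2)) with (e * (1 - y + e / 2)) by (unfold e; field).
  apply Rle_trans with (e * (1 - e / 2)); [unfold e in *; nra|].
  apply Rle_trans with (2 / k * (1 - 2 / k / 2)).
  - assert (0 < 2 / k <= 1).
    { split; [apply Rdiv_lt_0_compat; lra|]. apply Rmult_le_reg_r with k; [lra|].
      unfold Rdiv; rewrite Rmult_assoc, Rinv_l; lra. }
    nra.
  - replace (2 / k * (1 - 2 / k / 2)) with (2 * (k - 1) / (k * k)) by (field; lra).
    apply Rmult_le_reg_r with (k * k * (k + 1)); [nra|].
    replace (2 * (k - 1) / (k * k) * (k * k * (k + 1))) with (2 * (k - 1) * (k + 1)) by (field; lra).
    replace (2 / (k + 1) * (k * k * (k + 1))) with (2 * k * k) by (field; lra).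
    nra.
Qed.

Lemma real_trig_sqrt_approx (n : nat) (f : R -> R) :
  real_trig f -> real_trig (fun t => sqrt_approx n (f t)).
Proof.
  intros H; induction n as [|n IH]; [exact (real_trig_const 0)|].
  apply (real_trig_ext (fun t => sqrt_approx n (f t) + (/ 2 * f t +
    - / 2 * (sqrt_approx n (f t) * sqrt_approx n (f t))))).
  - intros t; simpl; field.
  - apply real_trig_plus; [exact IH|]. apply real_trig_plus; apply real_trig_scal; [exact H|].
    now apply real_trig_mult.
Qed.

(** |p|^2 / K^2 is a real trigonometric polynomial with values in [0, 1], so polynomials
    approximating the square root there give uniform approximations of |p|. *)
Lemma besicovitch_mean_exists (a : nat -> C) (w : nat -> R) (N : nat) :
  exists l, mean_cv (fun t => Cmod (csum (fun k => a k * cis (w k * t))%C N)) l.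
Proof.
  set (p := fun t => csum (fun k => a k * cis (w k * t))%C N).
  apply uniform_limit_mean_cv; [unfold p; auto 14 with cts|].
  intros e He.
  set (K := rsum (fun k => Cmod (a k)) N + 1).
  assert (HK0 : 0 <= rsum (fun k => Cmod (a k)) N) by (apply rsum_ge0; intros; apply Cmod_ge_0).
  assert (HK : forall t, Cmod (p t) <= K).
  { intros t; eapply Rle_trans; [apply Cmod_csum|].
    rewrite (rsum_ext _ (fun k => Cmod (a k))); [unfold K; lra|].
    intros; rewrite Cmod_mult, Cmod_cis; ring. }
  destruct (archimed_cor1 (e / (2 * K))) as (n & Hn & Hn0); [apply Rdiv_lt_0_compat; unfold K; lra|].
  exists (fun t => K * sqrt_approx n (/ K ^ 2 * (Re (p t) * Re (p t) + Im (p t) * Im (p t)))); split.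
  - apply real_trig_scal, real_trig_sqrt_approx, real_trig_scal.
    assert (HR : real_trig (fun t => Re (p t))).
    { apply (real_trig_ext (fun t => rsum (fun k => Re (a k) * cos (w k * t + 0) + Im (a k) * cos (w k * t + PI / 2)) N)).
      - intros t; unfold p; rewrite Re_csum; apply rsum_ext; intros k _.
        rewrite Rplus_0_r, cos_plus, cos_PI2, sin_PI2; unfold Re, Im; simpl; ring.
      - apply real_trig_rsum; intros; repeat constructor. }
    assert (HI : real_trig (fun t => Im (p t))).
    { apply (real_trig_ext (fun t => rsum (fun k => Im (a k) * cos (w k * t + 0) + - Re (a k) * cos (w k * t + PI / 2)) N)).
      - intros t; unfold p; rewrite Im_csum; apply rsum_ext; intros k _.
        rewrite Rplus_0_r, cos_plus, cos_PI2, sin_PI2; unfold Re, Im; simpl; ring.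
      - apply real_trig_rsum; intros; repeat constructor. }
    apply real_trig_plus; now apply real_trig_mult.
  - intros t; fold (p t). set (y := Cmod (p t) / K).
    assert (HKp : 0 < K) by (unfold K; lra).
    assert (Hy : 0 <= y <= 1).
    { split; [apply Rdiv_le_0_compat; [apply Cmod_ge_0 | lra]|].
      apply Rmult_le_reg_r with K; [lra|]. unfold y, Rdiv; rewrite Rmult_assoc, Rinv_l by lra.
      specialize (HK t); lra. }
    replace (/ K ^ 2 * (Re (p t) * Re (p t) + Im (p t) * Im (p t))) with (y * y).
    2:{ unfold y. assert (E := Cmod2_alt (p t)).
        transitivity (Cmod (p t) ^ 2 * / K ^ 2); [field; lra | rewrite E; ring]. }
    destruct (sqrt_approx_error n y Hy) as [H1 H2].
    replace (Cmod (p t)) with (K * y) by (unfold y; field; lra).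
    rewrite <- Rmult_minus_distr_l, Rabs_mult, (Rabs_pos_eq K), Rabs_pos_eq by lra.
    assert (H3 : 2 / INR (n + 2) <= 2 * / INR n).
    { unfold Rdiv; apply Rmult_le_compat_l; [lra|]. apply Rinv_le_contravar; [now apply lt_0_INR|].
      apply le_INR; lia. }
    apply Rle_trans with (K * (2 * (e / (2 * K)))); [apply Rmult_le_compat_l; lra|].
    right; field; lra.
Qed.

Lemma separation_exists (w : nat -> R) (N : nat) :
  (forall k l, (k < l)%nat -> (l < N)%nat -> w k < w l) ->
  exists delta, 0 < delta /\ forall k l, (k < l)%nat -> (l < N)%nat -> w k + delta <= w l.
Proof.
  induction N as [|N IH]; intros H; [exists 1; split; [lra | lia]|].
  destruct IH as (d & Hd & HD); [intros; apply H; lia|].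
  assert (HL : exists d', 0 < d' /\ forall k, (k < N)%nat -> w k + d' <= w N).
  { clear -H. assert (HN : forall k, (k < N)%nat -> w k < w N) by (intros; apply H; lia). clear H.
    revert HN; generalize (w N); intros v; induction N as [|N IH]; intros H.
    - exists 1; split; [lra | lia].
    - destruct IH as (d & Hd & HD); [intros; apply H; lia|].
      assert (HN := H N ltac:(lia)).
      exists (Rmin d (v - w N)); split; [apply Rmin_glb_lt; lra|].
      intros k Hk; destruct (Nat.eq_dec k N) as [->|].
      + generalize (Rmin_r d (v - w N)); lra.
      + specialize (HD k ltac:(lia)); generalize (Rmin_l d (v - w N)); lra. }
  destruct HL as (d' & Hd' & HD').
  exists (Rmin d d'); split; [apply Rmin_glb_lt; lra|].
  intros k l Hkl Hl; destruct (Nat.eq_dec l N) as [->|].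
  - specialize (HD' k ltac:(lia)); generalize (Rmin_r d d'); lra.
  - specialize (HD k l Hkl ltac:(lia)); generalize (Rmin_l d d'); lra.
Qed.

(** Lets T tend to infinity and tau to 0 in [large_T_bound]. *)
Lemma besicovitch_mean_ge (N r : nat) (a : nat -> C) (w : nat -> R) (eps M : R) :
  (2 <= r)%nat -> 0 < eps ->
  (forall k l, (k < l)%nat -> (l < N)%nat -> w k < w l) ->
  mean_cv (fun t => Cmod (csum (fun k => a k * cis (w k * t))%C N)) M ->
  (1 - exp (- eps)) * (1 - eps * sqrt 2 * (/ INR r / ((1 - / INR r) * (1 - (/ INR r) ^ 2)))) *
    rsum (fun k => (/ INR r) ^ (2 * block_of (r * r) k) * Cmod (a k)) N <= M.
Proof.
  intros Hr He Hw HM.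
  destruct (separation_exists w N Hw) as (delta & Hd & Hdelta).
  assert (E1 : exp (- eps) < 1) by (rewrite <- exp_0; apply exp_increasing; lra).
  assert (E0 := exp_pos (- eps)).
  set (W := rsum _ N).
  assert (HW : 0 <= W).
  { apply rsum_ge0; intros; apply Rmult_le_pos; [|apply Cmod_ge_0].
    left; apply block_weight_pos; lia. }
  set (c := / INR r / ((1 - / INR r) * (1 - (/ INR r) ^ 2))).
  set (s := eps * sqrt 2). set (q := 1 - exp (- eps)).
  apply le_epsilon; intros e Hepos.
  (* The terms with tau cost q (s c + 1) W tau; this choice makes them at most e/2, and the other
     e/2 is the distance of the mean to its limit. *)
  set (tau := e / (2 * (q * (Rabs (s * c) + 1) * W + 1))).
  assert (Hq : 0 < q) by (unfold q; lra).
  assert (Hsc := Rabs_pos (s * c)).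
  assert (Hden : 0 < q * (Rabs (s * c) + 1) * W + 1).
  { assert (0 <= q * (Rabs (s * c) + 1) * W) by (repeat apply Rmult_le_pos; lra). lra. }
  assert (Htau : 0 < tau) by (apply Rdiv_lt_0_compat; lra).
  destruct (large_T_bound N r a w eps delta tau Hr He Hd Htau Hdelta) as (T0 & HT0 & B).
  destruct (HM (e / 2)) as (T1 & HT1 & B1); [lra|].
  set (T := Rmax T0 T1).
  specialize (B T (Rmax_l _ _)). specialize (B1 T (Rmax_r _ _)).
  fold c W in B. fold s q in B.
  set (mu := mean T _) in *.
  assert (Hmu : mu <= M + e / 2) by (apply Rabs_le_between in B1; lra).
  assert (B2 : q * ((1 - s * (1 + tau) * c - tau) * W) <= mu).
  { apply Rmult_le_reg_l with (1 / q); [apply Rdiv_lt_0_compat; lra|].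
    replace (1 / q * (q * ((1 - s * (1 + tau) * c - tau) * W))) with ((1 - s * (1 + tau) * c - tau) * W)
      by (field; lra). exact B. }
  assert (B3 : q * (s * c + 1) * W * tau <= e / 2).
  { apply Rle_trans with ((q * (Rabs (s * c) + 1) * W + 1) * tau).
    - apply Rmult_le_compat_r; [lra|]. generalize (Rle_abs (s * c)); intros.
      assert (q * (s * c + 1) * W <= q * (Rabs (s * c) + 1) * W); [|lra].
      apply Rmult_le_compat_r; [lra|]. apply Rmult_le_compat_l; lra.
    - unfold tau; right; field; lra. }
  replace (q * (1 - s * c) * W) with (q * ((1 - s * (1 + tau) * c - tau) * W) + q * (s * c + 1) * W * tau) by ring.
  lra.
Qed.

(** * Numerical constants and the two bounds for the limit *)

Lemma exp_ge_taylor4 (x : R) : 0 <= x -> 1 + x + x ^ 2 / 2 + x ^ 3 / 6 + x ^ 4 / 24 <= exp x.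
Proof.
  intros Hx; eapply Rle_trans; [|apply (exp_ge_taylor x 4 Hx)].
  right; simpl; field.
Qed.

Lemma sqrt_2_le : sqrt 2 <= 1.41422.
Proof.
  rewrite <- (sqrt_pow2 1.41422) by lra. apply sqrt_le_1_alt; lra.
Qed.

(** Block b starts at (4^b - 1)/3 <= k, so 4^b <= 3k + 1. The form k + 2 matches the weight in the
    statement, whose indices start at 1. *)
Lemma dyadic_weight_ge (k : nat) : / (3 * (INR k + 2)) <= (/ INR 2) ^ (2 * block_of (2 * 2) k).
Proof.
  rewrite block_weight by lia.
  assert (Hs := block_of_spec (2 * 2) k ltac:(lia)).
  assert (Hb := INR_block_start (2 * 2) (block_of (2 * 2) k)).
  rewrite pow_INR.
  assert (INR (block_start (2 * 2) (block_of (2 * 2) k)) <= INR k) by (apply le_INR; lia).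
  assert (E : INR (2 * 2) = 4) by (simpl; ring). rewrite E in *.
  apply Rinv_le_contravar; [apply pow_lt; lra | generalize (pos_INR k); lra].
Qed.

Lemma dyadic_weighted_sum_ge (a : nat -> C) (N : nat) :
  rsum (fun k => Cmod (a k) / (INR k + 2)) N / 3 <=
  rsum (fun k => (/ INR 2) ^ (2 * block_of (2 * 2) k) * Cmod (a k)) N.
Proof.
  unfold Rdiv at 1; rewrite Rmult_comm, <- rsum_scal; apply rsum_le; intros k _.
  assert (H := dyadic_weight_ge k). assert (H0 := pos_INR k).
  replace (/ 3 * (Cmod (a k) / (INR k + 2))) with (/ (3 * (INR k + 2)) * Cmod (a k)) by (field; lra).
  apply Rmult_le_compat_r; [apply Cmod_ge_0 | exact H].
Qed.

(** With r = 2 and eps = 1/4 the geometric constant is 4/3, so the factors are 1 - exp(-1/4) >=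
    0.2194 and 1 - sqrt 2 / 3 >= 0.5285. Their product divided by 3 is just above 1/26. *)
Lemma besicovitch_mean_ge_26 (N : nat) (a : nat -> C) (w : nat -> R) (M : R) :
  (forall k l, (k < l)%nat -> (l < N)%nat -> w k < w l) ->
  mean_cv (fun t => Cmod (csum (fun k => a k * cis (w k * t))%C N)) M ->
  1 / 26 * rsum (fun k => Cmod (a k) / (INR k + 2)) N <= M.
Proof.
  intros Hw HM.
  assert (H := besicovitch_mean_ge N 2 a w (1 / 4) M (le_n 2) ltac:(lra) Hw HM).
  assert (HW := dyadic_weighted_sum_ge a N).
  set (W := rsum (fun k => (/ INR 2) ^ (2 * block_of (2 * 2) k) * Cmod (a k)) N) in *.
  set (S := rsum (fun k => Cmod (a k) / (INR k + 2)) N) in *.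
  assert (HS : 0 <= S).
  { apply rsum_ge0; intros; apply Rdiv_le_0_compat; [apply Cmod_ge_0 | generalize (pos_INR k); lra]. }
  assert (He : exp (- (1 / 4)) <= 0.7806).
  { rewrite exp_Ropp. assert (B := exp_ge_taylor4 (1 / 4) ltac:(lra)).
    rewrite <- (Rinv_inv 0.7806). apply Rinv_le_contravar; lra. }
  assert (Hs := sqrt_2_le).
  simpl (INR 2) in H.
  replace (/ (1 + 1) / ((1 - / (1 + 1)) * (1 - (/ (1 + 1)) ^ 2))) with (4 / 3) in H by field.
  eapply Rle_trans; [|exact H].
  apply Rle_trans with (0.2194 * 0.5285 * W); [lra|].
  apply Rmult_le_compat_r; [lra|].
  apply Rmult_le_compat; lra.
Qed.

(** If PI were smaller, 2 * 0.785375 would exceed PI/2 and have nonpositive cosine, while the Taylor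
    bound puts cos 0.785375 above 1/sqrt 2 and the double angle formula makes that cosine
    positive. *)
Lemma PI_ge : 3.1415 <= PI.
Proof.
  assert (B := proj1 (pre_cos_bound 0.785375 1 ltac:(lra) ltac:(lra))).
  unfold cos_approx, cos_term in B; simpl in B.
  assert (E := cos_2a_cos 0.785375).
  destruct (Rle_dec 3.1415 PI) as [H|H]; [exact H|exfalso].
  assert (cos (2 * 0.785375) <= 0) by (apply cos_le_0; generalize PI2_3_2; lra).
  assert (0.707119 <= cos 0.785375) by lra. nra.
Qed.

(** The exponent is divided by 20 so that a fourth-order Taylor polynomial is accurate enough; the
    20th power is then taken. *)
Lemma ln_100_le : ln 100 <= 4.606.
Proof.
  replace 4.606 with (ln (exp 4.606)) by apply ln_exp.
  apply ln_le; [lra|].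
  replace 4.606 with (INR 20 * 0.2303) by (simpl; lra).
  rewrite <- exp_pow.
  assert (B := exp_ge_taylor4 0.2303 ltac:(lra)).
  apply Rle_trans with (1.25897 ^ 20); [simpl; lra|].
  apply pow_incr; lra.
Qed.

Lemma exp_m17_le : exp (- (1.7)) <= 0.183.
Proof.
  rewrite exp_Ropp.
  assert (5.4650 <= exp 1.7).
  { replace 1.7 with (INR 10 * 0.17) by (simpl; lra).
    rewrite <- exp_pow.
    assert (B := exp_ge_taylor4 0.17 ltac:(lra)).
    apply Rle_trans with (1.1853 ^ 10); [simpl; lra|].
    apply pow_incr; lra. }
  rewrite <- (Rinv_inv 0.183). apply Rinv_le_contravar; lra.
Qed.

(** When |a_k| >= 1 the weighted sum is at least the number b of complete blocks, and b is about ln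
    N / ln rho. With rho = 100 and eps = 1.7 the mean is at least 0.5957 b, against 0.12902 * 4.6162
    b needed. *)
Lemma besicovitch_mean_ge_ln (N : nat) (a : nat -> C) (w : nat -> R) (M : R) :
  (1 <= N)%nat ->
  (forall k l, (k < l)%nat -> (l < N)%nat -> w k < w l) ->
  (forall k, (k < N)%nat -> 1 <= Cmod (a k)) ->
  mean_cv (fun t => Cmod (csum (fun k => a k * cis (w k * t))%C N)) M ->
  4 / PI ^ 3 * ln (INR N) <= M.
Proof.
  intros HN Hw Ha HM.
  assert (H := besicovitch_mean_ge N 10 a w 1.7 M ltac:(lia) ltac:(lra) Hw HM).
  (* The block of the last index, so that blocks 0 to b - 1 lie entirely below N. *)
  set (b := block_of (10 * 10) (N - 1)).
  assert (Hb := block_of_spec (10 * 10) (N - 1) ltac:(lia)). fold b in Hb.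
  assert (HW : INR b <= rsum (fun k => (/ INR 10) ^ (2 * block_of (10 * 10) k) * Cmod (a k)) N).
  { eapply Rle_trans; [apply (complete_blocks_mass 10 b N); lia|].
    apply rsum_le; intros k Hk.
    rewrite <- (Rmult_1_r ((/ INR 10) ^ _)) at 1.
    apply Rmult_le_compat_l; [left; apply block_weight_pos; lia | auto]. }
  set (W := rsum _ N) in *.
  assert (HbR := pos_INR b).
  assert (HP : 0 < 4 / PI ^ 3 <= 0.12902).
  { assert (B := PI_ge). assert (31.0035 <= PI ^ 3).
    { apply Rle_trans with (3.1415 ^ 3); [lra|]. apply pow_incr; lra. }
    split; [apply Rdiv_lt_0_compat; lra|].
    apply Rmult_le_reg_r with (PI ^ 3); [lra|]. unfold Rdiv; rewrite Rmult_assoc, Rinv_l; lra. }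
  assert (Hmain : 0.5957 * INR b <= M).
  { eapply Rle_trans; [|exact H].
    replace (INR 10) with 10 by (simpl; lra).
    replace (/ 10 / ((1 - / 10) * (1 - (/ 10) ^ 2))) with (100 / 891) by field.
    apply Rle_trans with (0.817 * 0.7301 * INR b); [lra|].
    assert (Hs := sqrt_2_le). assert (He := exp_m17_le). assert (Hs0 := sqrt_pos 2).
    apply Rmult_le_compat; try lra.
    apply Rmult_le_compat; lra. }
  (* b = 0 forces N = 1, where ln N = 0; for b >= 1 the additive 1/99 below can be absorbed into a
     multiple of b. *)
  destruct (Nat.eq_dec b 0) as [E|E].
  - rewrite E in Hb; simpl in Hb.
    replace N with 1%nat by lia. rewrite E in Hmain. simpl in *; rewrite ln_1; lra.
  (* N is at most the start (100^(b+1) - 1)/99 of the next block; the factor 100/99 adds at most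
     1/99 to the logarithm. *)
  - assert (HNb : INR N <= 100 ^ b * (100 / 99)).
    { assert (K := INR_block_start (10 * 10) (S b)).
      replace (INR (10 * 10)) with 100 in K by (simpl; lra).
      assert (INR N <= INR (block_start (10 * 10) (S b))) by (apply le_INR; lia).
      simpl (100 ^ S b) in K. lra. }
    assert (Hln : ln (INR N) <= INR b * 4.606 + 1 / 99).
    { eapply Rle_trans; [apply ln_le; [now apply lt_0_INR | exact HNb]|].
      assert (0 < 100 ^ b) by (apply pow_lt; lra).
      rewrite ln_mult by lra. rewrite ln_pow by lra.
      apply Rplus_le_compat; [apply Rmult_le_compat_l; [lra | apply ln_100_le]|].
      generalize (exp_ineq1_le (1 / 99)); intros.
      rewrite <- (ln_exp (1 / 99)); apply ln_le; lra. }
    assert (1 <= INR b) by (apply (le_INR 1); lia).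
    eapply Rle_trans; [|exact Hmain].
    apply Rle_trans with (4 / PI ^ 3 * (INR b * 4.6162)).
    + apply Rmult_le_compat_l; lra.
    + apply Rle_trans with (0.12902 * (INR b * 4.6162)); [apply Rmult_le_compat_r|]; lra.
Qed.

(** * Intervals of fixed length *)

Definition tent (T t : R) : R := 1 - 2 * Rabs t / T.

Lemma cts_tent (T : R) : cts (tent T).
Proof. unfold tent; auto 14 with cts. Qed.
#[local] Hint Resolve cts_tent : cts.

Lemma tent_bounds (T t : R) : 0 < T -> - T / 2 <= t <= T / 2 -> 0 <= tent T t <= 1.
Proof.
  intros HT Ht; unfold tent.
  assert (0 <= Rabs t <= T / 2) by (split; [apply Rabs_pos | apply Rabs_le; lra]).
  assert (0 <= 2 * Rabs t / T <= 1); [|lra].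
  split; [apply Rdiv_le_0_compat; lra|].
  apply Rmult_le_reg_r with T; [lra|]. unfold Rdiv; rewrite Rmult_assoc, Rinv_l; lra.
Qed.

(* Two integrations by parts on each half of the interval. *)
Lemma mean_tent (T : R) (g g1 g2 : R -> R) : 0 < T -> cts g ->
  (forall t, is_derive g1 t (g t)) -> (forall t, is_derive g2 t (g1 t)) ->
  mean T (fun t => tent T t * g t) = 2 / T ^ 2 * (g2 (T / 2) + g2 (- T / 2) - 2 * g2 0).
Proof.
  intros HT Hg H1 H2; unfold mean.
  assert (HL : is_RInt (fun t => tent T t * g t) (- T / 2) 0
    (g1 0 - 2 / T * g2 0 + 2 / T * g2 (- T / 2))).
  { set (F := fun t => (1 + 2 * t / T) * g1 t - 2 / T * g2 t).
    apply (is_RInt_ext (fun t => (1 + 2 * t / T) * g t)).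
    { rewrite Rmin_left, Rmax_right by lra; intros t Ht; unfold tent.
      rewrite Rabs_left by lra. f_equal; field; lra. }
    replace (g1 0 - 2 / T * g2 0 + 2 / T * g2 (- T / 2)) with (minus (F 0) (F (- T / 2))).
    2:{ unfold minus, plus, opp, F; simpl; field; lra. }
    apply (is_RInt_derive (V := R_CompleteNormedModule) F).
    - intros t _; unfold F.
      evar_last.
      + apply (is_derive_minus (fun t => (1 + 2 * t / T) * g1 t) (fun t => 2 / T * g2 t)).
        * apply (is_derive_mult (fun t => 1 + 2 * t / T) g1); [|apply H1|].
          -- instantiate (1 := 2 / T); auto_derive; auto; field; lra.
          -- intros; apply Rmult_comm.
        * apply (is_derive_scal g2); apply H2.
      + unfold minus, plus, opp, mult; simpl. unfold mult; simpl. ring.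
    - intros t _; apply (cts_mult (fun t => 1 + 2 * t / T) g); auto 14 with cts. }
  assert (HR : is_RInt (fun t => tent T t * g t) 0 (T / 2)
    (2 / T * g2 (T / 2) - g1 0 - 2 / T * g2 0)).
  { set (F := fun t => (1 - 2 * t / T) * g1 t + 2 / T * g2 t).
    apply (is_RInt_ext (fun t => (1 - 2 * t / T) * g t)).
    { rewrite Rmin_left, Rmax_right by lra; intros t Ht; unfold tent.
      rewrite Rabs_pos_eq by lra. reflexivity. }
    replace (2 / T * g2 (T / 2) - g1 0 - 2 / T * g2 0) with (minus (F (T / 2)) (F 0)).
    2:{ unfold minus, plus, opp, F; simpl; field; lra. }
    apply (is_RInt_derive (V := R_CompleteNormedModule) F).
    - intros t _; unfold F.
      evar_last.
      + apply (is_derive_plus (fun t => (1 - 2 * t / T) * g1 t) (fun t => 2 / T * g2 t)).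
        * apply (is_derive_mult (fun t => 1 - 2 * t / T) g1); [|apply H1|].
          -- instantiate (1 := - (2 / T)); auto_derive; auto; field; lra.
          -- intros; apply Rmult_comm.
        * apply (is_derive_scal g2); apply H2.
      + unfold plus, mult; simpl. unfold mult; simpl. ring.
    - intros t _; apply (cts_mult (fun t => 1 - 2 * t / T) g); auto 14 with cts. }
  assert (HC := is_RInt_Chasles _ _ _ _ _ _ HL HR).
  rewrite (is_RInt_unique _ _ _ _ HC). unfold plus; simpl. field; lra.
Qed.

Lemma wcoef_tent_0 (T : R) : 0 < T -> wcoef T (tent T) 0 = RtoC (1 / 2).
Proof.
  intros HT; unfold wcoef.
  rewrite (cmean_ext T _ (fun t => RtoC (tent T t * 1))) by
    (auto; intros; rewrite Rmult_0_l, cis_0, Rmult_1_r; ring).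
  unfold cmean, RtoC; simpl; rewrite mean_const by assumption; f_equal.
  rewrite (mean_tent T (fun _ => 1) (fun t => t) (fun t => t ^ 2 / 2)); auto with cts.
  - field; lra.
  - intros; auto_derive; auto.
  - intros; auto_derive; auto; field.
Qed.

(** The transform is exactly 4 (1 - cos(sT/2)) / (sT)^2; the imaginary part vanishes because the
    tent is even. *)
Lemma wcoef_tent_le (T s : R) : 0 < T -> s <> 0 -> Cmod (wcoef T (tent T) s) <= 8 / (s * T) ^ 2.
Proof.
  intros HT Hs.
  assert (E : wcoef T (tent T) s = RtoC (4 * (1 - cos (s * T / 2)) / (s * T) ^ 2)).
  { unfold wcoef, cmean; apply injective_projections.
    - change (mean T (fun t => Re (cis (s * t) * tent T t)%C) = 4 * (1 - cos (s * T / 2)) / (s * T) ^ 2).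
      rewrite (mean_ext T _ (fun t => tent T t * cos (s * t))) by (auto; intros; unfold Re; simpl; ring).
      rewrite (mean_tent T (fun t => cos (s * t)) (fun t => sin (s * t) / s) (fun t => - cos (s * t) / s ^ 2)); auto 14 with cts.
      + rewrite Rmult_0_r, cos_0. replace (s * (- T / 2)) with (- (s * T / 2)) by field.
        rewrite cos_neg. replace (s * (T / 2)) with (s * T / 2) by field. field; lra.
      + intros t; auto_derive; auto; field; assumption.
      + intros t; auto_derive; auto; field; assumption.
    - change (mean T (fun t => Im (cis (s * t) * tent T t)%C) = 0).
      rewrite (mean_ext T _ (fun t => tent T t * sin (s * t))) by (auto; intros; unfold Im; simpl; ring).
      rewrite (mean_tent T (fun t => sin (s * t)) (fun t => - cos (s * t) / s) (fun t => - sin (s * t) / s ^ 2)); auto 14 with cts.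
      + rewrite Rmult_0_r, sin_0. replace (s * (- T / 2)) with (- (s * T / 2)) by field.
        rewrite sin_neg. replace (s * (T / 2)) with (s * T / 2) by field. field; lra.
      + intros t; auto_derive; auto; field; assumption.
      + intros t; auto_derive; auto; field; assumption. }
  assert (HsT : 0 < (s * T) ^ 2) by (apply pow2_gt_0; apply Rmult_integral_contrapositive_currified; lra).
  assert (B := COS_bound (s * T / 2)).
  rewrite E, Cmod_RtoC.
  - unfold Rdiv; apply Rmult_le_compat_r; [left; now apply Rinv_0_lt_compat | lra].
  - apply Rdiv_le_0_compat; lra.
Qed.

(** On [-T/2, T/2] the tent of base 2T is at least 1/2, and averaging over twice the length costs
    another factor 2. This yields the unweighted norm bound while keeping the quadratic decay of the
    tent. *)
Lemma mean_le_tent (T : R) (phi : R -> R) : 0 < T -> cts phi -> (forall t, 0 <= phi t) ->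
  mean T phi <= 4 * mean (2 * T) (fun t => phi t * tent (2 * T) t).
Proof.
  intros HT Hphi H0.
  set (F := fun t => phi t * tent (2 * T) t).
  assert (HF : cts F) by (unfold F; auto with cts).
  assert (HF0 : forall t, - T <= t <= T -> 0 <= F t).
  { intros t Ht; apply Rmult_le_pos; auto; apply tent_bounds; lra. }
  assert (E : RInt F (- (2 * T) / 2) (2 * T / 2) =
    RInt F (- (2 * T) / 2) (- T / 2) + (RInt F (- T / 2) (T / 2) + RInt F (T / 2) (2 * T / 2))).
  { rewrite <- (RInt_Chasles (V := R_CompleteNormedModule) F _ (- T / 2) _ (cts_ex_RInt _ _ _ HF) (cts_ex_RInt _ _ _ HF)).
    rewrite <- (RInt_Chasles (V := R_CompleteNormedModule) F (- T / 2) (T / 2) _ (cts_ex_RInt _ _ _ HF) (cts_ex_RInt _ _ _ HF)).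
    reflexivity. }
  assert (P1 : 0 <= RInt F (- (2 * T) / 2) (- T / 2)).
  { apply RInt_ge_0; [lra | now apply cts_ex_RInt | intros; apply HF0; lra]. }
  assert (P2 : 0 <= RInt F (T / 2) (2 * T / 2)).
  { apply RInt_ge_0; [lra | now apply cts_ex_RInt | intros; apply HF0; lra]. }
  assert (P3 : mean T phi <= 2 * mean T F).
  { rewrite <- mean_scal by assumption. apply mean_le; auto with cts.
    intros t Ht; unfold F, tent.
    assert (Rabs t <= T / 2) by (apply Rabs_le; lra).
    assert (2 * Rabs t / (2 * T) <= / 2).
    { apply Rmult_le_reg_r with (2 * T); [lra|]. unfold Rdiv; rewrite Rmult_assoc, Rinv_l; lra. }
    specialize (H0 t); nra. }
  eapply Rle_trans; [exact P3|].
  unfold mean; rewrite E.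
  replace (4 * (1 / (2 * T) * (RInt F (- (2 * T) / 2) (- T / 2) + (RInt F (- T / 2) (T / 2) + RInt F (T / 2) (2 * T / 2)))))
    with (2 * (1 / T * (RInt F (- (2 * T) / 2) (- T / 2) + (RInt F (- T / 2) (T / 2) + RInt F (T / 2) (2 * T / 2)))))
    by (field; lra).
  apply Rmult_le_compat_l; [lra|]. apply Rmult_le_compat_l; [left; apply Rdiv_lt_0_compat; lra | lra].
Qed.

(** * Sums of inverse powers of the index distance *)

Definition inv_sqr (d : nat) : R := match d with O => 0 | S _ => / INR d ^ 2 end.
Definition inv_three_halves (d : nat) : R := match d with O => 0 | S _ => / (INR d * sqrt (INR d)) end.

Lemma rsum_shift (f : nat -> R) (n : nat) : rsum f (S n) = f O + rsum (fun k => f (S k)) n.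
Proof.
  induction n as [|n IH]; [simpl; ring|].
  change (rsum f (S (S n))) with (rsum f (S n) + f (S n)). rewrite IH; simpl; ring.
Qed.

Lemma inv_sqr_ge0 (d : nat) : 0 <= inv_sqr d.
Proof.
  destruct d; [simpl; lra|]. left; apply Rinv_0_lt_compat, pow_lt, lt_0_INR; lia.
Qed.

Lemma inv_three_halves_ge0 (d : nat) : 0 <= inv_three_halves d.
Proof.
  destruct d; [simpl; lra|]. assert (0 < INR (S d)) by (apply lt_0_INR; lia).
  left; apply Rinv_0_lt_compat, Rmult_lt_0_compat; [|apply sqrt_lt_R0]; assumption.
Qed.

Lemma inv_sqr_shift_sum (M : nat) : rsum (fun d => inv_sqr (S d)) M <= 2.
Proof.
  destruct M as [|M]; [simpl; lra|].
  assert (H : rsum (fun d => inv_sqr (S d)) (S M) <= 2 - / INR (S M)).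
  { induction M as [|M IH]; [simpl; lra|].
    change (rsum (fun d => inv_sqr (S d)) (S (S M))) with
      (rsum (fun d => inv_sqr (S d)) (S M) + / INR (S (S M)) ^ 2).
    assert (HM : 0 < INR (S M)) by (apply lt_0_INR; lia).
    rewrite (S_INR (S M)). set (y := INR (S M)) in *.
    assert (/ (y + 1) ^ 2 <= / y - / (y + 1)); [|lra].
    replace (/ y - / (y + 1)) with (/ (y * (y + 1))) by (field; lra).
    apply Rinv_le_contravar; nra. }
  assert (0 < / INR (S M)) by (apply Rinv_0_lt_compat, lt_0_INR; lia). lra.
Qed.

(** Telescopes against 3 - 2/sqrt M, a discrete form of the integral test. *)
Lemma inv_three_halves_shift_sum (M : nat) : rsum (fun d => inv_three_halves (S d)) M <= 3.
Proof.
  destruct M as [|M]; [simpl; lra|].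
  assert (H : rsum (fun d => inv_three_halves (S d)) (S M) <= 3 - 2 * / sqrt (INR (S M))).
  { induction M as [|M IH]; [simpl; rewrite sqrt_1; lra|].
    change (rsum (fun d => inv_three_halves (S d)) (S (S M))) with
      (rsum (fun d => inv_three_halves (S d)) (S M) + / (INR (S (S M)) * sqrt (INR (S (S M))))).
    assert (HM : 0 < INR (S M)) by (apply lt_0_INR; lia).
    rewrite (S_INR (S M)). set (y := INR (S M)) in *.
    assert (Ha := sqrt_lt_R0 y HM). assert (Hb := sqrt_lt_R0 (y + 1) ltac:(lra)).
    assert (Ea := sqrt_sqrt y ltac:(lra)). assert (Eb := sqrt_sqrt (y + 1) ltac:(lra)).
    set (u := sqrt y) in *; set (v := sqrt (y + 1)) in *.
    assert (u < v) by nra.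
    assert (/ ((y + 1) * v) <= 2 * / u - 2 * / v); [|lra].
    rewrite <- Eb.
    replace (2 * / u - 2 * / v) with (2 * (v - u) / (u * v)) by (field; lra).
    replace (2 * (v - u) / (u * v)) with (/ (u * v * (u + v) / 2)).
    - apply Rinv_le_contravar; [nra|].
      assert (u * (u + v) <= 2 * (v * v)) by nra. nra.
    - assert (E1 : (v - u) * (u + v) = 1) by nra.
      replace (v - u) with (/ (u + v)) by (apply Rmult_eq_reg_r with (u + v); [rewrite E1; apply Rinv_l; lra | lra]).
      field; lra. }
  assert (0 < / sqrt (INR (S M))) by (apply Rinv_0_lt_compat, sqrt_lt_R0, lt_0_INR; lia). lra.
Qed.

Lemma rsum_from_shift (g : nat -> R) (B : R) (M : nat) : g O = 0 ->
  (forall n, rsum (fun d => g (S d)) n <= B) -> rsum g M <= B.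
Proof.
  intros H0 H; destruct M as [|M]; [apply (H O)|]. rewrite rsum_shift, H0, Rplus_0_l; apply H.
Qed.

(** The sum runs backwards through g, so the induction carries along the part of g not yet reached,
    [rsum g (S k - N)]. *)
Lemma sum_dist_below (g : nat -> R) (B : R) (k N : nat) : (forall d, 0 <= g d) ->
  (forall M, rsum g M <= B) -> rsum (fun l => if lt_dec l k then g (k - l)%nat else 0) N <= B.
Proof.
  intros Hg HB.
  assert (H : rsum (fun l => if lt_dec l k then g (k - l)%nat else 0) N + rsum g (S k - N) <= rsum g (S k)).
  { induction N as [|N IH]; [simpl (rsum _ 0); rewrite Nat.sub_0_r; lra|].
    cbn [rsum]; destruct (lt_dec N k).
    - replace (S k - N)%nat with (S (k - N)) in IH by lia. cbn [rsum] in IH.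
      replace (S k - S N)%nat with (k - N)%nat by lia. simpl in *; lra.
    - eapply Rle_trans; [|exact IH]. rewrite Rplus_0_r.
      apply Rplus_le_compat_l, rsum_le_extend; [lia | exact Hg]. }
  assert (0 <= rsum g (S k - N)) by (apply rsum_ge0; auto). specialize (HB (S k)); lra.
Qed.

Lemma sum_dist_above (g : nat -> R) (B : R) (k N : nat) : (forall d, 0 <= g d) ->
  (forall M, rsum g M <= B) -> rsum (fun l => if lt_dec k l then g (l - k)%nat else 0) N <= B.
Proof.
  intros Hg HB.
  assert (H : rsum (fun l => if lt_dec k l then g (l - k)%nat else 0) N <= rsum g (N - k)).
  { induction N as [|N IH]; [simpl; lra|].
    cbn [rsum]; destruct (lt_dec k N).
    - replace (S N - k)%nat with (S (N - k)) by lia. cbn [rsum]; lra.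
    - rewrite Rplus_0_r; eapply Rle_trans; [exact IH|]. apply rsum_le_extend; [lia | exact Hg]. }
  specialize (HB (N - k)%nat); lra.
Qed.

(** The two branches handle truncated subtraction; both vanish at l = k, so the diagonal needs no
    exclusion. *)
Definition dist_inv_sqr (k l : nat) : R :=
  (if lt_dec l k then inv_sqr (k - l) else 0) + (if lt_dec k l then inv_sqr (l - k) else 0).

Lemma dist_inv_sqr_sum (k N : nat) : rsum (dist_inv_sqr k) N <= 4.
Proof.
  unfold dist_inv_sqr; rewrite rsum_plus.
  assert (H : forall M, rsum inv_sqr M <= 2).
  { intros M; apply rsum_from_shift; [reflexivity | apply inv_sqr_shift_sum]. }
  generalize (sum_dist_below inv_sqr 2 k N inv_sqr_ge0 H) (sum_dist_above inv_sqr 2 k N inv_sqr_ge0 H); lra.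
Qed.

Lemma dist_inv_sqr_eq (k l : nat) : k <> l -> dist_inv_sqr k l = / (INR k - INR l) ^ 2.
Proof.
  intros H; unfold dist_inv_sqr; destruct (lt_dec l k), (lt_dec k l); try lia.
  - rewrite Rplus_0_r, <- minus_INR by lia. destruct (k - l)%nat eqn:E; [lia | reflexivity].
  - rewrite Rplus_0_l. replace ((INR k - INR l) ^ 2) with ((INR l - INR k) ^ 2) by ring.
    rewrite <- minus_INR by lia. destruct (l - k)%nat eqn:E; [lia | reflexivity].
Qed.

(** * The inequality on a fixed interval, for unit gaps *)

Section LocalBound.
Variables (N : nat) (lam : nat -> R) (T : R).
Hypothesis HT : 72 <= T.
Hypothesis Hinc : forall k l, (k < l)%nat -> (l < N)%nat -> lam k < lam l.
Hypothesis Hgap : forall k l, (k < N)%nat -> (l < N)%nat ->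
  Rabs (INR k - INR l) <= Rabs (lam k - lam l).

Let w (k : nat) : R := 2 * PI * lam k.
Let b : nat -> nat := block_of (2 * 2).
Let x : R := / INR 2.

Lemma PI_gt_3 : 3 < PI.
Proof. generalize PI2_3_2; lra. Qed.

(** Angular gaps are at least 6 |k - l|, as 2 PI > 6, and 8/36 = 2/9. The length U is free because
    both T and 2T are needed. *)
Lemma wcoef_tent_gap (U : R) (k l : nat) : 0 < U -> (k < N)%nat -> (l < N)%nat -> k <> l ->
  Cmod (wcoef U (tent U) (w k - w l)) <= 2 / 9 / U ^ 2 * dist_inv_sqr k l.
Proof.
  intros HU Hk Hl Hkl. rewrite dist_inv_sqr_eq by assumption.
  assert (Hg := Hgap k l Hk Hl). assert (HP := PI_gt_3).
  assert (Hd : 0 < Rabs (INR k - INR l)).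
  { apply Rabs_pos_lt; intros E; apply Hkl, INR_eq; lra. }
  rewrite <- (pow2_abs (INR k - INR l)). set (d := Rabs (INR k - INR l)) in *.
  assert (Hs : 6 * d <= Rabs (w k - w l)).
  { unfold w. replace (2 * PI * lam k - 2 * PI * lam l) with (2 * PI * (lam k - lam l)) by ring.
    rewrite Rabs_mult, (Rabs_pos_eq (2 * PI)) by lra. apply Rmult_le_compat; lra. }
  eapply Rle_trans; [apply wcoef_tent_le; auto; intros E; rewrite E, Rabs_R0 in Hs; lra|].
  rewrite Rpow_mult_distr, <- (pow2_abs (w k - w l)).
  assert (Hs2 : (6 * d) ^ 2 <= Rabs (w k - w l) ^ 2) by (apply pow_incr; lra).
  assert (HU2 : 0 < U ^ 2) by (apply pow_lt; lra).
  apply Rle_trans with (8 / ((6 * d) ^ 2 * U ^ 2)); [|right; field; lra].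
  unfold Rdiv; apply Rmult_le_compat_l; [lra|]. apply Rinv_le_contravar; [|nra].
  apply Rmult_lt_0_compat; [apply pow_lt; lra | assumption].
Qed.

Lemma wcoef_tent_off_diagonal (U : R) (k : nat) : 0 < U -> (k < N)%nat ->
  rsum (fun l => if Nat.eq_dec l k then 0 else Cmod (wcoef U (tent U) (w k - w l))) N <= 8 / 9 / U ^ 2.
Proof.
  intros HU Hk.
  apply Rle_trans with (rsum (fun l => 2 / 9 / U ^ 2 * dist_inv_sqr k l) N).
  - apply rsum_le; intros l Hl; destruct (Nat.eq_dec l k) as [->|].
    + unfold dist_inv_sqr; destruct (lt_dec k k); [lia|]; lra.
    + apply wcoef_tent_gap; auto.
  - rewrite rsum_scal. apply Rle_trans with (2 / 9 / U ^ 2 * 4); [|right; field; lra].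
    apply Rmult_le_compat_l; [|apply dist_inv_sqr_sum].
    apply Rdiv_le_0_compat; [lra | apply pow_lt; lra].
Qed.

(** The power 3/2 is the square root of a sum over n of (X + n)^(-4), of order X^(-3) with X = (k -
    l) T; the constant is what T >= 72 allows. *)
Definition leak (l k : nat) : R := 0.0004 * inv_three_halves (k - l).

Lemma wcoef_tent_leak (l k M : nat) : (l < k)%nat -> (k < N)%nat ->
  rsum (fun n => Cmod (wcoef T (tent T) (w l - w k - 2 * PI * INR n / T)) ^ 2) M <= leak l k ^ 2.
Proof.
  intros Hlk Hk. assert (HP := PI_gt_3).
  assert (Hg := Hgap k l Hk ltac:(lia)). assert (Hi := Hinc l k Hlk Hk).
  assert (Hd1 : 1 <= INR k - INR l).
  { rewrite <- minus_INR by lia; apply (le_INR 1); lia. }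
  rewrite (Rabs_pos_eq (INR k - INR l)), (Rabs_pos_eq (lam k - lam l)) in Hg by lra.
  set (d := INR k - INR l) in *.
  set (X := d * T). assert (HX : 72 * d <= X) by (unfold X; nra).
  apply Rle_trans with (rsum (fun n => 4 / 81 / X ^ 2 * / (X + INR n) ^ 2) M).
  - apply rsum_le; intros n _. assert (Hn := pos_INR n).
    set (s := w l - w k - 2 * PI * INR n / T).
    assert (HsT : s * T = - (2 * PI * ((lam k - lam l) * T + INR n))) by (unfold s, w; field; lra).
    assert (Hge : X + INR n <= (lam k - lam l) * T + INR n) by (unfold X; nra).
    assert (Hs1 : s * T <= - (6 * (X + INR n))) by (rewrite HsT; nra).
    assert (Hs0 : s <> 0) by (intros E; rewrite E in Hs1; lra).
    assert (Hs2 : (6 * (X + INR n)) ^ 2 <= (s * T) ^ 2).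
    { replace ((s * T) ^ 2) with ((- (s * T)) ^ 2) by ring. apply pow_incr; lra. }
    assert (H : Cmod (wcoef T (tent T) s) <= 2 / 9 / (X + INR n) ^ 2).
    { eapply Rle_trans; [apply wcoef_tent_le; lra|].
      apply Rle_trans with (8 / (6 * (X + INR n)) ^ 2); [|right; field; lra].
      unfold Rdiv; apply Rmult_le_compat_l; [lra|]. apply Rinv_le_contravar; [apply pow_lt; lra | exact Hs2]. }
    apply Rle_trans with ((2 / 9 / (X + INR n) ^ 2) ^ 2).
    { apply pow_incr; split; [apply Cmod_ge_0 | exact H]. }
    replace ((2 / 9 / (X + INR n) ^ 2) ^ 2) with (4 / 81 * / (X + INR n) ^ 2 * / (X + INR n) ^ 2) by (field; lra).
    apply Rmult_le_compat_r; [left; apply Rinv_0_lt_compat, pow_lt; lra|].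
    unfold Rdiv; apply Rmult_le_compat_l; [lra|].
    apply Rinv_le_contravar; [apply pow_lt; lra|]. apply pow_incr; lra.
  - rewrite rsum_scal.
    apply Rle_trans with (4 / 81 / X ^ 2 * / (X - 1)).
    { apply Rmult_le_compat_l; [|apply sum_inv_sqr_le; lra].
      apply Rdiv_le_0_compat; [lra | apply pow_lt; lra]. }
    (* 0.00000016 is 0.0004 squared; from X >= 72 d and X - 1 >= 71 d, the requirement is 4/81/(71 *
       72^2) <= 0.00000016. *)
    apply Rle_trans with (0.00000016 / d ^ 3).
    + replace (4 / 81 / X ^ 2 * / (X - 1)) with (4 / 81 * / (X ^ 2 * (X - 1))) by (field; lra).
      assert (H1 : 71 * 72 ^ 2 * d ^ 3 <= X ^ 2 * (X - 1)).
      { assert ((72 * d) ^ 2 <= X ^ 2) by (apply pow_incr; lra).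
        apply Rle_trans with ((72 * d) ^ 2 * (71 * d)); [right; ring|].
        apply Rmult_le_compat; try lra. apply pow2_ge_0. }
      assert (Hd3 : 0 < d ^ 3) by (apply pow_lt; lra).
      apply Rle_trans with (4 / 81 * / (71 * 72 ^ 2 * d ^ 3)).
      * apply Rmult_le_compat_l; [lra|]. apply Rinv_le_contravar; [lra | exact H1].
      * rewrite Rinv_mult, <- Rmult_assoc. apply Rmult_le_compat_r; [left; now apply Rinv_0_lt_compat | lra].
    + unfold leak. destruct (k - l)%nat as [|e] eqn:E; [lia|].
      unfold inv_three_halves; rewrite <- E, minus_INR by lia; fold d.
      right. assert (Hd : d = sqrt d * sqrt d) by (symmetry; apply sqrt_sqrt; lra).
      assert (0 < sqrt d) by (apply sqrt_lt_R0; lra).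
      set (v := sqrt d) in *. rewrite Hd. replace 0.00000016 with (0.0004 * 0.0004) by lra. generalize 0.0004; intros; field. lra.
Qed.

Lemma dyadic_weight_le (k : nat) : x ^ (2 * b k) <= 4 / (3 * (INR k + 1)).
Proof.
  unfold x, b; rewrite block_weight by lia.
  assert (Hs := block_of_spec (2 * 2) k ltac:(lia)).
  assert (Hb := INR_block_start (2 * 2) (S (block_of (2 * 2) k))).
  rewrite pow_INR.
  assert (H : INR (S k) <= INR (block_start (2 * 2) (S (block_of (2 * 2) k)))) by (apply le_INR; lia).
  rewrite S_INR in H.
  assert (E : INR (2 * 2) = 4) by (simpl; ring). rewrite E in *. rewrite <- tech_pow_Rmult in Hb.
  assert (0 < 4 ^ block_of (2 * 2) k) by (apply pow_lt; lra). assert (Hk := pos_INR k).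
  replace (4 / (3 * (INR k + 1))) with (/ (3 * (INR k + 1) / 4)) by (field; lra).
  apply Rinv_le_contravar; lra.
Qed.

Lemma dyadic_weight_ge_succ (k : nat) : 1 <= x ^ (2 * b k) * (3 * (INR k + 1)).
Proof.
  unfold x, b; rewrite block_weight by lia.
  assert (Hs := block_of_spec (2 * 2) k ltac:(lia)).
  assert (Hb := INR_block_start (2 * 2) (block_of (2 * 2) k)).
  rewrite pow_INR.
  assert (H : INR (block_start (2 * 2) (block_of (2 * 2) k)) <= INR k) by (apply le_INR; lia).
  assert (E : INR (2 * 2) = 4) by (simpl; ring). rewrite E in *.
  assert (H4 : 0 < 4 ^ block_of (2 * 2) k) by (apply pow_lt; lra).
  apply Rle_trans with (/ 4 ^ block_of (2 * 2) k * 4 ^ block_of (2 * 2) k); [rewrite Rinv_l; lra|].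
  apply Rmult_le_compat_l; [left; now apply Rinv_0_lt_compat | lra].
Qed.

(** An earlier block has a larger weight, by a ratio at most 4 (k + 1)/(l + 1). With d = k - l and y
    = l + 1 this ratio times d^(-3/2) is 4 (d^(-3/2) + 1/(y sqrt d)), and the last term is at most
    d^(-3/2) or y^(-3/2). Both are summable over l, uniformly in k. *)
Lemma leak_weight (l k : nat) : (l < k)%nat ->
  x ^ (2 * b l) * leak l k <=
  x ^ (2 * b k) * (0.0016 * (2 * inv_three_halves (k - l) + inv_three_halves (S l))).
Proof.
  intros Hlk. set (h := inv_three_halves (k - l)).
  assert (Hh : 0 <= h) by apply inv_three_halves_ge0.
  assert (Hl := pos_INR l). assert (Hl4 := dyadic_weight_le l). assert (Hk4 := dyadic_weight_ge_succ k).
  assert (Hx : 0 < x ^ (2 * b k)) by (apply block_weight_pos; lia).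
  unfold leak; fold h.
  apply Rle_trans with (4 / (3 * (INR l + 1)) * (0.0004 * h)); [apply Rmult_le_compat_r; lra|].
  set (K := x ^ (2 * b k)) in *.
  assert (P : 0 <= 4 / (3 * (INR l + 1)) * (0.0004 * h)).
  { apply Rmult_le_pos; [apply Rdiv_le_0_compat; lra | lra]. }
  apply Rle_trans with (K * (3 * (INR k + 1)) * (4 / (3 * (INR l + 1)) * (0.0004 * h))).
  { rewrite <- (Rmult_1_l (_ * (0.0004 * h))) at 1. now apply Rmult_le_compat_r. }
  replace (K * (3 * (INR k + 1)) * (4 / (3 * (INR l + 1)) * (0.0004 * h))) with
    (K * (0.0016 * ((INR k + 1) / (INR l + 1) * h)))
    by (replace 0.0016 with (4 * 0.0004) by lra; generalize 0.0004; intros; field; lra).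
  apply Rmult_le_compat_l; [lra|]. apply Rmult_le_compat_l; [lra|].
  unfold h, inv_three_halves; destruct (k - l)%nat as [|e] eqn:E; [lia|].
  rewrite <- E, minus_INR, S_INR by lia.
  assert (Hd1 : 1 <= INR k - INR l) by (rewrite <- minus_INR by lia; apply (le_INR 1); lia).
  replace (INR k + 1) with ((INR k - INR l) + (INR l + 1)) by ring.
  set (d := INR k - INR l) in *; set (y := INR l + 1) in *.
  assert (Hy : 1 <= y) by (unfold y; lra).
  assert (0 < sqrt d) by (apply sqrt_lt_R0; lra). assert (0 < sqrt y) by (apply sqrt_lt_R0; lra).
  replace ((d + y) / y * / (d * sqrt d)) with (/ (d * sqrt d) + / (y * sqrt d)) by (field; lra).
  assert (Q1 : 0 < / (d * sqrt d)) by (apply Rinv_0_lt_compat; nra).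
  assert (Q2 : 0 < / (y * sqrt y)) by (apply Rinv_0_lt_compat; nra).
  destruct (Rle_dec d y) as [L|L].
  - assert (/ (y * sqrt d) <= / (d * sqrt d)); [|lra].
    apply Rinv_le_contravar; nra.
  - assert (sqrt y <= sqrt d) by (apply sqrt_le_1_alt; lra).
    assert (/ (y * sqrt d) <= / (y * sqrt y)); [|lra].
    apply Rinv_le_contravar; nra.
Qed.

(** The budget: 4 * 0.000043 from the blocks not before that of k, where 2/9/72^2 <= 0.000043, plus
    0.0016 * (2 * 3 + 3) from the leak, in total below 0.015. *)
Lemma tent_error_sum (k : nat) : (k < N)%nat ->
  rsum (fun l => if Nat.eq_dec l k then 0 else
    x ^ (2 * b l) * (if le_dec (b k) (b l) then Cmod (wcoef T (tent T) (w l - w k)) else leak l k)) N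
  <= 0.015 * x ^ (2 * b k).
Proof.
  intros Hk.
  assert (Hx1 : x = / 2) by (unfold x; simpl; f_equal; ring).
  assert (HK : 0 < x ^ (2 * b k)) by (apply block_weight_pos; lia).
  apply Rle_trans with (rsum (fun l => x ^ (2 * b k) * (0.000043 * dist_inv_sqr k l +
    0.0016 * (2 * (if lt_dec l k then inv_three_halves (k - l) else 0) + inv_three_halves (S l)))) N).
  - apply rsum_le; intros l Hl.
    assert (D0 : 0 <= dist_inv_sqr k l).
    { unfold dist_inv_sqr; generalize (inv_sqr_ge0 (k - l)) (inv_sqr_ge0 (l - k)).
      destruct (lt_dec l k), (lt_dec k l); lra. }
    assert (D1 := inv_three_halves_ge0 (S l)). assert (D2 := inv_three_halves_ge0 (k - l)).
    assert (D3 : 0 <= (if lt_dec l k then inv_three_halves (k - l) else 0)) by (destruct (lt_dec l k); lra).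
    destruct (Nat.eq_dec l k); [apply Rmult_le_pos; lra|].
    destruct (le_dec (b k) (b l)) as [L|L].
    + assert (Hw := wcoef_tent_gap T l k ltac:(lra) Hl Hk n).
      rewrite dist_inv_sqr_eq in Hw by assumption.
      replace ((INR l - INR k) ^ 2) with ((INR k - INR l) ^ 2) in Hw by ring.
      rewrite <- dist_inv_sqr_eq in Hw by auto.
      assert (HTT : 2 / 9 / T ^ 2 <= 0.000043).
      { assert (72 ^ 2 <= T ^ 2) by (apply pow_incr; lra).
        apply Rmult_le_reg_r with (T ^ 2); [lra|].
        unfold Rdiv at 1; rewrite Rmult_assoc, Rinv_l; lra. }
      assert (Hxl : x ^ (2 * b l) <= x ^ (2 * b k)).
      { replace (2 * b l)%nat with (2 * b k + (2 * b l - 2 * b k))%nat by lia. rewrite pow_add.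
        assert (x ^ (2 * b l - 2 * b k) <= 1) by (rewrite <- (pow1 (2 * b l - 2 * b k)); apply pow_incr; lra).
        nra. }
      apply Rmult_le_compat; [left; apply block_weight_pos; lia | apply Cmod_ge_0 | exact Hxl|].
      assert (2 / 9 / T ^ 2 * dist_inv_sqr k l <= 0.000043 * dist_inv_sqr k l) by now apply Rmult_le_compat_r.
      lra.
    + assert (Hlk : (l < k)%nat) by (apply (block_of_lt (2 * 2)); [lia | fold b; lia]).
      destruct (lt_dec l k); [|lia].
      eapply Rle_trans; [now apply leak_weight|].
      apply Rmult_le_compat_l; lra.
  - rewrite rsum_scal, Rmult_comm. apply Rmult_le_compat_r; [lra|].
    rewrite rsum_plus, !rsum_scal, rsum_plus, rsum_scal.
    assert (H1 := dist_inv_sqr_sum k N).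
    assert (H2 := sum_dist_below inv_three_halves 3 k N inv_three_halves_ge0
      (fun M => rsum_from_shift _ 3 M eq_refl inv_three_halves_shift_sum)).
    assert (H3 := inv_three_halves_shift_sum N). lra.
Qed.

(** The tent has mean 1/2, so the main factor is 1/2 minus the damping error, below 0.242, minus
    0.015. *)
Lemma local_mean_ge_122 (a : nat -> C) :
  1 / 122 * rsum (fun k => Cmod (a k) / (INR k + 2)) N <=
  mean T (fun t => Cmod (csum (fun k => a k * cis (w k * t))%C N)).
Proof.
  assert (Hx1 : x = / 2) by (unfold x; simpl; f_equal; ring).
  set (m := S (b N)).
  assert (Hb : forall k, (k < N)%nat -> (b k < m)%nat).
  { intros k Hk; unfold m. destruct (le_lt_dec (b k) (b N)); [lia|].
    assert (N < k)%nat by (apply (block_of_lt (2 * 2)); [lia | assumption]). lia. }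
  assert (HT2 : 72 ^ 2 <= T ^ 2) by (apply pow_incr; lra).
  assert (HD : forall U, 72 <= U -> 0 <= 8 / 9 / U ^ 2 <= 0.00018).
  { intros U HU; assert (72 ^ 2 <= U ^ 2) by (apply pow_incr; lra).
    split; [apply Rdiv_le_0_compat; lra|].
    apply Rmult_le_reg_r with (U ^ 2); [lra|]. unfold Rdiv at 1; rewrite Rmult_assoc, Rinv_l; lra. }
  assert (Hnorm : forall U u i, 72 <= U -> (forall k, Cmod (u k) <= 1) ->
    mean U (fun t => Cmod (block_poly x b u w N i t) ^ 2 * tent U t) <= x ^ (2 * i) * 0.50018).
  { intros U u i HU Hu.
    eapply Rle_trans; [apply (block_poly_mean_sqr_le U (8 / 9 / U ^ 2) (1 / 2) (tent U) 2); auto with cts; try lra|].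
    - apply HD; assumption.
    - apply wcoef_tent_0; lra.
    - intros k Hk; apply wcoef_tent_off_diagonal; [lra | assumption].
    - apply Rmult_le_compat_l; [left; apply block_weight_pos; lia|]. generalize (HD U HU); lra. }
  assert (Hpos : forall i, 0 < x ^ (2 * i)) by (intros; apply block_weight_pos; lia).
  (* 1.42^2 exceeds 4 * 0.50018, the unweighted bound through the tent of base 2T, and 0.72^2
     exceeds 0.50018, the weighted one; 1/2 is the mean of the tent. *)
  assert (H := weighted_sum_le_mean T (1 / 8) x 1.42 0.72 (1 / 2) 0.015 N m a w b (tent T) leak
    ltac:(lra) ltac:(lra) ltac:(lra) ltac:(lra) ltac:(lra) (cts_tent T)
    (fun t Ht => tent_bounds T t ltac:(lra) Ht) (wcoef_tent_0 T ltac:(lra)) Hb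
    (fun i => block_mass 2 i N ltac:(lia))).
  assert (H1 := H
    ltac:(intros u i Hi Hu; eapply Rle_lt_trans;
      [apply mean_le_tent; [lra | apply cts_pow, cts_Cmod, ccts_block_poly | intros; apply pow2_ge_0]
      | generalize (Hnorm (2 * T) u i ltac:(lra) Hu) (Hpos i); lra])
    ltac:(intros u i Hi Hu; generalize (Hnorm T u i HT Hu) (Hpos i); lra)
    ltac:(intros l k; unfold leak; generalize (inv_three_halves_ge0 (k - l)); lra)
    ltac:(intros l k M Hl Hk Hlk; apply wcoef_tent_leak; auto; apply (block_of_lt (2 * 2)); [lia | assumption])
    tent_error_sum).
  clear H.
  assert (HW := dyadic_weighted_sum_ge a N). fold x b in HW.
  set (W := rsum (fun k => x ^ (2 * b k) * Cmod (a k)) N) in *.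
  set (S := rsum (fun k => Cmod (a k) / (INR k + 2)) N) in *.
  set (mu := mean T _) in *.
  assert (HS : 0 <= S).
  { apply rsum_ge0; intros; apply Rdiv_le_0_compat; [apply Cmod_ge_0 | generalize (pos_INR k); lra]. }
  assert (He : exp (- (1 / 8)) <= 0.883).
  { rewrite exp_Ropp. assert (B := exp_ge_taylor4 (1 / 8) ltac:(lra)).
    rewrite <- (Rinv_inv 0.883). apply Rinv_le_contravar; lra. }
  assert (Hs := sqrt_2_le). assert (Hs0 := sqrt_pos 2).
  rewrite Hx1 in H1.
  replace (/ 2 / ((1 - / 2) * (1 - (/ 2) ^ 2))) with (4 / 3) in H1 by field.
  set (q := 1 - exp (- (1 / 8))) in *.
  assert (Hq : 0.117 <= q) by (unfold q; lra).
  (* W is at least a third of the weighted sum, and 0.117 * 0.243 / 3 exceeds 1/122. *)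
  apply Rle_trans with (0.117 * (0.243 * W)); [lra|].
  assert (H2 : 0.243 * W <= 1 / q * mu).
  { eapply Rle_trans; [|exact H1]. apply Rmult_le_compat_r; lra. }
  apply Rle_trans with (q * (0.243 * W)); [apply Rmult_le_compat_r; lra|].
  apply Rle_trans with (q * (1 / q * mu)); [apply Rmult_le_compat_l; lra | right; field; lra].
Qed.

End LocalBound.

(** * Passage from indices starting at 0 to those of the statement *)

Lemma trig_sum_csum (N : nat) (a : nat -> C) (lambda : nat -> R) (t : R) :
  trig_sum N a lambda t = csum (fun k => a (S k) * cis (2 * PI * lambda (S k) * t))%C N.
Proof.
  unfold trig_sum; induction N as [|N IH].
  - now rewrite sum_n_m_zero by lia.
  - rewrite sum_n_Sm, IH by lia; simpl. unfold plus; simpl. f_equal; f_equal.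
    rewrite <- Cexp_Ci, !RtoC_mult; f_equal; ring.
Qed.

Lemma weighted_sum_rsum (N : nat) (a : nat -> C) :
  weighted_sum N a = rsum (fun k => Cmod (a (S k)) / (INR k + 2)) N.
Proof.
  unfold weighted_sum; induction N as [|N IH].
  - now rewrite sum_n_m_zero by lia.
  - rewrite sum_n_Sm, IH by lia; cbn [rsum]. rewrite S_INR.
    unfold plus; simpl. f_equal; f_equal; ring.
Qed.

Lemma mean_abs_mean (N : nat) (a : nat -> C) (lambda : nat -> R) (T : R) : 0 < T ->
  mean_abs N a lambda T =
  mean T (fun t => Cmod (csum (fun k => a (S k) * cis (2 * PI * lambda (S k) * t))%C N)).
Proof.
  intros HT; unfold mean_abs; apply (mean_ext T (fun t => Cmod (trig_sum N a lambda t))); auto.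
  intros; now rewrite trig_sum_csum.
Qed.

(** Agreement is asked only for T > 0, which is all that a limit at infinity sees and all that
    [mean_abs_mean] provides. *)
Lemma mean_cv_is_lim (f g : R -> R) (l : R) : (forall T, 0 < T -> g T = mean T f) ->
  mean_cv f l -> is_lim g p_infty l.
Proof.
  intros E H; apply is_lim_spec; intros e.
  destruct (H (e / 2)) as (T0 & HT0 & B); [generalize (cond_pos e); lra|].
  exists T0; intros T HT; rewrite E by lra.
  apply Rle_lt_trans with (e / 2); [apply B; lra | generalize (cond_pos e); lra].
Qed.

Theorem theorem1p1 (N : nat) (lambda : nat -> R) (a : nat -> C)
  (hN : (1 <= N)%nat)
  (hlambda : forall k l : nat,
     (1 <= k)%nat -> (k < l)%nat -> (l <= N)%nat -> lambda k < lambda l) :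
  (exists M : R, is_lim (mean_abs N a lambda) p_infty M /\
     M >= 1 / 26 * weighted_sum N a)
  /\
  ((forall k : nat, (1 <= k <= N)%nat -> Cmod (a k) >= 1) ->
   exists M : R, is_lim (mean_abs N a lambda) p_infty M /\
     M >= 4 / PI ^ 3 * ln (INR N))
  /\
  ((forall k l : nat, (1 <= k <= N)%nat -> (1 <= l <= N)%nat ->
      Rabs (lambda k - lambda l) >= Rabs (INR k - INR l)) ->
   forall T : R, T >= 72 ->
     mean_abs N a lambda T >= 1 / 122 * weighted_sum N a).
Proof.
  set (w := fun k => 2 * PI * lambda (S k)).
  assert (Hlam : forall k l, (k < l)%nat -> (l < N)%nat -> lambda (S k) < lambda (S l))
    by (intros; apply hlambda; lia).
  assert (Hw : forall k l, (k < l)%nat -> (l < N)%nat -> w k < w l).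
  { intros k l Hkl Hl; unfold w. apply Rmult_lt_compat_l; [generalize PI_RGT_0; lra | auto]. }
  (* The same limit [M] serves for both asymptotic inequalities. *)
  destruct (besicovitch_mean_exists (fun k => a (S k)) w N) as (M & HM).
  assert (HL : is_lim (mean_abs N a lambda) p_infty M).
  { eapply mean_cv_is_lim; [|exact HM]. intros; now apply mean_abs_mean. }
  rewrite weighted_sum_rsum.
  split; [|split].
  - exists M; split; [exact HL|]. apply Rle_ge.
    now apply (besicovitch_mean_ge_26 N (fun k => a (S k)) w).
  - intros Ha; exists M; split; [exact HL|]. apply Rle_ge.
    apply (besicovitch_mean_ge_ln N (fun k => a (S k)) w); auto.
    intros k Hk; apply Rge_le, Ha; lia.
  - intros Hgap T HT; apply Rle_ge. rewrite mean_abs_mean by lra.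
    apply (local_mean_ge_122 N (fun k => lambda (S k)) T); auto; [lra|].
    intros k l Hk Hl. apply Rge_le.
    replace (INR k - INR l) with (INR (S k) - INR (S l)) by (rewrite !S_INR; ring).
    apply Hgap; lia.
Qed.
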